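(* Let $V$ be a convex polynomial of even degree $p\ge 2$ and let $\beta>0$. (1) For any $c\in\mathbb R$ and $\mu\in M_1^p(\mathbb R^+)$, $$\lim_{\delta\searrow0,\ \delta'\searrow0}\ \liminf_{N\to\infty}\ \frac{2}{\beta N^2}\ln \mathbb P^N_{V,\beta}\big(\lambda_{(N)}\in[c-\delta',c+\delta'],\ \mu_N\in B_{W_p}(\mu,\delta)\big)\ \ge\ -\mathcal I_V(c,\mu).$$ (2) For any closed set $F\subset\mathbb R$ and $\mu\in M_1^p(\mathbb R^+)$, $$\lim_{\delta\searrow0}\ \limsup_{N\to\infty}\ \frac{2}{\beta N^2}\ln \mathbb P^N_{V,\beta}\big(\lambda_{(N)}\in F,\ \mu_N\in B_{W_p}(\mu,\delta)\big)\ \le\ -\inf_{c\in F}\mathcal I_V(c,\mu).$$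
   Context: Let $\mathbb P^N_{V,\beta}$ be the probability measure on $\mathbb R^N$ given by $$\mathbb P^N_{V,\beta}(d\lambda_1,\dots,d\lambda_N) = (Z^N_{V,\beta})^{-1}\,|\Delta(\lambda)|^\beta \exp\Big(-\frac{N\beta}{2}\sum_{k=1}^N V(\lambda_k)\Big)\prod_{k=1}^N d\lambda_k ,$$ where $\Delta(\lambda)=\prod_{i<j}(\lambda_j-\lambda_i)$ is the Vandermonde determinant and $Z^N_{V,\beta}$ is the normalizing constant. Let $\lambda_{(1)}<\dots<\lambda_{(N)}$ be the increasing rearrangement of $\lambda_1,\dots,\lambda_N$ (a.s. distinct). For $N\ge 2$ define the random probability measure on $\mathbb R^+=[0,\infty)$ $$\mu_N := \frac1{N-1}\sum_{k=1}^{N-1}\delta_{\lambda_{(N)}-\lambda_{(k)}} .$$ $M_1(E)$ denotes the set of Borel probability measures on $E$, and $M_1^p(E)$ the set of $\nu\in M_1(E)$ with $\int |x|^p d\nu(x)<\infty$. The Wasserstein distance is $d_{W_p}(\mu,\nu)=\big(\inf_{\pi\in\Pi(\mu,\nu)}\int |x-y|^p d\pi(x,y)\big)^{1/p}$, where $\Pi(\mu,\nu)$ is the set of couplings of $\mu$ and $\nu$. $B_{W_p}(\mu,\delta)$ is the $d_{W_p}$-ball in $M_1^p(\mathbb R^+)$ centered at $\mu$ with radius $\delta$. For a measure $\mu$ put $\Sigma(\mu)=\iint \ln|x-y|\,d\mu(x)d\mu(y)$, $c_V=\inf_{\nu}\big(-\Sigma(\nu)+\int V d\nu\big)$ (infimum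 over probability measures $\nu$ on $\mathbb R$ with $\int|V|d\nu<\infty$), and $I_V(\mu)=-\Sigma(\mu)+\int V d\mu-c_V$ if $\int|V|d\mu<\infty$, $I_V(\mu)=+\infty$ otherwise. For $c\in\mathbb R$, $\tau_c\mu$ is the probability defined by $\int f(x)\,\tau_c\mu(dx)=\int f(c-x)\,\mu(dx)$, and $$\mathcal I_V(c,\nu):=I_V(\tau_c\nu)=-\Sigma(\nu)+\int V(c-x)\,d\nu(x)-c_V .$$ *)

(* Defs.v *)
From HB Require Import structures.
From mathcomp Require Import all_boot all_order all_algebra.
From mathcomp Require Import all_classical all_reals all_analysis.
From mathcomp Require Import measurable_realfun.

Set Implicit Arguments.
Unset Strict Implicit.
Unset Printing Implicit Defensive.

Import Order.TTheory GRing.Theory Num.Theory.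
Import numFieldNormedType.Exports.

Local Open Scope classical_set_scope.
Local Open Scope ring_scope.

(* Lebesgue measure on n.-tuple R, built by iterating the binary product
   \x along the isomorphism R * R^n -> R^(n+1), (x, t) |-> x :: t. *)
Section lebesgue_tuple.
Context d (T : measurableType d) (n : nat).

Definition tuple_cons (z : T * n.-tuple T) : n.+1.-tuple T :=
  [tuple of z.1 :: z.2].

Definition tuple_uncons (t : n.+1.-tuple T) : T * n.-tuple T :=
  (thead t, [tuple of behead t]).

Lemma tuple_consK : cancel tuple_cons tuple_uncons.
Proof.
by move=> [x t]; rewrite /tuple_uncons /tuple_cons theadE; congr pair; exact/val_inj.
Qed.

Lemma tuple_unconsK : cancel tuple_uncons tuple_cons.
Proof. by move=> t; rewrite [RHS]tuple_eta. Qed.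

Lemma measurable_tuple_cons : measurable_fun [set: T * n.-tuple T] tuple_cons.
Proof. exact: measurable_cons. Qed.

Lemma measurable_tuple_uncons :
  measurable_fun [set: n.+1.-tuple T] tuple_uncons.
Proof.
apply: measurable_fun_pair; [exact: measurable_tnth|exact: measurable_behead].
Qed.

HB.instance Definition _ :=
  isMeasurableFun.Build _ _ _ _ tuple_cons measurable_tuple_cons.

Context (R : realType).
Variables (m1 : {sigma_finite_measure set T -> \bar R})
          (m2 : {sigma_finite_measure set (n.-tuple T) -> \bar R}).

Definition measure_cons : set (n.+1.-tuple T) -> \bar R :=
  pushforward (m1 \x m2)%E tuple_cons.

Let measure_cons0 : measure_cons set0 = 0%E.
Proof. exact: measure0. Qed.

Let measure_cons_ge0 A : (0 <= measure_cons A)%E.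
Proof. exact: measure_ge0. Qed.

Let measure_cons_sigma_additive : semi_sigma_additive measure_cons.
Proof. exact: measure_semi_sigma_additive. Qed.

HB.instance Definition _ := isMeasure.Build _ _ _ measure_cons
  measure_cons0 measure_cons_ge0 measure_cons_sigma_additive.

Lemma measure_cons_sigma_finite : sigma_finite setT measure_cons.
Proof.
have /sigma_finiteP[F [FT ndF Foo]] := sigma_finiteT m1.
have /sigma_finiteP[G [GT ndG Goo]] := sigma_finiteT m2.
exists (fun k => tuple_uncons @^-1` (F k `*` G k)).
  rewrite -preimage_bigcup (_ : \bigcup_k _ = setT) ?preimage_setT//.
  rewrite -subTset -setXTT FT GT => -[x y] [/= [n1 _ Fx] [k _ Gy]].
  exists (maxn n1 k) => //; split.
  - by move: x Fx; exact/subsetPset/ndF/leq_maxl.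
  - by move: y Gy; exact/subsetPset/ndG/leq_maxr.
move=> k; have [mF Fk] := Foo k; have [mG Gk] := Goo k.
have mFG : measurable (F k `*` G k) by exact: measurableX.
split.
  by rewrite -[X in measurable X]setTI; exact: measurable_tuple_uncons.
rewrite /measure_cons /pushforward -comp_preimage.
rewrite (_ : _ \o _ = id); last by apply/funext => z /=; rewrite tuple_consK.
by rewrite preimage_id product_measure1E// lte_mul_pinfty// ge0_fin_numE.
Qed.

HB.instance Definition _ := Measure_isSigmaFinite.Build _ _ _ measure_cons
  measure_cons_sigma_finite.

End lebesgue_tuple.

Section ensemble.
Context {R : realType}.
Local Notation RR := (measurableTypeR R).
Local Open Scope ereal_scope.

Fixpoint lebesgue_tuple (n : nat) :
    {sigma_finite_measure set (n.-tuple RR) -> \bar R} :=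
  if n is n'.+1 then
    [the {sigma_finite_measure set (n'.+1.-tuple RR) -> \bar R}
     of measure_cons lebesgue_measure (lebesgue_tuple n')]
  else
    [the {sigma_finite_measure set (0.-tuple RR) -> \bar R}
     of \d_([tuple] : 0.-tuple RR)].

Definition vandermonde N (lam : N.-tuple RR) : R :=
  (\prod_(i < N) \prod_(j < N | (i < j)%N)
    ((tnth lam j : R) - (tnth lam i : R)))%R.

Definition gibbs_density (V : R -> R) (beta : R) N (lam : N.-tuple RR) : R :=
  (`|vandermonde lam| `^ beta *
   expR (- (N%:R * beta / 2) * \sum_(k < N) V (tnth lam k)))%R.

Definition partition_function (V : R -> R) (beta : R) N : \bar R :=
  \int[lebesgue_tuple N]_lam (gibbs_density V beta lam)%:E.

Definition gibbs (V : R -> R) (beta : R) N (A : set (N.-tuple RR)) : \bar R :=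
  (partition_function V beta N)^-1 *
  \int[lebesgue_tuple N]_(lam in A) (gibbs_density V beta lam)%:E.

(* k is counted from 1: order_stat lam 1 <= ... <= order_stat lam N. *)
Definition order_stat N (lam : N.-tuple RR) (k : nat) : R :=
  nth 0%R (sort <=%R (lam : seq R)) k.-1.

(* mnormalize divides by the total mass, which is N - 1; its second argument is
   only a default value for N < 2. *)
Definition gap_measure N (lam : N.-tuple RR) : probability RR R :=
  mnormalize
    (msum (fun k => \d_(order_stat lam N - order_stat lam k.+1 : RR)%R) N.-1)
    \d_(0%R : RR).

Lemma gap_measureE N (lam : N.-tuple RR) (A : set RR) : (1 < N)%N ->
  gap_measure lam A =
  ((N.-1)%:R^-1)%:E *
  \sum_(k < N.-1) \d_(order_stat lam N - order_stat lam k.+1 : RR)%R A.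
Proof.
move=> N1; rewrite /gap_measure /= /mnormalize /=.
have -> : msum (fun k => \d_(order_stat lam N - order_stat lam k.+1 : RR)%R)
    N.-1 [set: RR] = ((N.-1)%:R : R)%:E.
  rewrite /msum (eq_bigr (fun=> 1%:E)) ?sumEFin ?sumr_const ?card_ord//.
  by move=> k _ /=; rewrite diracT.
have N0 : ((N.-1)%:R : R)%R != 0%R by rewrite pnatr_eq0; case: N N1 {lam} => [|[]].
by rewrite eqe (negbTE N0) /= muleC.
Qed.

(* M_1^p(R^+), its elements being identified with the Borel probability
   measures on R that are carried by [0, +oo[. *)
Definition M1plus (p : nat) : set (probability RR R) :=
  [set nu : probability RR R | nu `[0%R, +oo[%classic = 1 /\
            \int[nu]_x (`|x : R| ^+ p)%:E < +oo].

Definition couplings (mu nu : probability RR R) :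
    set (probability (RR * RR)%type R) :=
  [set pi : probability (RR * RR)%type R | forall A : set RR, measurable A ->
              pi (fst @^-1` A) = mu A /\ pi (snd @^-1` A) = nu A].

Definition wasserstein (p : nat) (mu nu : probability RR R) : \bar R :=
  (ereal_inf [set \int[pi]_z (`|(z.1 : R) - (z.2 : R)| ^+ p)%:E
             | pi in couplings mu nu]) `^ p%:R^-1.

Definition ball_wasserstein (p : nat) (mu : probability RR R) (delta : R) :
    set (probability RR R) :=
  [set nu : probability RR R | M1plus p nu /\ wasserstein p mu nu < delta%:E].

(* lne is -oo at 0, whereas ln 0 = 0. *)
Definition log_energy (mu : probability RR R) : \bar R :=
  \int[mu \x mu]_z lne `|(z.1 : R) - (z.2 : R)|%:E.

Definition V_integrable (V : R -> R) (mu : probability RR R) : Prop :=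
  \int[mu]_x `|V x|%:E < +oo.

Definition cV (V : R -> R) : \bar R :=
  ereal_inf [set - log_energy nu + \int[nu]_x (V x)%:E
            | nu in V_integrable V].

Definition rate (V : R -> R) (mu : probability RR R) : \bar R :=
  if `[< V_integrable V mu >] then
    - log_energy mu + \int[mu]_x (V x)%:E - cV V
  else +oo.

Definition sub_from (c : R) (x : RR) : RR := (c - (x : R))%R.

Lemma measurable_sub_from (c : R) : measurable_fun [set: RR] (sub_from c).
Proof. exact: measurable_funB. Qed.

HB.instance Definition _ (c : R) :=
  isMeasurableFun.Build _ _ _ _ (sub_from c) (measurable_sub_from c).

Definition tau (c : R) (mu : probability RR R) : probability RR R :=
  distribution mu (sub_from c).

Definition joint_rate (V : R -> R) (c : R) (nu : probability RR R) : \bar R :=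
  rate V (tau c nu).

End ensemble.

(* Main.v *)
(* Choose b so that W = V + b dominates a |x|^p, and B so that the kernel
   k(x, y) = (W x + W y)/2 + B - ln |x - y| is nonnegative.  Up to a factor that is
   common to the partition function and to the integrals over events, the density
   is exp(-(beta/2) sum_{i != j} k(x_i, x_j)) prod_i exp(-(beta/2) W(x_i)), and I_V is
   the energy iint k dnu dnu minus its infimum.  Everything then reduces to bounds,
   at the scale N^2 of the exponent, on integrals of this density.

   Lower bounds.  A measure of finite energy has no atom, hence can be cut into M
   cells of equal mass; averaging over one independent point per cell produces
   points whose discrete energy and transport cost are both small.  Spreading these
   points by at most d, which costs little since W is convex of polynomial growth,
   leaves room for a box of side d/(3M), whose volume is only exp(-O(N ln N)).  For
   the event, the largest particle is put just to the right of c.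

   Upper bounds.  For the partition function, smearing the atoms of a configuration
   over intervals of length N^-2 gives a measure whose energy is at most the discrete
   one, up to errors o(N^2).  For the event, the kernel is truncated near the
   diagonal; the truncated kernel changes by at most a small multiple of itself plus
   a multiple of |x - y|^p, so a coupling of small cost carries it from the gap
   measure to mu.  The truncation is removed by monotone convergence, uniformly in c
   because under translation the truncated and the full energies vary by the same
   integral of W. *)

Require Import Defs.
From HB Require Import structures.
From mathcomp Require Import all_boot all_order all_algebra.
From mathcomp Require Import all_classical all_reals all_analysis.
From mathcomp Require Import measurable_realfun ring lra.

Set Implicit Arguments.
Unset Strict Implicit.
Unset Printing Implicit Defensive.

Import Order.TTheory GRing.Theory Num.Theory.
Import numFieldNormedType.Exports.

Local Open Scope classical_set_scope.
Local Open Scope ring_scope.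

(** * Potentials *)

(** The potential enters the density [N] times per particle, but the ordered pairs absorb only
    [N - 1] of these copies; the last one is the product weight, which makes every integral over
    [R^N] finite at a price [m ^ N], invisible at the scale [N ^ 2]. The degree of [V] is the
    exponent of the Wasserstein distance, so the transport cost controls the potential part of the
    energy, which weak convergence would not. The logarithm is the obstacle: an empirical measure
    has infinite energy because of its diagonal. Each direction is therefore one-sided: truncation
    only lowers the kernel and costs about [m] per diagonal term, and smearing never shrinks the
    distance between two particles. As [F] may be unbounded, the truncation level has to serve all
    [c] at once. Errors on [W] are taken relative to [W], hence to the kernel, which keeps a share
    of the potential after the logarithm has been dominated; this replaces a restriction to compact
    sets. No minimiser of the energy is constructed: near-minimisers suffice for the partition
    function, whose two bounds meet at the infimum. *)

Section powers.
Context {R : realType}.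
Implicit Types x y eta : R.

Lemma exprn_add_le (p : nat) x y : 0 <= x -> 0 <= y ->
  (x + y) ^+ p <= 2 ^+ p * (x ^+ p + y ^+ p).
Proof.
move=> x0 y0; wlog xy : x y x0 y0 / x <= y.
  move=> h; have [xy|/ltW yx] := leP x y; first exact: h.
  by rewrite addrC [x ^+ p + _]addrC; exact: h.
have : (x + y) ^+ p <= (2 * y) ^+ p.
  by rewrite lerXn2r ?nnegrE ?mulr_ge0 ?addr_ge0//; lra.
move=> /le_trans; apply; rewrite exprMn ler_wpM2l ?exprn_ge0//.
by rewrite lerDr exprn_ge0.
Qed.

Lemma exprn_le1D (n k : nat) x : (n <= k)%N -> 0 <= x -> x ^+ n <= 1 + x ^+ k.
Proof.
move=> nk x0; have [x1|/ltW x1] := leP x 1.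
  by apply: (@le_trans _ _ 1); [exact: exprn_ile1|rewrite lerDl exprn_ge0].
apply: (@le_trans _ _ (x ^+ k)); first exact: ler_weXn2l.
by rewrite lerDr.
Qed.

Lemma exprn_le_eps (p : nat) eta x : 0 < eta -> 0 <= x ->
  x ^+ p <= eta * x ^+ p.+1 + eta^-1 ^+ p.
Proof.
move=> eta0 x0; have [h|/ltW h] := leP (eta * x) 1.
  have : x ^+ p <= eta^-1 ^+ p.
    by rewrite lerXn2r ?nnegrE ?invr_ge0 ?(ltW eta0)// -[leRHS]mulr1 mulrC
      ler_pdivlMr// mulrC.
  move=> /le_trans; apply; rewrite lerDr mulr_ge0 ?exprn_ge0//; exact: ltW.
have xp : x ^+ p <= eta * x * x ^+ p by rewrite ler_peMl ?exprn_ge0.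
by rewrite exprS mulrA (le_trans xp)// lerDl exprn_ge0// invr_ge0 ltW.
Qed.

Lemma ln_lipschitz x y e : 0 < e -> e <= x -> e <= y ->
  ln x - ln y <= `|x - y| / e.
Proof.
move=> e0 ex ey; have x0 := lt_le_trans e0 ex; have y0 := lt_le_trans e0 ey.
rewrite -ln_div ?posrE//.
have -> : x / y = 1 + (x - y) / y by field; rewrite gt_eqF.
apply: le_trans (le_ln1Dx _) _.
  rewrite ltr_pdivlMr//; lra.
apply: (@le_trans _ _ (`|x - y| / y)).
  by rewrite ler_wpM2r ?invr_ge0 ?(ltW y0)// ler_norm.
by rewrite ler_wpM2l// lef_pV2 ?posrE.
Qed.

End powers.

Section confining.
Context {R : realType}.

(* The functions [W >= 0] to which the potential is reduced, with the only form
   of regularity used: [W] oscillates little, relatively to its size, up to a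
   multiple of the Wasserstein cost. [B] compensates the logarithm at infinity. *)
Record confining (p : nat) (W : R -> R) (a B : R) : Prop := Confining {
  conf_p : (2 <= p)%N;
  conf_a : 0 < a;
  conf_meas : measurable_fun [set: measurableTypeR R] W;
  conf_ge : forall x, a * `|x| ^+ p <= W x;
  conf_le : exists2 C, 0 <= C & forall x, W x <= C * (1 + `|x| ^+ p);
  conf_reg : forall eta, 0 < eta -> exists2 C, 0 <= C &
    forall u v, W v <= W u + eta * (1 + W v) + C * `|u - v| ^+ p;
  conf_B : 0 <= B;
  conf_ln : forall x y,
    ln (Num.max `|x - y| 1) <= (W x + W y) / 4 + B
}.

(** Convexity does the work of a derivative bound: [v] lies between [u] and a far point [w], so
    [W v <= (1 - t) * W u + t * W w], and polynomial growth bounds [W w] by multiples of [1 + W v]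
    and [|u - v| ^ p]. A small [t] makes the first contribution negligible and only enlarges the
    constant of the second. *)
Lemma convex_reg (p : nat) (W : R -> R) (a C : R) : 0 < a ->
  (forall t x y, 0 <= t <= 1 ->
     W ((1 - t) * x + t * y) <= (1 - t) * W x + t * W y) ->
  (forall x, a * `|x| ^+ p <= W x) ->
  0 <= C -> (forall x, W x <= C * (1 + `|x| ^+ p)) ->
  forall eta, 0 < eta -> exists2 D, 0 <= D &
    forall u v, W v <= W u + eta * (1 + W v) + D * `|u - v| ^+ p.
Proof.
move=> a0 Wc Wge C0 Wle eta eta0.
have W0 x : 0 <= W x by apply: le_trans (Wge x); rewrite mulr_ge0// ltW.
(* [K] is the coefficient of [1 + W v] in the bound for [W w]; [t] is then chosen with
   [t * K <= eta] and [t <= 1]. *)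
pose K := C * (1 + 2 ^+ p * (1 + a^-1)).
have K0 : 0 <= K.
  by rewrite mulr_ge0// addr_ge0// mulr_ge0// addr_ge0// invr_ge0 ltW.
pose t := eta / (1 + K + eta).
have d0 : 0 < 1 + K + eta by lra.
have t0 : 0 < t by rewrite divr_gt0.
have t1 : t <= 1 by rewrite ler_pdivrMr// mul1r; lra.
have tK : t * K <= eta.
  rewrite /t mulrAC ler_pdivrMr// ler_wpM2l ?(ltW eta0)//; lra.
exists (C * 2 ^+ p * t^-1 ^+ p).
  by rewrite !mulr_ge0// exprn_ge0// invr_ge0 ltW.
move=> u v.
pose w := u + (v - u) / t.
have -> : W v = W ((1 - t) * u + t * w).
  by congr W; rewrite /w; field; rewrite gt_eqF.
have vE : (1 - t) * u + t * w = v by rewrite /w; field; rewrite gt_eqF.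
apply: le_trans (Wc t u w _) _; first by rewrite (ltW t0).
rewrite vE.
have h1 : (1 - t) * W u <= W u.
  by rewrite mulrBl mul1r lerBlDr lerDl mulr_ge0// ltW.
have nw : `|w| ^+ p <= 2 ^+ p * (`|v| ^+ p + t^-1 ^+ p * `|u - v| ^+ p).
  rewrite -exprMn; apply: le_trans (exprn_add_le p _ _) => //; last first.
    by rewrite mulr_ge0// invr_ge0 ltW.
  rewrite lerXn2r ?nnegrE ?addr_ge0 ?mulr_ge0 ?invr_ge0 ?(ltW t0)//.
  have -> : w = v + (t^-1 - 1) * (v - u) by rewrite /w; field; rewrite gt_eqF.
  apply: le_trans (ler_normD _ _) _; rewrite lerD2l normrM (distrC v) ler_wpM2r//.
  have it : 1 <= t^-1 by rewrite -[1]invr1 lef_pV2 ?posrE.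
  by rewrite ger0_norm; lra.
have vp : `|v| ^+ p <= a^-1 * W v by rewrite -ler_pdivrMl ?invr_gt0// invrK.
have h2 : t * W w <= eta * (1 + W v) + C * 2 ^+ p * t^-1 ^+ p * `|u - v| ^+ p.
  set X := t^-1 ^+ p * `|u - v| ^+ p in nw.
  have X0 : 0 <= X by rewrite mulr_ge0// exprn_ge0// invr_ge0 ltW.
  have -> : C * 2 ^+ p * t^-1 ^+ p * `|u - v| ^+ p = C * 2 ^+ p * X.
    by rewrite /X !mulrA.
  apply: (@le_trans _ _ (t * (K * (1 + W v) + C * 2 ^+ p * X))).
    rewrite ler_wpM2l ?(ltW t0)//; apply: (le_trans (Wle w)).
    rewrite /K -[C * _ * (1 + _)]mulrA -[C * _ * X]mulrA -mulrDr ler_wpM2l//.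
    have -> : (1 + 2 ^+ p * (1 + a^-1)) * (1 + W v) + 2 ^+ p * X =
      1 + W v + 2 ^+ p * (1 + W v + a^-1 + a^-1 * W v + X) by ring.
    have ia : 0 <= a^-1 by rewrite invr_ge0 ltW.
    have : 2 ^+ p * (`|v| ^+ p + X) <= 2 ^+ p * (1 + W v + a^-1 + a^-1 * W v + X).
      by rewrite ler_wpM2l// lerD2r; have := W0 v; lra.
    by have := W0 v; move: nw; lra.
  rewrite mulrDr lerD//.
    by rewrite mulrA ler_wpM2r// addr_ge0.
  by rewrite ler_piMl// mulr_ge0// mulr_ge0// exprn_ge0.
by rewrite -addrA lerD.
Qed.

(** As [ln r <= r], it suffices to absorb [|x| + |y|], whose degree is below [p]. The factor 1/4,
    against 1/2 in the kernel, keeps half of the potential in reserve, so that the kernel will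
    control [W]. *)
Lemma log_domination (p : nat) (W : R -> R) (a : R) : (2 <= p)%N -> 0 < a ->
  (forall x, a * `|x| ^+ p <= W x) ->
  exists2 B, 0 <= B &
    forall x y, ln (Num.max `|x - y| 1) <= (W x + W y) / 4 + B.
Proof.
move=> p2 a0 Wge.
have W0 x : 0 <= W x by apply: le_trans (Wge x); rewrite mulr_ge0// ltW.
have a40 : 0 < a / 4 by lra.
exists (2 * (1 + (a / 4)^-1 ^+ p.-1)).
  by rewrite mulr_ge0// addr_ge0// exprn_ge0// invr_ge0; lra.
have abs x : `|x| <= W x / 4 + (1 + (a / 4)^-1 ^+ p.-1).
  have h1 : `|x| <= 1 + `|x| ^+ p.-1.
    by rewrite -[leLHS]expr1 exprn_le1D//; case: p p2 {Wge} => [|[]].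
  have := exprn_le_eps p.-1 a40 (normr_ge0 x).
  rewrite prednK ?(leq_trans _ p2)// => h2.
  by have := Wge x; lra.
move=> x y; rewrite maxEle; case: ifPn => [_|].
  rewrite ln1 addr_ge0// ?divr_ge0 ?addr_ge0//.
  by rewrite mulr_ge0// addr_ge0// exprn_ge0// invr_ge0; lra.
rewrite -ltNge => xy1.
have /ltW h := ln_sublinear (lt_trans ltr01 xy1).
have := ler_normB x y; have := abs x; have := abs y; lra.
Qed.

Lemma sum_horner_le (q : {poly R}) (n : nat) x : size q = n.+1 ->
  `|q.[x] - lead_coef q * x ^+ n| <= (\sum_(i < n) `|q`_i|) * (1 + `|x| ^+ n.-1).
Proof.
move=> qn; rewrite horner_coef qn big_ord_recr/= lead_coefE qn/= addrK.
apply: le_trans (ler_norm_sum _ _ _) _; rewrite mulr_suml ler_sum// => i _.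
rewrite normrM normrX ler_wpM2l// exprn_le1D//.
by have := ltn_ord i; case: n {qn} i => // -[].
Qed.

(** A negative leading coefficient would, the degree being even, send [V] to minus infinity on both
    sides, against convexity at the midpoint 0. Once it is positive, half of the leading term
    absorbs all the others. *)
Lemma convex_even_poly_coercive (p : nat) (V : {poly R}) : (2 <= p)%N -> ~~ odd p ->
  size V = p.+1 ->
  (forall t x y, 0 <= t <= 1 ->
     V.[(1 - t) * x + t * y] <= (1 - t) * V.[x] + t * V.[y]) ->
  exists2 ab : R * R, 0 < ab.1 & 0 <= ab.2 /\
    forall x, ab.1 * `|x| ^+ p <= V.[x] + ab.2.
Proof.
move=> p2 pe sV Vc; pose S : R := \sum_(i < p) `|V`_i|.
have S0 : 0 <= S by apply: sumr_ge0.
have pp : p.-1.+1 = p by rewrite prednK// (leq_trans _ p2).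
have lead (x : R) : `|V.[x] - lead_coef V * `|x| ^+ p| <= S * (1 + `|x| ^+ p.-1).
  have -> : `|x| ^+ p = x ^+ p.
    by rewrite -normrX ger0_norm// exprn_even_ge0.
  exact: sum_horner_le.
have eps (eta x : R) : 0 < eta ->
    S * `|x| ^+ p.-1 <= S * eta * `|x| ^+ p + S * eta^-1 ^+ p.-1.
  move=> eta0; rewrite -mulrA -mulrDr ler_wpM2l//.
  by have := exprn_le_eps p.-1 eta0 (normr_ge0 x); rewrite pp.
have l0 : 0 < lead_coef V.
  rewrite lt_neqAle eq_sym lead_coef_eq0 -size_poly_eq0 sV/= leNgt.
  apply/negP => ln0.
  pose l : R := - lead_coef V; have lp : 0 < l by rewrite oppr_gt0.
  pose eta : R := l / (2 * (S + 1)).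
  have eta0 : 0 < eta by rewrite divr_gt0// mulr_gt0//; lra.
  have Se : S * eta <= l / 2.
    rewrite /eta (_ : S * _ = (l / 2) * (S / (S + 1))); last first.
      by field; rewrite gt_eqF//; lra.
    rewrite ler_piMr//; first lra.
    by rewrite ler_pdivrMr; lra.
  pose D : R := S + S * eta^-1 ^+ p.-1.
  have Vle (x : R) : V.[x] <= - (l / 2) * `|x| ^+ p + D.
    have /ler_normlP[_ h1] := lead x; have h2 := eps eta x eta0.
    have h3 : S * eta * `|x| ^+ p <= l / 2 * `|x| ^+ p by rewrite ler_wpM2r.
    by move: h1; rewrite /D /l; rewrite /l in h3; lra.
  (* Chosen so that [l / 2 * x] exceeds the sum of the absolute values of [V.[0]] and [D], which
     puts both [V.[x]] and [V.[- x]] below [V.[0]]. *)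
  pose x : R := 1 + (`|V.[0]| + `|D|) * 2 / l.
  have x1 : 1 <= x by rewrite lerDl divr_ge0 ?(ltW lp)// mulr_ge0// addr_ge0.
  have xp : x <= `|x| ^+ p.
    rewrite ger0_norm; last lra.
    by rewrite -[leLHS]expr1 ler_weXn2l// (leq_trans _ p2).
  have h0 : V.[0] <= (V.[x] + V.[- x]) / 2.
    have := Vc (1 / 2) x (- x).
    rewrite (_ : (1 - 1 / 2) * x + 1 / 2 * (- x) = 0); last by field.
    by move=> /(_ ltac:(lra)); lra.
  have := Vle x; have := Vle (- x); rewrite normrN => h1 h2.
  have : l / 2 * x <= l / 2 * `|x| ^+ p by rewrite ler_wpM2l//; lra.
  have -> : l / 2 * x = l / 2 + (`|V.[0]| + `|D|).
    by rewrite /x; field; rewrite gt_eqF.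
  have := ler_norm (- V.[0]); rewrite normrN; have := ler_norm D; lra.
set l := lead_coef V in l0 lead.
pose eta : R := l / (2 * (S + 1)).
have eta0 : 0 < eta by rewrite divr_gt0// mulr_gt0//; lra.
have Se : S * eta <= l / 2.
  rewrite /eta (_ : S * _ = (l / 2) * (S / (S + 1))); last first.
    by field; rewrite gt_eqF//; lra.
  rewrite ler_piMr//; first lra.
  by rewrite ler_pdivrMr; lra.
exists (l / 2, S + S * eta^-1 ^+ p.-1) => /=; first lra.
split; first by rewrite addr_ge0// mulr_ge0// exprn_ge0// invr_ge0 ltW.
move=> x; have /ler_normlP[h1 _] := lead x; have h2 := eps eta x eta0.
have h3 : S * eta * `|x| ^+ p <= l / 2 * `|x| ^+ p by rewrite ler_wpM2r.
by move: h1; lra.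
Qed.

Lemma convex_even_poly_confining (p : nat) (V : {poly R}) : (2 <= p)%N -> ~~ odd p ->
  size V = p.+1 ->
  (forall t x y, 0 <= t <= 1 ->
     V.[(1 - t) * x + t * y] <= (1 - t) * V.[x] + t * V.[y]) ->
  exists a b B, 0 <= b /\ confining p (fun x => V.[x] + b) a B.
Proof.
move=> p2 pe sV Vc.
have [[a b]/= a0 [b0 Wge]] := convex_even_poly_coercive p2 pe sV Vc.
have [B B0 hB] := log_domination p2 a0 Wge.
pose C := (\sum_(i < p.+1) `|V`_i|) + b.
have C0 : 0 <= C by rewrite addr_ge0//; apply: sumr_ge0.
have Wle x : V.[x] + b <= C * (1 + `|x| ^+ p).
  rewrite mulrDl lerD//; last by rewrite ler_peMr// lerDl exprn_ge0.
  rewrite horner_coef sV mulr_suml ler_sum// => i _.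
  apply: le_trans (ler_norm _) _; rewrite normrM normrX ler_wpM2l//.
  by rewrite exprn_le1D// -ltnS ltn_ord.
exists a, b, B; split => //; split => //.
- apply: measurable_funD => //; apply: continuous_measurable_fun.
  exact: continuous_horner.
- by exists C.
- apply: (convex_reg a0 _ Wge C0 Wle) => t x y t01.
  by have := Vc t x y t01; lra.
Qed.

End confining.

(** * The interaction kernel *)

Section kernels.
Context {R : realType}.
Variables (W : R -> R) (B : R).
Local Notation RR := (measurableTypeR R).

(** The parameter is the height of the truncation, not its distance [expR (- m)]: the diagonal value
    is [W x + B + m], and the kernels increase with [m] to [kern]. *)
Definition kcut (m x y : R) : R :=
  (W x + W y) / 2 + B - ln (Num.max `|x - y| (expR (- m))).

Definition kreal (x y : R) : R := (W x + W y) / 2 + B - ln `|x - y|.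

(* Unlike [kreal], for which the junk value [ln 0 = 0] matters, the
   interaction kernel is infinite on the diagonal. *)
Definition kern (x y : R) : \bar R := if x == y then +oo%E else (kreal x y)%:E.

Lemma kcutE m x y :
  kcut m x y = (W x + W y) / 2 + B - ln (Num.max `|x - y| (expR (- m))).
Proof. by []. Qed.

Lemma krealE x y : kreal x y = (W x + W y) / 2 + B - ln `|x - y|.
Proof. by []. Qed.

Lemma kreal_sym x y : kreal x y = kreal y x.
Proof. by rewrite /kreal (addrC (W x)) distrC. Qed.

Lemma kern_sym x y : kern x y = kern y x.
Proof. by rewrite /kern eq_sym kreal_sym. Qed.

Lemma kernxx x : kern x x = +oo%E.
Proof. by rewrite /kern eqxx. Qed.

Lemma kernE x y : x != y -> kern x y = (kreal x y)%:E.
Proof. by rewrite /kern => /negbTE ->. Qed.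

Lemma kern_lne x y :
  kern x y = (((W x + W y) / 2 + B)%:E - lne `|x - y|%:E)%E.
Proof.
rewrite /kern; case: eqVneq => [->|xy]; first by rewrite subrr normr0 le0_lneNy.
by rewrite lne_EFin ?normr_gt0 ?subr_eq0// -EFinB.
Qed.

Lemma kcut_diag m x : kcut m x x = W x + B + m.
Proof.
rewrite /kcut subrr normr0 max_r ?expR_ge0// expRK opprK; congr (_ + _ + _).
by field.
Qed.

Lemma kcut_le_kreal m x y : x != y -> kcut m x y <= kreal x y.
Proof.
move=> xy; rewrite lerD2l lerN2 ler_ln ?posrE ?le_max ?lexx//.
  by rewrite normr_gt0 subr_eq0.
by rewrite lt_max expR_gt0 orbT.
Qed.

Lemma kcut_le_kern m x y : ((kcut m x y)%:E <= kern x y)%E.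
Proof.
rewrite /kern; case: eqVneq => [->|xy]; first by rewrite leey.
by rewrite lee_fin kcut_le_kreal.
Qed.

Lemma kcut_nd m m' x y : m <= m' -> kcut m x y <= kcut m' x y.
Proof.
move=> mm'; rewrite lerD2l lerN2 ler_ln ?posrE ?lt_max ?expR_gt0 ?orbT//.
by rewrite ge_max !le_max lexx/= ler_expR lerN2 mm' orbT.
Qed.

Lemma cvg_kcut x y : (kcut n%:R x y)%:E @[n --> \oo] --> kern x y.
Proof.
rewrite /kern; case: eqVneq => [->|xy].
  apply/cvgeyPge => A; near=> n; rewrite kcut_diag lee_fin.
  rewrite -lerBlDl; near: n; exact: nbhs_infty_ger.
apply/cvg_EFin; first exact: nearW.
have xy0 : 0 < `|x - y| by rewrite normr_gt0 subr_eq0.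
apply: cvg_near_cst; near=> n => /=; rewrite /kcut /kreal max_l//.
rewrite -ler_ln ?posrE ?expR_gt0// expRK lerNl; near: n.
exact: nbhs_infty_ger.
Unshelve. all: by end_near. Qed.

Hypothesis mW : measurable_fun [set: RR] W.

Lemma measurable_kcut m :
  measurable_fun [set: RR * RR] (fun z => kcut m z.1 z.2).
Proof.
apply: measurable_funB.
  apply: measurable_funD => //; apply: measurable_funM => //.
  by apply: measurable_funD; apply: measurableT_comp.
apply: measurableT_comp; first exact: measurable_ln.
apply: measurable_maxr => //; apply: measurableT_comp => //.
exact: measurable_funB.
Qed.

Lemma measurable_kern :
  measurable_fun [set: RR * RR] (fun z => kern z.1 z.2).
Proof.
apply: (emeasurable_fun_cvg
    (fun n (z : RR * RR) => (kcut n%:R z.1 z.2)%:E)) => /=.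
  by move=> n; apply/measurable_EFinP; exact: measurable_kcut.
by move=> z _; exact: cvg_kcut.
Qed.

Lemma measurable_kern2 x : measurable_fun [set: RR] (fun y : RR => kern x y).
Proof. exact: (measurableT_comp measurable_kern (measurable_pair1 x)). Qed.

Lemma measurable_kcut2 m x : measurable_fun [set: RR] (fun y : RR => kcut m x y).
Proof.
exact: (measurableT_comp (measurable_kcut m) (measurable_pair1 x)).
Qed.

End kernels.

Section confining_kernel.
Context {R : realType} (p : nat) (W : R -> R) (a B : R).
Hypothesis cf : confining p W a B.
Local Notation kcut := (kcut W B).
Local Notation kreal := (kreal W B).
Local Notation kern := (kern W B).

Lemma confining_ge0 x : 0 <= W x.
Proof.
by apply: le_trans (conf_ge cf x); rewrite mulr_ge0// ltW ?(conf_a cf).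
Qed.

(** For [m >= 0] the truncation distance is at most 1, so [conf_ln] applies. Beyond positivity, this
    is what turns errors on [W] into relative errors on the kernel. *)
Lemma kcut_ge m x y : 0 <= m -> (W x + W y) / 4 <= kcut m x y.
Proof.
move=> m0; rewrite /kcut.
have h : ln (Num.max `|x - y| (expR (- m))) <= ln (Num.max `|x - y| 1).
  rewrite ler_ln ?posrE ?lt_max ?ltr01 ?expR_gt0 ?orbT//.
  by rewrite ge_max !le_max lexx/= expR_le1 oppr_le0 m0 orbT.
by have := conf_ln cf x y; lra.
Qed.

Lemma kcut_ge0 m x y : 0 <= m -> 0 <= kcut m x y.
Proof.
move=> m0; apply: le_trans (kcut_ge x y m0).
by rewrite divr_ge0// addr_ge0// confining_ge0.
Qed.

Lemma kreal_ge x y : x != y -> (W x + W y) / 4 <= kreal x y.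
Proof. by move=> xy; exact: le_trans (kcut_ge x y (lexx 0)) (kcut_le_kreal _ _ _ xy). Qed.

Lemma kern_ge0 x y : (0 <= kern x y)%E.
Proof.
by apply: le_trans (kcut_le_kern W B 0 x y); rewrite lee_fin kcut_ge0.
Qed.

(** When no distance shrinks, the logarithm can only help, so no modulus of continuity of [ln] near
    0 enters; the change of [W] is absorbed by [kreal_ge]. *)
Lemma kreal_spread eta x y x' y' : 0 < eta -> x != y -> `|x - y| <= `|x' - y'| ->
  W x' <= (1 + eta) * W x + eta -> W y' <= (1 + eta) * W y + eta ->
  kreal x' y' <= (1 + 2 * eta) * kreal x y + eta.
Proof.
move=> eta0 xy d wx wy.
have xy0 : 0 < `|x - y| by rewrite normr_gt0 subr_eq0.
have h : ln `|x - y| <= ln `|x' - y'|.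
  by rewrite ler_ln ?posrE// (lt_le_trans xy0).
have k1 : kreal x' y' <= kreal x y + eta * ((W x + W y) / 2) + eta.
  by rewrite /kreal; lra.
have k2 : eta * ((W x + W y) / 2) <= eta * (2 * kreal x y).
  by rewrite ler_wpM2l ?(ltW eta0)//; have := kreal_ge xy; lra.
lra.
Qed.

(** In [conf_reg] the term [W v] stands on both sides; the choice of [e] gives
    [(1 - e) * (1 + eta) = 1 + eta / 2], so that solving for it costs no more than [1 + eta]. *)
Lemma confining_shift eta : 0 < eta -> exists2 d, 0 < d &
  forall x y, `|x - y| <= d -> W y <= (1 + eta) * W x + eta.
Proof.
move=> eta0; pose e := eta / (2 * (1 + eta)).
have e0 : 0 < e by rewrite divr_gt0//; lra.
have [C C0 hC] := conf_reg cf e0.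
pose d := Num.min 1 (e / (1 + C)).
have d0 : 0 < d by rewrite lt_min ltr01 divr_gt0//; lra.
exists d => // x y xy.
have Cd : C * `|x - y| ^+ p <= e.
  apply: (@le_trans _ _ (C * (e / (1 + C)))).
    rewrite ler_wpM2l//; apply: (@le_trans _ _ (`|x - y| ^+ 1)).
      apply: ler_wiXn2l => //; last by have := conf_p cf; case: (p).
      by apply: le_trans xy _; rewrite ge_min lexx.
    by rewrite expr1; apply: le_trans xy _; rewrite ge_min lexx orbT.
  rewrite mulrA ler_pdivrMr; nra.
have h := hC x y.
have {}h : (1 - e) * W y <= W x + 2 * e by lra.
have e1 : 0 < 1 - e.
  rewrite subr_gt0 ltr_pdivrMr; lra.
have ee : (1 - e) * (1 + eta) >= 1.
  by rewrite (_ : (1 - e) * (1 + eta) = 1 + eta / 2); [lra|rewrite /e; field; lra].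
rewrite -(ler_pM2l e1); apply: (le_trans h).
have -> : (1 - e) * ((1 + eta) * W x + eta) =
   ((1 - e) * (1 + eta)) * W x + (1 - e) * eta by ring.
apply: lerD; first by rewrite ler_peMl ?confining_ge0.
have -> : e = eta / 2 / (1 + eta) by rewrite /e; field; lra.
have -> : (1 - eta / 2 / (1 + eta)) * eta = (eta * (1 + eta / 2)) / (1 + eta).
  by field; lra.
rewrite mulrA ler_pM2r ?invr_gt0; nra.
Qed.

(** Lipschitz errors have degree one whereas the transport cost has degree [p]; above the threshold
    [e] the first is at most a multiple of the second. *)
Lemma le_eps_exprn (e : R) : 0 < e -> exists2 D : R, 0 <= D &
  forall t : R, 0 <= t -> t <= e + D * t ^+ p.
Proof.
move=> e0; have ie0 : 0 <= e^-1 by rewrite invr_ge0 ltW.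
exists (e^-1 ^+ p.-1); first by rewrite exprn_ge0.
move=> t t0; have [te|/ltW te] := leP t e.
  by rewrite (le_trans te)// lerDl mulr_ge0// exprn_ge0.
rewrite (_ : t ^+ p = t ^+ p.-1 * t); last first.
  by rewrite -exprSr prednK//; have := conf_p cf; case: (p).
rewrite mulrA -exprMn -[leLHS]add0r lerD ?(ltW e0)// ler_peMl//.
by rewrite exprn_ege1// mulrC ler_pdivlMr// mul1r.
Qed.

(** The truncated logarithm is Lipschitz with constant [expR m], the potential is handled by
    [conf_reg], and [kcut_ge] bounds the relative error on [W] by the kernel itself. The constant
    [D] depends on [m], so the truncation level has to be fixed before the radius of the ball. *)
Lemma kcut_reg eta m : 0 < eta -> 0 <= m -> exists2 D, 0 <= D &
  forall x y x' y', kcut m x y <=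
    kcut m x' y' + eta * (1 + kcut m x y) + D * (`|x' - x| ^+ p + `|y' - y| ^+ p).
Proof.
move=> eta0 m0; have e0 : 0 < eta / 2 by lra.
have [C C0 hC] := conf_reg cf e0.
have em0 : 0 < expR m := expR_gt0 m.
(* This threshold is used for both displacements and multiplied by the Lipschitz constant [expR m],
   which yields [eta / 2]. *)
have e10 : 0 < eta / 4 / expR m by rewrite divr_gt0//; lra.
have [D D0 hD] := le_eps_exprn e10.
exists (C / 2 + expR m * D); first by rewrite addr_ge0 ?mulr_ge0//; lra.
move=> x y x' y'.
set K := kcut m x y.
have KW : (W x + W y) / 4 <= K by exact: kcut_ge.
set M := Num.max `|x - y| (expR (- m)); set M' := Num.max `|x' - y'| (expR (- m)).
have lnM : ln M' - ln M <= expR m * (`|x' - x| + `|y' - y|).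
  apply: le_trans (@ln_lipschitz _ _ _ (expR (- m)) _ _ _) _.
  - exact: expR_gt0.
  - by rewrite le_max lexx orbT.
  - by rewrite le_max lexx orbT.
  rewrite expRN invrK mulrC ler_wpM2l ?(ltW em0)//.
  apply: (@le_trans _ _ `| `|x' - y'| - `|x - y| |).
    rewrite /M /M'; move: `|x' - y'| `|x - y| (expR (- m)) => u v w.
    by rewrite /Num.max; do 2 case: ifPn; rewrite -?leNgt => h1 h2;
      rewrite ler_norml; apply/andP; split; have := ler_norm (u - v);
      have := ler_norm (v - u); rewrite distrC; lra.
  apply: le_trans (ler_dist_dist _ _) _.
  have -> : x' - y' - (x - y) = (x' - x) - (y' - y) by ring.
  exact: ler_normB.
have h1 := hC x' x; have h2 := hC y' y.
have d1 := hD _ (normr_ge0 (x' - x)); have d2 := hD _ (normr_ge0 (y' - y)).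
have em : expR m * (`|x' - x| + `|y' - y|) <=
    eta / 2 + expR m * D * (`|x' - x| ^+ p + `|y' - y| ^+ p).
  apply: (@le_trans _ _ (expR m * (2 * (eta / 4 / expR m) +
      D * (`|x' - x| ^+ p + `|y' - y| ^+ p)))).
    by rewrite ler_wpM2l ?(ltW em0)//; lra.
  rewrite mulrDr [expR m * (D * _)]mulrA lerD2r.
  by rewrite (_ : expR m * _ = eta / 2) //; field; rewrite gt_eqF.
have KE : K = (W x + W y) / 2 + B - ln M by [].
have K'E : kcut m x' y' = (W x' + W y') / 2 + B - ln M' by [].
have eK : eta / 2 * ((W x + W y) / 2) <= eta / 2 * (2 * K).
  by rewrite ler_wpM2l ?(ltW e0)//; lra.
rewrite K'E [X in X <= _]KE.
have -> : (C / 2 + expR m * D) * (`|x' - x| ^+ p + `|y' - y| ^+ p) =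
  C / 2 * (`|x' - x| ^+ p + `|y' - y| ^+ p) +
  expR m * D * (`|x' - x| ^+ p + `|y' - y| ^+ p) by ring.
lra.
Qed.

End confining_kernel.

(** * Energy *)

Section integral_extra.
Context d (T : measurableType d) (R : realType).
Variable mu : {measure set T -> \bar R}.
Local Open Scope ereal_scope.

(* No measurability is needed: nonnegative integrals are suprema over simple
   functions, and the events of the theorem need not be shown measurable. *)
Lemma integral_mono (D D' : set T) (f g : T -> \bar R) :
  (forall x, D x -> 0 <= f x) -> (forall x, D' x -> 0 <= g x) ->
  (forall x, D x -> D' x /\ f x <= g x) ->
  \int[mu]_(x in D) f x <= \int[mu]_(x in D') g x.
Proof.
move=> f0 g0 fg; rewrite integral_mkcond [leRHS]integral_mkcond.
rewrite !ge0_integralTE; last 2 first.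
- by move=> x; rewrite patchE; case: ifPn => // /[!inE] /g0.
- by move=> x; rewrite patchE; case: ifPn => // /[!inE] /f0.
apply: le_ereal_sup => _ [h /= hf <-]; exists h => //= x.
apply: (le_trans (hf x)); rewrite !patchE.
case: ifPn => [/[!inE] /fg[D'x fgx]|_]; first by rewrite mem_set.
by case: ifPn => // /[!inE] /g0.
Qed.

End integral_extra.

Section probability_integral.
Context d (T : measurableType d) (R : realType).
Variable P : probability T R.
Local Open Scope ereal_scope.

Lemma integral_prob_cst (r : \bar R) : \int[P]_x cst r x = r.
Proof. by rewrite integral_cst//= probability_setT mule1. Qed.

Lemma integral_prob_affine (f : T -> \bar R) (r k : R) : (0 <= r)%R -> (0 <= k)%R ->
  (forall x, 0 <= f x) -> measurable_fun setT f ->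
  \int[P]_x (r%:E + k%:E * f x) = r%:E + k%:E * \int[P]_x f x.
Proof.
move=> r0 k0 f0 mf; rewrite ge0_integralD//=; last 2 first.
- by move=> x _; exact: mule_ge0.
- exact: measurable_funeM.
by rewrite ge0_integralZl_EFin// [X in X + _]integral_prob_cst.
Qed.

End probability_integral.

Section energy.
Context {R : realType} (p : nat) (W : R -> R) (a B : R).
Hypothesis cf : confining p W a B.
Local Notation RR := (measurableTypeR R).
Local Open Scope ereal_scope.

Definition energy (nu : probability RR R) : \bar R :=
  \int[nu]_x \int[nu]_y kern W B x y.

Let mW := conf_meas cf.

Lemma energy_ge0 nu : 0 <= energy nu.
Proof.
apply: integral_ge0 => x _; apply: integral_ge0 => y _; exact: kern_ge0 cf _ _.
Qed.

Lemma measurable_pot :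
  measurable_fun [set: RR] (fun x : RR => (W x)%:E : \bar R).
Proof. exact/measurable_EFinP. Qed.

Lemma energyE nu : energy nu = \int[nu \x nu]_z kern W B z.1 z.2.
Proof.
rewrite (fubini_tonelli1 (fun z : RR * RR => kern W B z.1 z.2))//.
- exact: measurable_kern.
- by move=> z; exact: kern_ge0 cf _ _.
Qed.

Lemma measurable_energy_inner (nu : probability RR R) :
  measurable_fun [set: RR] (fun x : RR => \int[nu]_y kern W B x y).
Proof.
apply: (measurable_fun_fubini_tonelli_F (fun z : RR * RR => kern W B z.1 z.2)).
- exact: measurable_kern.
- by move=> z; exact: kern_ge0 cf _ _.
Qed.

Lemma prod_integral1 (nu : probability RR R) (f : RR -> \bar R) :
  measurable_fun setT f -> (forall x, 0 <= f x) ->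
  \int[nu \x nu]_z f z.1 = \int[nu]_x f x.
Proof.
move=> mf f0; rewrite fubini_tonelli1//=; last exact: measurableT_comp.
by apply: eq_integral => x _; exact: (integral_prob_cst nu (f x)).
Qed.

Lemma prod_integral2 (nu : probability RR R) (f : RR -> \bar R) :
  measurable_fun setT f -> (forall x, 0 <= f x) ->
  \int[nu \x nu]_z f z.2 = \int[nu]_x f x.
Proof.
move=> mf f0; rewrite fubini_tonelli2//=; last exact: measurableT_comp.
by apply: eq_integral => x _; exact: (integral_prob_cst nu (f x)).
Qed.

(** If the energy is finite, this is subtraction of integrable functions. If it is infinite, the
    kernel is at most [l^\- + g] with [g] integrable, so the negative part of the logarithm has
    infinite integral; the sum with [-oo] is then [-oo] whatever the positive part. *)
Lemma log_energyE (nu : probability RR R) (w : R) :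
  \int[nu]_x (W x)%:E = w%:E -> log_energy nu = (w + B)%:E - energy nu.
Proof.
move=> Ww; pose g (z : RR * RR) : \bar R := ((W z.1 + W z.2) / 2 + B)%:E.
have W0 x : (0 <= W x)%R := confining_ge0 cf x.
have g0 z : 0 <= g z.
  by rewrite lee_fin addr_ge0 ?(conf_B cf)// divr_ge0// addr_ge0.
have mW1 : measurable_fun [set: RR * RR] (fun z => (W z.1)%:E).
  by apply/measurable_EFinP; exact: measurableT_comp.
have mW2 : measurable_fun [set: RR * RR] (fun z => (W z.2)%:E).
  by apply/measurable_EFinP; exact: measurableT_comp.
have mg : measurable_fun setT g.
  apply/measurable_EFinP; apply: measurable_funD => //.
  by apply: measurable_funM => //; apply: measurable_funD; exact/measurable_EFinP.
have mk : measurable_fun [set: RR * RR] (fun z => kern W B z.1 z.2).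
  exact: measurable_kern.
have k0 (z : RR * RR) : 0 <= kern W B z.1 z.2 := kern_ge0 cf z.1 z.2.
have Ig : \int[nu \x nu]_z g z = (w + B)%:E.
  rewrite (eq_integral (fun z : RR * RR =>
    B%:E + (2^-1)%:E * ((W z.1)%:E + (W z.2)%:E))); last first.
    by move=> z _; rewrite -EFinD; congr (_%:E); ring.
  rewrite integral_prob_affine ?(conf_B cf) ?invr_ge0//; last 2 first.
  - by move=> z; rewrite adde_ge0// lee_fin.
  - exact: emeasurable_funD.
  rewrite ge0_integralD//; last 2 first.
  - by move=> z _; rewrite lee_fin.
  - by move=> z _; rewrite lee_fin.
  rewrite (@prod_integral1 nu (fun x => (W x)%:E))//; last exact: measurable_pot.
  rewrite (@prod_integral2 nu (fun x => (W x)%:E))//; last exact: measurable_pot.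
  by rewrite Ww -EFinD; congr (_%:E); field.
have ig : (nu \x nu).-integrable setT g.
  apply/integrableP; split => //.
  rewrite (eq_integral g) ?Ig ?ltry// => z _; exact: gee0_abs.
pose l (z : RR * RR) : \bar R := lne `|(z.1 : R) - (z.2 : R)|%:E.
have lE z : l z = g z - kern W B z.1 z.2.
  rewrite kern_lne /l /g; case: (lne _) => [r| |]//.
  by rewrite -!EFinB; congr (_%:E); ring.
have ml : measurable_fun setT l.
  rewrite (_ : l = fun z => g z - kern W B z.1 z.2); last exact/funext.
  exact: emeasurable_funB.
rewrite /log_energy -/l energyE.
have [Efin|] := ltP (\int[nu \x nu]_z kern W B z.1 z.2) +oo.
  have ik : (nu \x nu).-integrable setT (fun z => kern W B z.1 z.2).
    apply/integrableP; split => //.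
    rewrite (eq_integral (fun z : RR * RR => kern W B z.1 z.2))// => z _.
    exact: gee0_abs.
  rewrite (eq_integral (g \- (fun z => kern W B z.1 z.2))) => [|z _]; last exact: lE.
  by rewrite integralB// Ig.
rewrite leye_eq => /eqP kinf; rewrite kinf /= integralE.
suff -> : \int[nu \x nu]_z l^\- z = +oo by rewrite addeNy.
have : \int[nu \x nu]_z kern W B z.1 z.2 <= \int[nu \x nu]_z (l^\- z + g z).
  apply: integral_mono => [z _|z _|z _]; [exact: k0|exact: adde_ge0|split => //].
  have : - l z <= l^\- z by rewrite funenegE le_max lexx.
  rewrite lE; have := k0 z; move: (kern W B z.1 z.2) (g0 z) => [r| |]//.
  - rewrite /g => _ _; case: (l^\- z) => [s| |]//; rewrite ?leey//.
    by rewrite -EFinB -EFinN -EFinD !lee_fin; lra.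
  - by move=> _ _ /=; rewrite /g/=; case: (l^\- z).
rewrite kinf ge0_integralD//; last exact: measurable_funeneg.
rewrite Ig; have : 0 <= \int[nu \x nu]_z l^\- z by exact: integral_ge0.
by case: (\int[_]_z _) => [r| |]//=; rewrite leye_eq.
Qed.

End energy.

(** * The averaging principle *)

Section sums.
Context {V : nmodType}.

Lemma sum_neq_lt n (F : nat -> nat -> V) :
  \sum_(i < n) \sum_(j < n | j != i) F i j =
  \sum_(i < n) \sum_(j < i) (F i j + F j i).
Proof.
elim: n => [|n IH]; first by rewrite !big_ord0.
rewrite big_ord_recr/= [RHS]big_ord_recr/= -IH.
rewrite [in LHS](eq_bigr (fun i : 'I_n => \sum_(j < n | j != i) F i j + F i n));
  last first.
  move=> i _; rewrite big_mkcond big_ord_recr/= -big_mkcond/=.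
  rewrite (_ : ord_max == widen_ord (leqnSn n) i = false) => [|]/=; last first.
    by apply/eqP => /(congr1 val)/= e; have := ltn_ord i; rewrite -e ltnn.
  by congr (_ + _); apply: eq_bigl => j.
rewrite big_split/= -addrA; congr (_ + _).
rewrite [X in _ + X]big_mkcond big_ord_recr/= eqxx/= addr0 big_split/= addrC; congr (_ + _).
apply: eq_bigr => i _; case: eqP => // /(congr1 val)/= e.
by have := ltn_ord i; rewrite e ltnn.
Qed.

End sums.

Section averaging.
Context d (T : measurableType d) (R : realType).
Local Open Scope ereal_scope.

(** Were [phi] above its mean [I] on all of [C], then [phi - I] would be positive almost surely with
    zero integral. The set [C] lets the chosen point satisfy any condition of full probability. *)
Lemma exists_le_integral (P : probability T R) (C : set T) (phi : T -> \bar R) :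
  measurable C -> P C = 1 -> measurable_fun setT phi -> (forall x, 0 <= phi x) ->
  exists2 x, C x & phi x <= \int[P]_x phi x.
Proof.
move=> mC PC mphi phi0; apply: contrapT => h.
have {}h x : C x -> \int[P]_x phi x < phi x.
  by move=> Cx; rewrite ltNge; apply/negP => ?; apply: h; exists x.
have [x0 Cx0] : C !=set0.
  by apply/set0P/negP => /eqP C0; move: PC; rewrite C0 measure0 => /esym/eqP;
    rewrite eqe oner_eq0.
have I0 : 0 <= \int[P]_x phi x by exact: integral_ge0.
move: (h x0 Cx0); case E : (\int[P]_x phi x) => [I| |]; last 2 first.
- by rewrite ltNge leey.
- by move: I0; rewrite E.
move=> _; have I0' : (0 <= I)%R by rewrite -lee_fin -E.
have PCc : P (~` C) = 0 by rewrite probability_setC// PC subee.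
have IC : \int[P]_(x in C) phi x = I%:E.
  rewrite -E [RHS](@ge0_negligible_integral _ _ _ P setT (~` C))//=; last exact: measurableC.
  by rewrite setTD setCK.
have mC' := measurable_funTS mphi.
have : \int[P]_(x in C) (I%:E + `|phi x - I%:E|) = I%:E.
  rewrite -[RHS]IC; apply: eq_integral => x /[!inE] /h; rewrite E.
  case: (phi x) => [r| |]//; rewrite ?lte_fin => rI.
  by rewrite -EFinB abse_EFin -EFinD ger0_norm; [congr (_%:E); ring|rewrite subr_ge0 ltW].
rewrite ge0_integralD//; last first.
  by apply: measurableT_comp => //; exact: emeasurable_funB.
rewrite integral_cst//= PC mule1 => IX.
have : \int[P]_(x in C) `|phi x - I%:E| = 0.
  move: IX; case: (\int[P]_(x in C) _) => [r| |]//= [e].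
  by congr (_%:E); lra.
move=> /(ae_eq_integral_abs _ mC)[].
  exact: emeasurable_funB.
move=> N [mN N0 CN].
suff : P C <= P N by rewrite N0 PC leNgt lte_fin ltr01.
apply: le_measure; rewrite ?inE// => x Cx; apply: CN => /= /(_ Cx).
move: (h x Cx); rewrite E; case: (phi x) => [r| |]//.
rewrite lte_fin => Ir [] /eqP; rewrite subr_eq0 => /eqP rI.
by rewrite rI ltxx in Ir.
Qed.

(** The right-hand side is the mean of the left one for independent points of laws [P i]. The points
    are chosen one at a time, the last first: its interaction with the others becomes part of their
    one-body terms, which is why the induction runs over all [f]. *)
Lemma averaging (P : nat -> probability T R) (C : nat -> set T)
    (k : T -> T -> \bar R) n (f : nat -> T -> \bar R) :
  (forall i, (i < n)%N -> measurable (C i) /\ P i (C i) = 1) ->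
  measurable_fun setT (fun z : T * T => k z.1 z.2) -> (forall x y, 0 <= k x y) ->
  (forall i, measurable_fun setT (f i)) -> (forall i x, 0 <= f i x) ->
  exists2 x : nat -> T, (forall i, (i < n)%N -> C i (x i)) &
    \sum_(i < n) f i (x i) + \sum_(i < n) \sum_(j < i) k (x j) (x i) <=
    \sum_(i < n) \int[P i]_x f i x +
    \sum_(i < n) \sum_(j < i) \int[P i]_x \int[P j]_y k y x.
Proof.
move=> PC mk k0; elim: n => [|n IH] in f PC *.
  by move=> _ _; exists (fun=> point) => //; rewrite !big_ord0.
move=> mf f0.
have mkl x : measurable_fun setT (k ^~ x).
  exact: (measurableT_comp mk (measurable_pair2 x)).
have mI j : measurable_fun setT (fun x => \int[P j]_y k y x).
  apply: (measurable_fun_fubini_tonelli_G (fun z : T * T => k z.1 z.2)) => //.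
pose phi x := f n x + \sum_(j < n) \int[P j]_y k y x.
have [||||xn Cxn hxn] := @exists_le_integral (P n) (C n) phi.
- by have [] := PC n (ltnSn n).
- by have [] := PC n (ltnSn n).
- by apply: emeasurable_funD => //; exact: emeasurable_sum.
- by move=> x; rewrite adde_ge0// sume_ge0// => j _; exact: integral_ge0.
rewrite ge0_integralD//= in hxn; last 2 first.
- by move=> x _; rewrite sume_ge0// => j _; exact: integral_ge0.
- exact: emeasurable_sum.
rewrite ge0_integral_sum//= in hxn; last first.
  by move=> j x _; exact: integral_ge0.
have [|||x Cx hx] := IH (fun i y => f i y + k y xn).
- by move=> i ni; apply: PC; exact: ltnW.
- by move=> i; exact: emeasurable_funD.
- by move=> i y; rewrite adde_ge0.
pose x' i := if i == n then xn else x i.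
have x'n : x' n = xn by rewrite /x' eqxx.
have x'E i : (i < n)%N -> x' i = x i by rewrite /x'; case: ltngtP.
exists x' => [i|].
  by rewrite ltnS leq_eqVlt => /orP[/eqP->|ni]; rewrite ?x'n// x'E//; exact: Cx.
have e1 : \sum_(i < n) f i (x' i) = \sum_(i < n) f i (x i).
  by apply: eq_bigr => i _; rewrite x'E.
have e2 : \sum_(i < n) \sum_(j < i) k (x' j) (x' i) =
          \sum_(i < n) \sum_(j < i) k (x j) (x i).
  apply: eq_bigr => i _; rewrite x'E//; apply: eq_bigr => j _.
  by rewrite x'E// (ltn_trans (ltn_ord j)).
have e3 : \sum_(i < n) k (x' i) xn = \sum_(i < n) k (x i) xn.
  by apply: eq_bigr => i _; rewrite x'E.
rewrite !big_ord_recr/= x'n e1 e2 e3.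
rewrite big_split/= in hx.
rewrite [X in _ <= X + _](eq_bigr (fun i : 'I_n =>
    \int[P i]_y f i y + \int[P i]_y k y xn)) in hx; last first.
  by move=> i _; rewrite ge0_integralD.
rewrite big_split/= in hx.
set a := \sum_(i < n) f i (x i) in hx *; set b := \sum_(i < n) k _ _ in hx *.
set c := \sum_(i < n) \sum_(j < i) k _ _ in hx *.
set a' := \sum_(i < n) \int[P i]_y f i y in hx *.
set c' := \sum_(i < n) \sum_(j < i) _ in hx *.
rewrite (addeC c b) addeA (addeAC a _ b) (addeAC (a + b)).
apply: (le_trans (leeD hx (lexx (f n xn)))).
have aux (s t u v z w : \bar R) : v + t <= z + w -> s + t + u + v <= s + z + (u + w).
  move=> h; rewrite (addeACA s z u w) (addeAC s t u) -(addeA (s + u)).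
  by rewrite leeD2l// addeC.
exact: aux hxn.
Qed.

End averaging.

Section conditioning.
Context d (T : measurableType d) (R : realType).
Local Open Scope ereal_scope.

Lemma integral_mnormalize (m : {measure set T -> \bar R}) (P : probability T R)
    (s : R) (f : T -> \bar R) : (0 < s)%R -> m setT = s%:E ->
  measurable_fun setT f -> (forall x, 0 <= f x) ->
  \int[mnormalize m P]_x f x = (s^-1)%:E * \int[m]_x f x.
Proof.
move=> s0 ms mf f0; have s0' : (0 <= s^-1)%R by rewrite invr_ge0 ltW.
rewrite -(@ge0_integral_mscale _ _ _ m setT measurableT (NngNum s0'))//.
apply: eq_measure_integral => A mA _.
by rewrite /= /mnormalize /mscale ms eqe gt_eqF//= muleC.
Qed.

Lemma integral_mrestr (m : {measure set T -> \bar R}) (C : set T)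
    (mC : measurable C) (f : T -> \bar R) :
  measurable_fun setT f -> (forall x, 0 <= f x) ->
  \int[mrestr m mC]_x f x = \int[m]_(x in C) f x.
Proof.
move=> mf f0; have mCc := measurableC mC.
have mU : measurable_fun (~` C `|` C) f by exact: measurable_funTS.
have dC : [disjoint ~` C & C] by rewrite disj_set2E setICl.
rewrite -(setvU C) ge0_integral_setU//= [X in X + _](_ : _ = 0) ?add0e.
  by apply: eq_measure_integral => A mA AC; rewrite /= /mrestr setIidl.
rewrite (_ : 0 = \int[mzero]_(x in ~` C) f x); last by rewrite integral_measure_zero.
apply: eq_measure_integral => A mA AC; rewrite /= /mrestr /mzero.
by rewrite (_ : A `&` C = set0) ?measure0// -subset0 => x [/AC].
Qed.

(** The last [P] is the default value of [mnormalize] for a null set [C]. *)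
Definition conditional (P : probability T R) (C : set T) (mC : measurable C) :
  probability T R := mnormalize (mrestr P mC) P.

Lemma integral_conditional (P : probability T R) (C : set T) (mC : measurable C)
    (s : R) (f : T -> \bar R) : (0 < s)%R -> P C = s%:E ->
  measurable_fun setT f -> (forall x, 0 <= f x) ->
  \int[conditional P mC]_x f x = (s^-1)%:E * \int[P]_(x in C) f x.
Proof.
move=> s0 Ps mf f0; rewrite (@integral_mnormalize _ _ s)//.
  by rewrite integral_mrestr.
by rewrite /= /mrestr setTI.
Qed.

Lemma conditional_mem (P : probability T R) (C : set T) (mC : measurable C)
    (s : R) : (0 < s)%R -> P C = s%:E -> conditional P mC C = 1.
Proof.
move=> s0 Ps; rewrite /conditional /= /mnormalize /= /mrestr setTI Ps.
by rewrite eqe gt_eqF//= setIid Ps -EFinM mulfV// gt_eqF.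
Qed.

End conditioning.

(** * Quantile cells *)

Section quantiles.
Context {R : realType}.
Local Notation RR := (measurableTypeR R).
Local Open Scope ereal_scope.
Variable nu : probability RR R.

(** The quantile is the supremum of the points where the distribution function is at most [t]:
    absence of atoms gives left continuity, hence [<=], and right continuity gives [>=]. *)
Lemma atomless_quantile (t : R) : (forall x, nu [set x] = 0) -> (0 < t < 1)%R ->
  exists r : R, nu `]-oo, r]%classic = t%:E.
Proof.
move=> nu0 /andP[t0 t1].
(* The identity is packed as a random variable so that the results on [cdf] apply to [nu]. *)
pose idR : RR -> R := idfun.
pose mid := @isMeasurableFun.Build _ _ _ _ idR (@measurable_id _ _ setT).
pose X : {RV nu >-> R} := HB.pack_for {mfun RR >-> R} idR mid.
pose F := cdf X.
have Fnd : nondecreasing_fun F by exact: cdf_nondecreasing.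
have FE r : F r = nu `]-oo, r]%classic by [].
pose S : set R := [set r | F r <= t%:E].
have [r0 Sr0] : S !=set0.
  have : \forall r \near -oo%R, F r < t%:E.
    have h : nbhs (0 : \bar R) [set y | y < t%:E].
      by apply: open_nbhs_nbhs; split;
        [exact: open_ereal_lt_ereal|rewrite /= lte_fin].
    exact: (cvg_cdfNy0 X h).
  by move=> [M [_ hM]]; exists (M - 1)%R; apply/ltW/hM; rewrite ltrBlDr ltrDl.
have [r1 r1P] : exists r1, t%:E < F r1.
  have : \forall r \near +oo%R, t%:E < F r.
    have h : nbhs (1 : \bar R) [set y | t%:E < y].
      by apply: open_nbhs_nbhs; split;
        [exact: open_ereal_gt_ereal|rewrite /= lte_fin].
    exact: (cvg_cdfy1 X h).
  by move=> [M [_ hM]]; exists (M + 1)%R; apply/hM; rewrite ltrDl.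
have Sub : ubound S r1.
  move=> r Sr; rewrite leNgt; apply/negP => /ltW /Fnd r1r.
  by have := lt_le_trans r1P (le_trans r1r Sr); rewrite ltxx.
have hS : has_sup S by split; [exists r0|exists r1].
exists (sup S); rewrite -FE; apply/eqP; rewrite eq_le; apply/andP; split.
  rewrite FE -(@setUitv1 _ _ -oo%O (sup S) true)//= measureU//=; last first.
    by apply/seteqP; split => x //= []; rewrite in_itv/= => h xS; rewrite xS ltxx in h.
  rewrite [X in _ + X]nu0 adde0.
  pose G n : set RR := `]-oo, (sup S - n.+1%:R^-1)%R]%classic.
  have GE : `]-oo, sup S[%classic = \bigcup_n G n.
    apply/seteqP; split => x /=; rewrite ?in_itv/=.
      move=> xS; have d0 : (0 < sup S - x)%R by rewrite subr_gt0.
      exists (Num.truncn (sup S - x)^-1) => //=; rewrite /G/= in_itv/= lerBrDr -lerBrDl.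
      rewrite -[leRHS]invrK lef_pV2 ?posrE ?invr_gt0//.
      by rewrite ltW// truncnS_gt.
    move=> [n _]; rewrite /G/= in_itv/= => /le_lt_trans; apply.
    by rewrite ltrBlDr ltrDl.
  have cG : nu (G n) @[n --> \oo] --> nu (\bigcup_n G n).
    have mG n : measurable (G n) by exact: measurable_itv.
    apply: nondecreasing_cvg_mu => //; first exact: bigcup_measurable.
    move=> n m nm; apply/subsetPset => x; rewrite /G/= !in_itv/= => /le_trans; apply.
    by rewrite lerD2l lerN2 lef_pV2 ?posrE// ler_nat.
  rewrite GE -(cvg_lim _ cG)//; apply: lime_le.
    by apply/cvg_ex; eexists; exact: cG.
  apply: nearW => n.
  have [s Ss sS] : exists2 s, S s & (sup S - n.+1%:R^-1 < s)%R.
    by apply: sup_adherent => //; rewrite invr_gt0.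
  by apply: le_trans Ss; apply: Fnd; exact: ltW.
rewrite leNgt; apply/negP => Ft.
have : \forall x \near (sup S)^'+, F x < t%:E.
  have h : nbhs (F (sup S)) [set y | y < t%:E].
    by apply: open_nbhs_nbhs; split => //; exact: open_ereal_lt_ereal.
  exact: (@cdf_right_continuous _ _ _ _ X (sup S) _ h).
move=> /(filterI (nbhs_right_gt (sup S))) /filter_ex[x [sx /ltW Fx]].
by have := sup_ubound hS.2 Fx; rewrite leNgt sx.
Qed.

(** The cut points are extended reals so that the two outer cells may be unbounded; with cut points
    equal to [+oo] from index [M] on, all later cells are empty. *)
Definition cell (q : nat -> \bar R) (i : nat) : set RR :=
  [set x | q i < (x : R)%:E <= q i.+1].

Record quantiles (M : nat) (q : nat -> \bar R) : Prop := Quantiles {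
  quantile0 : q 0%N = -oo;
  quantile_end : forall i, (M <= i)%N -> q i = +oo;
  quantile_nd : forall i j, (i <= j)%N -> q i <= q j;
  quantile_mass : forall i, (i < M)%N -> nu (cell q i) = (M%:R^-1)%:E
}.

Lemma measurable_EFin_preimage (A : set (\bar R)) :
  measurable A -> measurable ((EFin : RR -> \bar R) @^-1` A).
Proof.
move=> mA; rewrite -[X in measurable X]setTI.
have : measurable_fun [set: RR] (EFin : RR -> \bar R).
  by apply/measurable_EFinP; exact: measurable_id.
exact.
Qed.

Lemma measurable_cell q i : measurable (cell q i).
Proof.
rewrite (_ : cell q i = EFin @^-1` `]q i, q i.+1]%classic).
  by apply: measurable_EFin_preimage; exact: emeasurable_itv.
by apply/seteqP; split => x; rewrite /cell /= in_itv/=.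
Qed.

Lemma exists_quantiles (M : nat) : (forall x, nu [set x] = 0) -> (0 < M)%N ->
  exists q, quantiles M q.
Proof.
move=> nu0 M0; have M0' : (0 < M%:R :> R)%R by rewrite ltr0n.
have [Q hQ] : {Q : nat -> R & forall i, (0 < i < M)%N ->
    nu `]-oo, Q i]%classic = (i%:R / M%:R)%:E}.
  apply: (@choice _ _ (fun i r => (0 < i < M)%N -> nu `]-oo, r]%classic = (i%:R / M%:R)%:E)).
  move=> i; have [/andP[i0 iM]|] := boolP (0 < i < M)%N; last by exists 0%R.
  have [|r hr] := @atomless_quantile (i%:R / M%:R) nu0; last by exists r.
  by rewrite divr_gt0 ?ltr0n//= ltr_pdivrMr// mul1r ltr_nat.
pose q i : \bar R := if i == 0%N then -oo else if (i < M)%N then (Q i)%:E else +oo.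
pose H (e : \bar R) := nu [set x | (x : R)%:E <= e].
have Hq i : (i <= M)%N -> H (q i) = (i%:R / M%:R)%:E.
  move=> iM; rewrite /H /q; case: eqVneq => [->|i0].
    rewrite mul0r (_ : [set _ | _] = set0) ?measure0//.
    by apply/seteqP; split => x //=; rewrite leeNy_eq.
  rewrite leq_eqVlt in iM; case/orP: iM => [/eqP ->|iM].
    rewrite ltnn divff ?gt_eqF// (_ : [set _ | _] = setT) ?probability_setT//.
    by apply/seteqP; split => x //=; rewrite leey.
  by rewrite iM -hQ ?lt0n ?i0.
have mH e : measurable [set x : RR | (x : R)%:E <= e].
  rewrite (_ : [set _ | _] = EFin @^-1` `]-oo, e]%classic).
    by apply: measurable_EFin_preimage; exact: emeasurable_itv.
  by apply/seteqP; split => x; rewrite /= in_itv/=.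
have Hnd e e' : e <= e' -> H e <= H e'.
  by move=> ee'; apply: le_measure; rewrite ?inE// => x /= /le_trans; apply.
have qnd i j : (i <= j)%N -> q i <= q j.
  move=> ij; have [Mj|jM] := leqP M j.
    by rewrite [q j]/q ltnNge Mj/= gtn_eqF ?leey// (leq_trans M0).
  rewrite leq_eqVlt in ij; case/orP: ij => [/eqP ->//|ij].
  rewrite leNgt; apply/negP => /ltW/Hnd; rewrite !Hq ?(ltnW jM)//; last first.
    by rewrite (leq_trans (ltnW ij))// ltnW.
  by rewrite lee_fin ler_pdivrMr// divfK ?gt_eqF// ler_nat leqNgt ij.
exists q; split => //.
- move=> i Mi; rewrite /q ltnNge Mi gtn_eqF//; exact: leq_trans M0 Mi.
- move=> i iM.
  have cE : cell q i = [set x : RR | (x : R)%:E <= q i.+1] `\` [set x : RR | (x : R)%:E <= q i].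
    apply/seteqP; split => x; rewrite /cell/=.
      by move=> /andP[h1 h2]; split => //; apply/negP; rewrite -ltNge.
    by move=> [h1 /negP]; rewrite -ltNge => h2; apply/andP.
  rewrite cE measureD//; last first.
    by rewrite (le_lt_trans (probability_le1 _ _))// ltry.
  rewrite setIidr; last by move=> x /= /le_trans; apply; exact: qnd.
  transitivity (H (q i.+1) - H (q i)); first by [].
  rewrite (Hq _ iM) (Hq _ (ltnW iM)).
  rewrite -EFinB; congr (_%:E).
  by rewrite -mulrBl -natr1 addrAC subrr add0r mul1r.
Qed.

Lemma cell_lt q i j x y : (forall i j, (i <= j)%N -> q i <= q j) ->
  (i < j)%N -> cell q i x -> cell q j y -> ((x : R) < y)%R.
Proof.
move=> qnd ij /andP[_ xi] /andP[jy _]; rewrite -lte_fin.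
by apply: le_lt_trans jy; apply: le_trans xi _; exact: qnd.
Qed.

Lemma cell_cover M q x : quantiles M q -> exists2 i, (i < M)%N & cell q i x.
Proof.
move=> Qq; have ex : exists i, (x : R)%:E <= q i.
  by exists M; rewrite (quantile_end Qq)// leey.
case: (ex_minnP ex) => -[|i] hi mini.
  by move: hi; rewrite (quantile0 Qq) leeNy_eq.
have qi : q i < (x : R)%:E.
  by rewrite ltNge; apply/negP => /mini; rewrite ltnn.
exists i; last by apply/andP.
rewrite ltnNge; apply/negP => Mi; move: qi.
by rewrite (quantile_end Qq)// ltNge leey.
Qed.

Lemma cell_inj M q i j x : quantiles M q -> cell q i x -> cell q j x -> i = j.
Proof.
move=> Qq xi xj; have qnd := quantile_nd Qq.
by case: (ltngtP i j) => // ij; have := cell_lt qnd ij; [move=> /(_ _ _ xi xj)|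
  move=> /(_ _ _ xj xi)]; rewrite ltxx.
Qed.

Lemma bigcup_cell M q : quantiles M q -> \big[setU/set0]_(i < M) cell q i = setT.
Proof.
move=> Qq; rewrite -subTset -bigcup_mkord => x _.
by have [i iM xi] := cell_cover x Qq; exists i.
Qed.

Lemma trivIset_cell M q : quantiles M q -> trivIset setT (cell q).
Proof. by move=> Qq i j _ _ [x [xi xj]]; exact: cell_inj Qq xi xj. Qed.

Lemma sum_integral_cell M q (f : RR -> \bar R) : quantiles M q ->
  measurable_fun setT f -> (forall x, 0 <= f x) ->
  \sum_(i < M) \int[nu]_(x in cell q i) f x = \int[nu]_x f x.
Proof.
move=> Qq mf f0; rewrite -[in RHS](bigcup_cell Qq).
rewrite -(big_mkord xpredT (cell q)) ge0_integral_bigsetU//=.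
- by rewrite big_mkord.
- by move=> i; exact: measurable_cell.
- exact: iota_uniq.
- by move=> i j _ _ h; exact: (trivIset_cell Qq).
- exact: measurable_funTS.
Qed.

End quantiles.

(** * Transport cost inside quantile cells *)

Section discretization.
Context {R : realType} (p : nat) (W : R -> R) (a B : R).
Hypothesis cf : confining p W a B.
Local Notation RR := (measurableTypeR R).
Local Open Scope ereal_scope.
Local Notation kern := (kern W B).

Let mW := conf_meas cf.
Let p1 : (0 < p)%N. Proof. by have := conf_p cf; case: (p). Qed.

(** An atom at [x] would charge the diagonal point [(x, x)], where the kernel is infinite. *)
Lemma energy_atomless (nu : probability RR R) : energy W B nu < +oo ->
  forall x, nu [set x] = 0.
Proof.
move=> Efin x; apply/eqP; rewrite eq_le measure_ge0 andbT leNgt; apply/negP => nux.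
suff : +oo <= energy W B nu by rewrite leNgt Efin.
have ooE : \int[nu]_(y in [set x]) (cst +oo) y = +oo.
  by rewrite integral_cst// gt0_mulye.
have inner : +oo <= \int[nu]_y kern x y.
  rewrite -[leLHS]ooE; apply: integral_mono => y.
  - by move=> _; rewrite leey.
  - by move=> _; exact: kern_ge0 cf _ _.
  - by move=> ->; split => //; rewrite kernxx.
rewrite -[leLHS]ooE; apply: integral_mono => y.
- by move=> _; rewrite leey.
- by move=> _; apply: integral_ge0 => z _; exact: kern_ge0 cf _ _.
- by move=> ->; split.
Qed.

Lemma finite_pmoment (nu : probability RR R) : \int[nu]_x (W x)%:E < +oo ->
  \int[nu]_x (`|x : R| ^+ p)%:E < +oo.
Proof.
move=> Wfin; have a0 := conf_a cf.
have : \int[nu]_x (`|x : R| ^+ p)%:E <= \int[nu]_x ((a^-1)%:E * (W x)%:E).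
  apply: integral_mono => x _; first by rewrite lee_fin exprn_ge0.
    by rewrite mule_ge0// lee_fin ?invr_ge0 ?(ltW a0)//; exact: confining_ge0 cf _.
  by split => //; rewrite -EFinM lee_fin ler_pdivlMl//; exact: conf_ge cf _.
have W0 x : 0 <= (W x)%:E by rewrite lee_fin; exact: confining_ge0 cf _.
have mWE : measurable_fun setT (fun x : RR => (W x)%:E) by exact/measurable_EFinP.
have ia0 : (0 <= a^-1)%R by rewrite invr_ge0 ltW.
move/le_lt_trans; apply; rewrite ge0_integralZl_EFin//.
by rewrite lte_mul_pinfty.
Qed.

Definition clamp (K x : R) : R := (Num.max (- K) (Num.min K x))%R.

Lemma clamp_dist_le (K x : R) : (0 <= K)%R -> (`|x - clamp K x| <= `|x|)%R.
Proof.
move=> K0; rewrite /clamp /Num.max /Num.min.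
by have := ler_norm x; have := ler_norm (- x); rewrite normrN;
  case: ifPn; case: ifPn; rewrite -?leNgt => h1 h2 h3 h4;
  rewrite ler_norml; apply/andP; split; lra.
Qed.

Lemma clamp_id (K x : R) : (`|x| <= K)%R -> clamp K x = x.
Proof.
by move=> /ler_normlP[h1 h2]; rewrite /clamp min_r// max_r//; lra.
Qed.

Lemma measurable_tail K :
  measurable_fun [set: RR] (fun x : RR => (`|(x : R) - clamp K x| ^+ p)%:E : \bar R).
Proof.
apply/measurable_EFinP; apply: measurable_funX; apply: measurableT_comp => //.
apply: measurable_funB => //; apply: measurable_maxr => //.
exact: measurable_minr.
Qed.

Lemma clamp_tail (nu : probability RR R) (eps : R) : (0 < eps)%R ->
  \int[nu]_x (`|x : R| ^+ p)%:E < +oo ->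
  exists2 K : R, (0 <= K)%R & \int[nu]_x (`|(x : R) - clamp K x| ^+ p)%:E < eps%:E.
Proof.
move=> eps0 mfin.
pose f (n : nat) (x : RR) : \bar R := (`|(x : R) - clamp n%:R x| ^+ p)%:E.
have mx : measurable_fun [set: RR] (fun x : RR => (`|x : R| ^+ p)%:E : \bar R).
  by apply/measurable_EFinP; apply: measurable_funX; exact: normr_measurable.
have mf n : measurable_fun setT (f n) by exact: measurable_tail.
have m0 : measurable_fun [set: RR] (cst (0 : \bar R)) by exact: measurable_cst.
have f0 : {ae nu, forall x, setT x -> f ^~ x @ \oo --> cst (0 : \bar R) x}.
  apply: aeW => x _; apply: cvg_near_cst; near=> n.
  rewrite /f clamp_id ?subrr ?normr0 ?expr0n ?gtn_eqF//; near: n.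
  exact: nbhs_infty_ger.
have fg : {ae nu, forall x n, setT x -> `|f n x| <= (`|x : R| ^+ p)%:E}.
  apply: aeW => x n _; rewrite /f /= lee_fin normrX normr_id.
  by rewrite lerXn2r ?nnegrE// clamp_dist_le.
have ig : nu.-integrable setT (fun x : RR => (`|x : R| ^+ p)%:E).
  apply/integrableP; split => //.
  rewrite (eq_integral (fun x : RR => (`|x : R| ^+ p)%:E))// => x _.
  by rewrite /= normrX normr_id.
have [_ _ cvgf] := dominated_convergence measurableT mf m0 f0 ig fg.
have : \forall n \near \oo, \int[nu]_x f n x < eps%:E.
  rewrite integral0 in cvgf; have h : nbhs (0 : \bar R) [set y | y < eps%:E].
    by apply: open_nbhs_nbhs; split;
      [exact: open_ereal_lt_ereal|rewrite /= lte_fin].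
  exact: (cvgf _ h).
by move=> /filter_ex[n hn]; exists n%:R.
Unshelve. all: by end_near. Qed.

Lemma integral_affine_on (nu : probability RR R) (C : set RR) (m g r k : R)
    (f : RR -> R) : measurable C -> nu C = m%:E -> measurable_fun setT f ->
  (forall x, (0 <= f x)%R) -> \int[nu]_(x in C) (f x)%:E = g%:E ->
  (0 <= r)%R -> (0 <= k)%R ->
  \int[nu]_(x in C) (r + k * f x)%:E = (r * m + k * g)%:E.
Proof.
move=> mC nuC mf f0 fg r0 k0.
have mf' : measurable_fun C (fun x => (f x)%:E).
  by apply/measurable_EFinP; exact: measurable_funTS.
rewrite (eq_integral (fun x => r%:E + k%:E * (f x)%:E))//.
rewrite ge0_integralD//; last 2 first.
- by move=> x _; rewrite mule_ge0// lee_fin.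
- exact: measurable_funeM.
rewrite integral_cst// ge0_integralZl_EFin//; last by move=> x _; rewrite lee_fin.
rewrite fg; transitivity (r%:E * nu C + k%:E * g%:E); first by [].
by rewrite nuC.
Qed.

Lemma measurable_dist : measurable_fun [set: RR * RR]
  (fun z : RR * RR => (`|(z.1 : R) - z.2| ^+ p)%:E : \bar R).
Proof.
apply/measurable_EFinP; apply: measurable_funX; apply: measurableT_comp => //.
exact: measurable_funB.
Qed.

Lemma measurable_dist2 x : measurable_fun [set: RR]
  (fun y : RR => (`|(x : R) - y| ^+ p)%:E : \bar R).
Proof. exact: (measurableT_comp measurable_dist (measurable_pair1 x)). Qed.

(** The left-hand side is the mean transport cost when one point per cell is drawn from [nu]
    conditioned on it. Cells need not be short, but after clamping to [[- K, K]] their lengths add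
    up to at most [2 * K]; as each carries mass [1 / M], this part is [O(1 / M)]. The rest is
    bounded by the tail moment, made small by [K]. *)
Lemma cell_cost (nu : probability RR R) (eps : R) : (0 < eps)%R ->
  \int[nu]_x (`|x : R| ^+ p)%:E < +oo ->
  exists2 M0 : nat, (0 < M0)%N & forall (M : nat) q, (M0 <= M)%N -> quantiles nu M q ->
    (M%:R)%:E * \sum_(i < M) \int[nu]_(x in cell q i) \int[nu]_(y in cell q i)
      (`|(x : R) - y| ^+ p)%:E <= eps%:E.
Proof.
(* One factor [2 ^ p] for separating the clamped part, another for separating the two tails. *)
move=> eps0 mfin; pose D : R := (2 ^+ p * 2 ^+ p)%R.
have D0 : (0 < D)%R by rewrite mulr_gt0// exprn_gt0.
have e1 : (0 < eps / (4 * D))%R by rewrite divr_gt0// mulr_gt0.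
have [K K0 hK] := clamp_tail e1 mfin.
pose g (x : RR) : R := (`|(x : R) - clamp K x| ^+ p)%R.
have g0 x : (0 <= g x)%R by rewrite exprn_ge0.
have mg : measurable_fun setT g by apply/measurable_EFinP; exact: measurable_tail.
pose L : R := (2 ^+ p * (2 * K) ^+ p.-1)%R.
have L0 : (0 <= L)%R by rewrite mulr_ge0// exprn_ge0// mulr_ge0.
pose M0 := (Num.truncn (4 * L * K / eps)%R).+1.
exists M0 => // M q M0M Qq.
have M0' : (0 < M%:R :> R)%R by rewrite ltr0n (leq_trans _ M0M).
have LM : (2 * L * K / M%:R <= eps / 2)%R.
  rewrite ler_pdivrMr//.
  have : (4 * L * K / eps < M%:R)%R.
    by apply: lt_le_trans (truncnS_gt _) _; rewrite ler_nat.
  by rewrite ltr_pdivrMr//; lra.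
(* Clamping extended to infinite cut points: every cell gets a finite length, and the lengths
   telescope. *)
pose cl (e : \bar R) : R := fine (maxe (- K)%:E (mine K%:E e)).
have clE (x : R) : cl x%:E = clamp K x.
  by rewrite /cl /clamp -EFin_min -EFin_max.
have clfin e : maxe (- K)%:E (mine K%:E e) \is a fin_num.
  by rewrite fin_numElt lt_max ltNyr/= gt_max ltry/= gt_min ltry.
have clnd e e' : e <= e' -> (cl e <= cl e')%R.
  move=> ee'; rewrite fine_le// ge_max !le_max lexx/=.
  by rewrite le_min !ge_min lexx ee' !orbT.
have clK e : (- K <= cl e <= K)%R.
  rewrite -!lee_fin fineK// le_max lexx/= ge_max ge_min lexx andbT lee_fin; lra.
pose l i : R := (cl (q i.+1) - cl (q i))%R.
have l0 i : (0 <= l i)%R by rewrite subr_ge0 clnd//; exact: quantile_nd Qq _ _ _.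
have suml : (\sum_(i < M) l i <= 2 * K)%R.
  rewrite -(big_mkord xpredT l) (telescope_sumr (fun i => cl (q i)))//.
  by have := clK (q M); have := clK (q 0%N); lra.
pose gam i : R := fine (\int[nu]_(x in cell q i) (g x)%:E).
have gfin i : \int[nu]_(x in cell q i) (g x)%:E = (gam i)%:E.
  rewrite fineK// ge0_fin_numE; last by apply: integral_ge0 => x _; rewrite lee_fin.
  apply: le_lt_trans (lt_trans hK (ltry _)).
  by apply: integral_mono => x _; rewrite ?lee_fin.
have gam0 i : (0 <= gam i)%R.
  by rewrite -lee_fin -gfin; apply: integral_ge0 => x _; rewrite lee_fin.
have sumg : (\sum_(i < M) gam i <= eps / (4 * D))%R.
  rewrite -lee_fin -sumEFin; under eq_bigr do rewrite -gfin.
  rewrite (sum_integral_cell Qq (f := fun x => (g x)%:E)).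
  - exact: ltW.
  - exact/measurable_EFinP.
  - by move=> x; rewrite lee_fin.
pose m : R := (M%:R^-1)%R.
have bound (i : 'I_M) : \int[nu]_(x in cell q i) \int[nu]_(y in cell q i)
      (`|(x : R) - y| ^+ p)%:E <= (L * l i * m * m + 2 * D * m * gam i)%:E.
  have mC := measurable_cell q i.
  have nuC : nu (cell q i) = m%:E by exact: (quantile_mass Qq).
  have m0 : (0 <= m)%R by rewrite invr_ge0 ltW.
  have Dg x : (0 <= D * g x)%R := mulr_ge0 (ltW D0) (g0 x).
  have Ll j : (0 <= L * l j)%R := mulr_ge0 L0 (l0 j).
  have Llm : (0 <= L * l i * m)%R := mulr_ge0 (Ll i) m0.
  have Dgam : (0 <= D * gam i)%R := mulr_ge0 (ltW D0) (gam0 i).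
  have Dm : (0 <= D * m)%R := mulr_ge0 (ltW D0) m0.
  have pt x y : cell q i x -> cell q i y ->
      (`|x - y| ^+ p <= (D * g x + L * l i) + D * g y)%R.
    move=> /andP[x1 x2] /andP[y1 y2].
    have cxy : (`|clamp K x - clamp K y| <= l i)%R.
      rewrite -!clE ler_norml.
      have := clnd _ _ (ltW x1); have := clnd _ _ x2.
      have := clnd _ _ (ltW y1); have := clnd _ _ y2; rewrite /l.
      move=> *; apply/andP; split; lra.
    have cxp : (`|clamp K x - clamp K y| ^+ p <= (2 * K) ^+ p.-1 * l i)%R.
      rewrite -[X in (_ ^+ X)%R](prednK p1) exprSr ler_pM ?exprn_ge0//.
      rewrite lerXn2r ?nnegrE ?mulr_ge0//; apply: le_trans cxy _.
      by have := clK (q i); have := clK (q i.+1); rewrite /l; lra.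
    have tri : (`|x - y| <= (`|x - clamp K x| + `|y - clamp K y|) +
        `|clamp K x - clamp K y|)%R.
      have -> : (x - y = (x - clamp K x - (y - clamp K y)) + (clamp K x - clamp K y))%R.
        by ring.
      by apply: le_trans (ler_normD _ _) _; rewrite lerD2r ler_normB.
    have h1 : (`|x - y| ^+ p <= 2 ^+ p * ((`|x - clamp K x| + `|y - clamp K y|) ^+ p +
        `|clamp K x - clamp K y| ^+ p))%R.
      apply: le_trans (exprn_add_le p _ _); rewrite ?addr_ge0//.
      by rewrite lerXn2r ?nnegrE ?addr_ge0.
    have h2 : ((`|x - clamp K x| + `|y - clamp K y|) ^+ p <= 2 ^+ p * (g x + g y))%R.
      exact: exprn_add_le.
    apply: (le_trans h1).
    have -> : (D * g x + L * l i + D * g y = 2 ^+ p * (2 ^+ p * (g x + g y) +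
      (2 * K) ^+ p.-1 * l i))%R by rewrite /D /L; ring.
    by rewrite ler_wpM2l ?exprn_ge0// lerD.
  have inner x : cell q i x -> \int[nu]_(y in cell q i) (`|(x : R) - y| ^+ p)%:E <=
      ((L * l i * m + D * gam i) + (D * m) * g x)%:E.
    move=> Cx; apply: (@le_trans _ _
        (\int[nu]_(y in cell q i) ((D * g x + L * l i) + D * g y)%:E)).
      apply: integral_mono => y Cy.
      - by rewrite lee_fin exprn_ge0.
      - by rewrite lee_fin (addr_ge0 (addr_ge0 (Dg x) (Ll i)) (Dg y)).
      - by split => //; rewrite lee_fin; exact: pt.
    rewrite (@integral_affine_on nu _ m (gam i))//; last 2 first.
    - exact: addr_ge0 (Dg x) (Ll i).
    - exact: ltW.
    by rewrite lee_fin le_eqVlt; apply/orP; left; apply/eqP; ring.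
  apply: (@le_trans _ _ (\int[nu]_(x in cell q i)
     ((L * l i * m + D * gam i) + (D * m) * g x)%:E)).
    apply: integral_mono => x Cx.
    - by apply: integral_ge0 => y _; rewrite lee_fin exprn_ge0.
    - by rewrite lee_fin (addr_ge0 (addr_ge0 Llm Dgam) (mulr_ge0 Dm (g0 x))).
    - by split => //; exact: inner.
  rewrite (@integral_affine_on nu _ m (gam i))//; last first.
  - exact: addr_ge0 Llm Dgam.
  by rewrite lee_fin le_eqVlt; apply/orP; left; apply/eqP; ring.
apply: (@le_trans _ _ ((M%:R)%:E *
    \sum_(i < M) (L * l i * m * m + 2 * D * m * gam i)%:E)).
  by rewrite lee_wpmul2l ?lee_fin ?(ltW M0')//; apply: lee_sum => i _; exact: bound.
rewrite sumEFin -EFinM lee_fin big_split/= -!mulr_sumr.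
rewrite (eq_bigr (fun i : 'I_M => L * m * m * l i)%R); last by move=> i _; ring.
rewrite -mulr_sumr mulrDr.
have -> : (M%:R * (L * m * m * \sum_(i < M) l i) = L / M%:R * \sum_(i < M) l i)%R.
  by rewrite /m; field; rewrite gt_eqF.
have -> : (M%:R * (2 * D * m * \sum_(i < M) gam i) = 2 * D * \sum_(i < M) gam i)%R.
  by rewrite /m; field; rewrite gt_eqF.
have h1 : (L / M%:R * \sum_(i < M) l i <= L / M%:R * (2 * K))%R.
  by rewrite ler_wpM2l// divr_ge0// ltW.
have h2 : (2 * D * \sum_(i < M) gam i <= 2 * D * (eps / (4 * D)))%R.
  by rewrite ler_wpM2l// mulr_ge0// ltW.
have e2 : (2 * D * (eps / (4 * D)) = eps / 2)%R by field; rewrite gt_eqF.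
have e3 : (L / M%:R * (2 * K) = 2 * L * K / M%:R)%R by ring.
by move: h1 h2; rewrite e2 e3; move: LM; lra.
Qed.

End discretization.

(** * Discretization of a measure of finite energy *)

Section discretization_lemma.
Context {R : realType} (p : nat) (W : R -> R) (a B : R).
Hypothesis cf : confining p W a B.
Local Notation RR := (measurableTypeR R).
Local Open Scope ereal_scope.
Local Notation kern := (kern W B).

Let mW := conf_meas cf.

Lemma conditional_full (nu : probability RR R) (C D : set RR) (mC : measurable C)
    (s : R) : (0 < s)%R -> nu C = s%:E -> measurable D -> nu D = 1 ->
  conditional nu mC (C `&` D) = 1.
Proof.
move=> s0 nuC mD nuD.
have P1 := conditional_mem mC s0 nuC.
have nuDc : nu (~` D) = 0 by rewrite probability_setC// nuD subee.
have CD0 : nu (C `&` ~` D) = 0.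
  have mDc := measurableC mD; have mCD := measurableI _ _ mC mDc.
  by apply/eqP; rewrite -measure_le0 -nuDc le_measure ?inE//; exact: subIsetr.
have nuCD : nu (C `&` D) = s%:E.
  have h : nu C = nu (C `&` ~` D) + nu (C `&` D) by rewrite -setDE; exact: measureDI.
  by rewrite CD0 add0e nuC in h.
rewrite /conditional /= /mnormalize /= /mrestr setTI nuC eqe gt_eqF//=.
by rewrite setIAC setIid nuCD -EFinM mulfV// gt_eqF.
Qed.

Lemma sum_conditional (nu : probability RR R) M q (f : RR -> \bar R) : (0 < M)%N ->
  quantiles nu M q -> measurable_fun setT f -> (forall x, 0 <= f x) ->
  \sum_(i < M) \int[conditional nu (measurable_cell q i)]_x f x =
  (M%:R)%:E * \int[nu]_x f x.
Proof.
move=> M0 Qq mf f0; rewrite -(sum_integral_cell Qq mf f0) ge0_sume_distrr//; last first.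
  by move=> i _; exact: integral_ge0.
apply: eq_bigr => i _; rewrite (@integral_conditional _ _ _ _ _ _ M%:R^-1)//.
- by rewrite invrK.
- by rewrite invr_gt0 ltr0n.
- exact: (quantile_mass Qq).
Qed.

(** Energy and transport cost must be small for the same points, so [averaging] is applied to their
    sum, the cost being weighted by [L * M ^ 2]. Both terms are nonnegative, so each is at most the
    common bound [M ^ 2 * (e + L * eps)]. *)
Lemma discretization (nu : probability RR R) (D : set RR) (eta : R) :
  measurable D -> nu D = 1 -> energy W B nu < +oo ->
  \int[nu]_x (W x)%:E < +oo -> (0 < eta)%R ->
  exists2 M0 : nat, (0 < M0)%N & forall M, (M0 <= M)%N ->
  exists q, exists x : nat -> R,
  [/\ quantiles nu M q,
      forall i, (i < M)%N -> cell q i (x i) /\ D (x i),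
      \sum_(i < M) \sum_(j < M | j != i) kern (x i) (x j) <=
        ((M ^ 2)%:R * (fine (energy W B nu) + eta))%:E &
      \sum_(i < M) \int[nu]_(y in cell q i) (`|x i - (y : R)| ^+ p)%:E <= eta%:E].
Proof.
move=> mD nuD Efin Wfin eta0; have E0 : 0 <= energy W B nu := energy_ge0 cf nu.
pose e := fine (energy W B nu).
have eE : energy W B nu = e%:E by rewrite fineK// ge0_fin_numE.
have e0 : (0 <= e)%R by rewrite fine_ge0.
(* Dividing the common bound by the weight gives a cost of at most [eps + e / L], whence
   [e / L <= eta / 2]; [e + 1] keeps [L] positive. Only then is [eps] chosen, with
   [L * eps <= eta]. *)
pose L : R := (2 * (e + 1) / eta)%R.
have L0 : (0 < L)%R by rewrite divr_gt0// mulr_gt0//; lra.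
pose eps : R := (Num.min (eta / 2) (eta / L))%R.
have eps0 : (0 < eps)%R by rewrite lt_min; apply/andP; split; exact: divr_gt0.
have Leps : (L * eps <= eta)%R.
  apply: (@le_trans _ _ (L * (eta / L))%R); last by rewrite mulrC divfK// gt_eqF.
  by rewrite ler_wpM2l ?(ltW L0)// ge_min lexx orbT.
have [M0 M00 hM0] := cell_cost cf eps0 (finite_pmoment cf Wfin).
exists M0 => // M M0M; have M_gt0 : (0 < M)%N := leq_trans M00 M0M.
have M0' : (0 < M%:R :> R)%R by rewrite ltr0n.
have iM0 : (0 < M%:R^-1 :> R)%R by rewrite invr_gt0.
have [q Qq] := exists_quantiles (energy_atomless cf Efin) M_gt0.
have hcost := hM0 M q M0M Qq.
pose P i : probability RR R := conditional nu (measurable_cell q i).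
pose dist (x y : RR) : \bar R := (`|(x : R) - y| ^+ p)%:E.
have d0 x y : 0 <= dist x y by rewrite lee_fin exprn_ge0.
have md := measurable_dist p (R := R).
have md2 x : measurable_fun setT (dist x) := measurable_dist2 p x.
pose f i (x : RR) : \bar R := (L * M%:R)%:E * \int[P i]_y dist x y.
(* Both orders of a pair are counted, since [averaging] sums over [j < i] only. *)
pose k (y x : RR) : \bar R := kern x y + kern y x.
have k0 x y : 0 <= kern x y := kern_ge0 cf x y.
have mk : measurable_fun setT (fun z : RR * RR => kern z.1 z.2) := measurable_kern B mW.
have mk' : measurable_fun setT (fun z : RR * RR => kern z.2 z.1).
  rewrite (_ : (fun _ => _) = (fun z : RR * RR => kern z.1 z.2))//.
  by apply/funext => z; rewrite kern_sym.
have mkI i : measurable_fun setT (fun x => \int[P i]_y kern x y).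
  exact: (measurable_fun_fubini_tonelli_F (fun z : RR * RR => kern z.1 z.2)).
have LM0 : (0 <= L * M%:R)%R by rewrite mulr_ge0 ?ltW.
have mdI i : measurable_fun setT (fun x => \int[P i]_y dist x y).
  exact: (measurable_fun_fubini_tonelli_F (fun z : RR * RR => dist z.1 z.2)).
have [|||||x Cx hx] := @averaging _ RR R P (fun i => cell q i `&` D) k M f.
- move=> i iM; split; first by apply: measurableI => //; exact: measurable_cell.
  by apply: (conditional_full _ iM0) => //; exact: (quantile_mass Qq).
- exact: emeasurable_funD.
- by move=> x y; rewrite adde_ge0.
- by move=> i; exact: measurable_funeM.
- by move=> i x; rewrite mule_ge0// ?lee_fin// integral_ge0.
pose A i j := \int[P i]_x \int[P j]_y kern x y.
have A0 i j : 0 <= A i j by apply: integral_ge0 => ? _; exact: integral_ge0.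
have kA (i j : nat) : \int[P i]_x \int[P j]_y k y x = A i j + A j i.
  rewrite /A (fubini_tonelli (fun z : RR * RR => kern z.1 z.2) (m1 := P j))//=.
  rewrite -ge0_integralD//=; last 4 first.
  - by move=> y _; exact: integral_ge0.
  - exact: mkI.
  - by move=> y _; exact: integral_ge0.
  - exact: (measurable_fun_fubini_tonelli_G (fun z : RR * RR => kern z.1 z.2)).
  apply: eq_integral => y _; rewrite ge0_integralD//.
  - exact: measurable_kern2.
  - exact: (measurableT_comp mk (measurable_pair2 y)).
(* Adding the nonnegative self-interactions [A i i] of the cells completes the double sum to [M ^ 2]
   times the energy of [nu], because the conditional laws average to [nu]. *)
have sumA : \sum_(i < M) \sum_(j < i) \int[P i]_x \int[P j]_y k y x <=
    ((M ^ 2)%:R * e)%:E.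
  under eq_bigr do under eq_bigr do rewrite kA.
  rewrite -(sum_neq_lt M A).
  apply: (@le_trans _ _ (\sum_(i < M) \sum_(j < M) A i j)).
    apply: lee_sum => i _; rewrite big_mkcond; apply: lee_sum => j _.
    by case: ifPn.
  rewrite (eq_bigr (fun i : 'I_M => (M%:R)%:E * \int[P i]_x \int[nu]_y kern x y)).
    rewrite -ge0_sume_distrr; last first.
      by move=> i _; apply: integral_ge0 => ? _; exact: integral_ge0.
    rewrite (sum_conditional M_gt0 Qq)//; last 2 first.
    - exact: measurable_energy_inner cf _.
    - by move=> y; exact: integral_ge0.
    by rewrite -/(energy W B nu) eE -!EFinM lee_fin natrX expr2 mulrA.
  move=> i _; rewrite /A -ge0_integral_sum//=; last 2 first.
  - by move=> j; exact: mkI.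
  - by move=> j y _; exact: integral_ge0.
    rewrite (eq_integral (fun x : RR => (M%:R)%:E * \int[nu]_y kern x y)) => [|y _].
    have mE := measurable_energy_inner cf nu.
    have E0' z : 0 <= \int[nu]_y kern z y by exact: integral_ge0.
    by rewrite ge0_integralZl_EFin ?ler0n.
  by rewrite (sum_conditional M_gt0 Qq)//; exact: measurable_kern2.
have sumf : \sum_(i < M) \int[P i]_x f i x <= ((M ^ 2)%:R * (L * eps))%:E.
  have fE (i : 'I_M) : \int[P i]_x f i x = ((L * M%:R) * M%:R * M%:R)%:E *
      \int[nu]_(x in cell q i) \int[nu]_(y in cell q i) dist x y.
    have nuC : nu (cell q i) = (M%:R^-1)%:E by exact: (quantile_mass Qq).
    have condE (h : RR -> \bar R) : measurable_fun setT h -> (forall x, 0 <= h x) ->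
        \int[P i]_y h y = (M%:R)%:E * \int[nu]_(y in cell q i) h y.
      by move=> mh h0; rewrite (@integral_conditional _ _ _ _ _ _ M%:R^-1)// invrK.
    have I0 z : 0 <= \int[P i]_y dist z y by exact: integral_ge0.
    have J0 z : 0 <= \int[nu]_(y in cell q i) dist z y by exact: integral_ge0.
    have mJ : measurable_fun setT (fun z => \int[nu]_(y in cell q i) dist z y).
      rewrite (_ : (fun _ => _) = fun z => (M%:R^-1)%:E * \int[P i]_y dist z y).
        exact: measurable_funeM.
      apply/funext => z; rewrite condE// muleA -EFinM mulVf ?mul1e//.
      by rewrite gt_eqF.
    rewrite ge0_integralZl_EFin// condE//.
    rewrite (eq_integral (fun z : RR => (M%:R)%:E * \int[nu]_(y in cell q i) dist z y)).
      rewrite ge0_integralZl_EFin ?ler0n//=.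
      - by rewrite !muleA -!EFinM.
      - exact: measurable_cell.
      - exact: measurable_funTS.
    by move=> z _; exact: condE.
  under eq_bigr do rewrite fE.
  rewrite -ge0_sume_distrr; last first.
    by move=> i _; apply: integral_ge0 => ? _; exact: integral_ge0.
  rewrite EFinM -muleA; apply: (@le_trans _ _ ((L * M%:R * M%:R)%:E * eps%:E)).
    by rewrite lee_wpmul2l// lee_fin mulr_ge0.
  by rewrite -EFinM lee_fin natrX le_eqVlt; apply/orP; left; apply/eqP; ring.
exists q, x; split => //.
- have h : \sum_(i < M) \sum_(j < i) k (x j) (x i) =
      \sum_(i < M) \sum_(j < M | j != i) kern (x i) (x j).
    by rewrite (sum_neq_lt M (fun i j => kern (x i) (x j))).
  rewrite -h; apply: (@le_trans _ _ (\sum_(i < M) f i (x i) +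
      \sum_(i < M) \sum_(j < i) k (x j) (x i))).
    rewrite leeDr// sume_ge0// => i _.
    by rewrite mule_ge0// ?lee_fin// integral_ge0.
  apply: (le_trans hx); apply: (le_trans (leeD sumf sumA)).
  rewrite -EFinD lee_fin -mulrDr ler_wpM2l ?ler0n//.
  by rewrite -/e; clear - mW Leps; lra. (* [lra] fails if a section variable is cleared *)
- have hf : \sum_(i < M) f i (x i) = (L * M%:R * M%:R)%:E *
      \sum_(i < M) \int[nu]_(y in cell q i) dist (x i) y.
    rewrite ge0_sume_distrr; last by move=> i _; exact: integral_ge0.
    apply: eq_bigr => i _; rewrite /f (@integral_conditional _ _ _ _ _ _ M%:R^-1)//.
      by rewrite invrK muleA -EFinM.
    exact: (quantile_mass Qq).
  have : \sum_(i < M) f i (x i) <= ((M ^ 2)%:R * (L * eps) + (M ^ 2)%:R * e)%:E.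
    apply: (@le_trans _ _ (\sum_(i < M) f i (x i) +
      \sum_(i < M) \sum_(j < i) k (x j) (x i))).
      rewrite leeDl// sume_ge0// => i _; rewrite sume_ge0// => j _.
      by rewrite adde_ge0.
    by apply: (le_trans hx); rewrite EFinD leeD.
  rewrite hf -lee_pdivlMl; last by rewrite mulr_gt0// mulr_gt0.
  move=> /le_trans; apply; rewrite -EFinM lee_fin natrX.
  have -> : ((L * M%:R * M%:R)^-1 * (M%:R ^+ 2 * (L * eps) + M%:R ^+ 2 * e) =
    eps + e / L)%R by field; rewrite !gt_eqF.
  have : (eps <= eta / 2)%R by rewrite ge_min lexx.
  have : (e / L <= eta / 2)%R.
    rewrite ler_pdivrMr// /L.
    have -> : (eta / 2 * (2 * (e + 1) / eta) = e + 1)%R by field; rewrite gt_eqF.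
    by clear - mW; lra.
  by clear - mW; lra.
Qed.

End discretization_lemma.

(** * Energy of smeared configurations *)

Section asymptotics.
Context {R : realType}.

Lemma ln_le_sqrt (x : R) : 0 < x -> ln x <= 2 * Num.sqrt x.
Proof.
move=> x0; have s0 : 0 < Num.sqrt x by rewrite sqrtr_gt0.
rewrite -[in leLHS](sqr_sqrtr (ltW x0)) lnXn// mulr2n.
by have := ln_sublinear s0; lra.
Qed.

Lemma log_sublinear (C eta : R) : 0 < eta -> exists2 N0 : nat, (0 < N0)%N &
  forall N : nat, (N0 <= N)%N -> C * (1 + ln N%:R) <= eta * N%:R.
Proof.
move=> eta0; pose D := `|C| * 3 / eta.
exists (Num.truncn (D ^+ 2)).+1 => // N hN.
have ND : D ^+ 2 <= N%:R.
  by apply: le_trans (ltW (truncnS_gt _)) _; rewrite ler_nat.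
have N1 : 1 <= N%:R :> R by rewrite ler1n (leq_trans _ hN).
have N0 : 0 < N%:R :> R by rewrite (lt_le_trans _ N1).
have s1 : 1 <= Num.sqrt N%:R :> R by rewrite -[leLHS]sqrtr1 ler_sqrt.
have Ds : D <= Num.sqrt N%:R.
  have D0 : 0 <= D by rewrite divr_ge0 ?(ltW eta0)// mulr_ge0.
  by rewrite -[leLHS](ger0_norm D0) -sqrtr_sqr ler_sqrt.
have l0 : 0 <= ln N%:R :> R by rewrite ln_ge0.
apply: (@le_trans _ _ (`|C| * (3 * Num.sqrt N%:R))).
  apply: (@le_trans _ _ (`|C| * (1 + ln N%:R))).
    by rewrite ler_wpM2r ?ler_norm// addr_ge0.
  by rewrite ler_wpM2l//; have := ln_le_sqrt N0; lra.
rewrite -[in leRHS](sqr_sqrtr (ltW N0)) expr2 !mulrA ler_wpM2r ?sqrtr_ge0//.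
by move: Ds; rewrite /D ler_pdivrMr// [eta * _]mulrC.
Qed.

End asymptotics.

Section mixture.
Context d (T : measurableType d) (R : realType).
Local Open Scope ereal_scope.

Lemma integral_mixture (m : {measure set T -> \bar R}^nat) (Q : probability T R)
    (N : nat) (f : T -> \bar R) : (0 < N)%N -> (forall i, m i setT = 1) ->
  measurable_fun setT f -> (forall x, 0 <= f x) ->
  \int[mnormalize (msum m N) Q]_x f x = (N%:R^-1)%:E * \sum_(i < N) \int[m i]_x f x.
Proof.
move=> N0 m1 mf f0; rewrite (@integral_mnormalize _ _ _ _ _ N%:R)//.
- by rewrite ge0_integral_measure_sum.
- by rewrite ltr0n.
- rewrite /= /msum (eq_bigr (fun=> 1%:E)) => [|i _]; last by rewrite m1.
  by rewrite sumEFin sumr_const card_ord.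
Qed.

End mixture.

Section uniform.
Context {R : realType}.
Local Notation RR := (measurableTypeR R).
Local Open Scope ereal_scope.
Variables (x0 r : R).
Hypothesis r0 : (0 < r)%R.

Lemma lt_addr_pos : (x0 < x0 + r)%R. Proof. by rewrite ltrDl. Qed.

Definition unif : probability RR R := uniform_prob lt_addr_pos.

Lemma integral_unif (f : RR -> \bar R) : measurable_fun setT f ->
  (forall x, 0 <= f x) ->
  \int[unif]_x f x =
  (r^-1)%:E * \int[lebesgue_measure]_(x in `[x0, (x0 + r)%R]%classic) f x.
Proof.
move=> mf f0; rewrite /unif integral_uniform//.
by rewrite (_ : (x0 + r - x0 = r)%R) //; ring.
Qed.

Lemma lebesgue_unif :
  lebesgue_measure (`[x0, (x0 + r)%R]%classic : set RR) = r%:E.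
Proof.
rewrite lebesgue_measure_itv/= lte_fin lt_addr_pos -EFinD; congr (_%:E); ring.
Qed.

Lemma integral_unif_le (f : RR -> \bar R) (c : R) : measurable_fun setT f ->
  (forall x, 0 <= f x) -> (forall x, (x0 <= x <= x0 + r)%R -> f x <= c%:E) ->
  \int[unif]_x f x <= c%:E.
Proof.
move=> mf f0 fc; rewrite integral_unif//.
have c0 : 0 <= c%:E by apply: le_trans (f0 x0) (fc x0 _); rewrite lexx/= ltW// lt_addr_pos.
apply: (@le_trans _ _ ((r^-1)%:E *
    \int[lebesgue_measure]_(x in `[x0, (x0 + r)%R]%classic) (cst c%:E) x)).
  rewrite lee_wpmul2l ?lee_fin ?invr_ge0 ?(ltW r0)//.
  apply: integral_mono => x //=; rewrite in_itv/= => xr; split => //.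
  exact: fc.
rewrite integral_cst//= lebesgue_unif -EFinM lee_fin mulrCA mulVf ?mulr1//.
by rewrite gt_eqF.
Qed.

End uniform.

Section smear.
Context {R : realType} (p : nat) (W : R -> R) (a B : R).
Hypothesis cf : confining p W a B.
Local Notation RR := (measurableTypeR R).
Local Open Scope ereal_scope.
Local Notation kern := (kern W B).
Local Notation kcut := (kcut W B).
Local Notation kreal := (kreal W B).

Let mW := conf_meas cf.

(** A layer-cake bound: each factor [e] by which [t] falls below [r] adds one indicator, so that
    integrating the logarithm reduces to measuring intervals. *)
Lemma ln_cut_le (r t : R) (n : nat) : (0 < r)%R ->
  (- ln (Num.max t (expR (- (n%:R - ln r)))) <=
   - ln r + \sum_(k < n) (t <= r * expR (- k%:R))%R%:R)%R.
Proof.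
move=> r0; have E k : expR (- (k%:R - ln r)) = (r * expR (- k%:R))%R.
  by rewrite opprB addrC expRD lnK ?posrE// mulrC.
rewrite E; elim: n => [|n IH].
  rewrite big_ord0 addr0 oppr0 expR0 mulr1 lerN2 ler_ln ?posrE ?le_max ?lexx ?orbT//.
  by rewrite lt_max r0 orbT.
rewrite big_ord_recr/=.
have p0 k : (0 < r * expR (- k%:R))%R by rewrite mulr_gt0// expR_gt0.
have pS : (r * expR (- n.+1%:R) <= r * expR (- n%:R))%R.
  by rewrite ler_pM2l// ler_expR lerN2 ler_nat.
have [tn|tn] := leP t (r * expR (- n%:R))%R.
  rewrite max_r// in IH.
  have : (- ln (Num.max t (r * expR (- n.+1%:R))) <= - ln (r * expR (- n.+1%:R)))%R.
    by rewrite lerN2 ler_ln ?posrE ?lt_max ?p0 ?orbT// le_max lexx orbT.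
  move: IH; rewrite !lnM ?posrE ?expR_gt0// !expRK -natr1 /=; lra.
rewrite max_l ?(le_trans pS) ?(ltW tn)// addr0.
by move: IH; rewrite max_l// ltW.
Qed.

Lemma sum_expN_le (n : nat) : (\sum_(k < n) expR (- k%:R) <= (2 : R))%R.
Proof.
have e1 : (expR (- 1) <= 2^-1 :> R)%R.
  by rewrite expRN lef_pV2 ?posrE ?expR_gt0//; have := expR_ge1Dx (1 : R); lra.
have h k : (expR (- k%:R) <= (2^-1) ^+ k :> R)%R.
  rewrite -[X in expR (- X)]mulr1 -mulrN expRM_natl.
  by rewrite lerXn2r ?nnegrE ?expR_ge0.
apply: (@le_trans _ _ (2 - 2 * 2^-1 ^+ n)%R); last first.
  by rewrite gerBl mulr_ge0// exprn_ge0.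
elim: n => [|n IH]; first by rewrite big_ord0 expr0; lra.
by rewrite big_ord_recr/= exprS; have := h n; move: IH; lra.
Qed.

Lemma measurable_near (x t : R) : measurable [set y : RR | (`|x - y| <= t)%R].
Proof.
rewrite (_ : [set _ | _] = `[(x - t)%R, (x + t)%R]%classic); first exact: measurable_itv.
apply/seteqP; split => y /=; rewrite in_itv/= ler_norml.
  by move=> /andP[h1 h2]; apply/andP; split; lra.
by move=> /andP[h1 h2]; apply/andP; split; lra.
Qed.

(** The logarithmic singularity is integrable, so the self-energy of an interval of length [r] is
    only about [- ln r]. The layers have length at most [2 * r * expR (- k)] and the exponentials
    sum to at most 2, whence the constant 4. *)
Lemma unif_kern_le (x0 r x w : R) (r0 : (0 < r)%R) : (r <= 1)%R ->
  (forall y, (x0 <= y <= x0 + r)%R -> ((W x + W y) / 2 <= w)%R) ->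
  \int[unif x0 r0]_y kern x y <= (w + B - ln r + 4)%:E.
Proof.
move=> r1 hw.
pose nn (n : nat) : R := (n%:R - ln r)%R.
have lr : (0 <= - ln r)%R by rewrite oppr_ge0 ln_le0.
have nn0 n : (0 <= nn n)%R by rewrite addr_ge0.
have mk n : measurable_fun setT (fun y : RR => (kcut (nn n) x y)%:E).
  by apply/measurable_EFinP; exact: measurable_kcut2.
have cv : \int[unif x0 r0]_y (kcut (nn n) x y)%:E @[n --> \oo] -->
    \int[unif x0 r0]_y kern x y.
  rewrite [X in _ --> X](eq_integral (fun y : RR => limn (fun n => (kcut (nn n) x y)%:E))).
    apply: cvg_monotone_convergence => //.
    - by move=> n y _; rewrite lee_fin; exact: (kcut_ge0 cf).
    - move=> y _ n m nm; rewrite lee_fin; apply: kcut_nd.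
      by rewrite lerD2r ler_nat.
  move=> y _; apply/esym/cvg_lim => //.
  apply: (@squeeze_cvge _ _ _ _ (fun n => (kcut n%:R x y)%:E) _ (fun=> kern x y));
    [|exact: cvg_kcut|exact: cvg_cst].
  apply: nearW => n; rewrite kcut_le_kern andbT lee_fin; apply: kcut_nd.
  by rewrite /nn lerDl.
rewrite -(cvg_lim _ cv)//; apply: lime_le; first by apply/cvg_ex; eexists; exact: cv.
apply: nearW => n.
rewrite integral_unif//; last by move=> y; rewrite lee_fin; exact: (kcut_ge0 cf).
have w0 : (0 <= w)%R.
  apply: le_trans (hw x0 _); last by rewrite lexx/= ltW// ltrDl.
  by rewrite divr_ge0// addr_ge0//; exact: confining_ge0 cf _.
set D : set RR := `[x0, (x0 + r)%R]%classic.
pose A (k : nat) : set RR := [set y : RR | (`|x - y| <= r * expR (- k%:R))%R].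
have mA k : measurable (A k) by exact: measurable_near.
have mD : measurable D by exact: measurable_itv.
have c0 : (0 <= w + B - ln r)%R by rewrite -addrA !addr_ge0// (conf_B cf).
apply: (@le_trans _ _ ((r^-1)%:E * \int[lebesgue_measure]_(y in D)
    ((w + B - ln r)%:E + \sum_(k < n) (\1_(A k) y)%:E))).
  rewrite lee_wpmul2l ?lee_fin ?invr_ge0 ?(ltW r0)//.
  apply: integral_mono => y Dy.
  - by rewrite lee_fin; exact: (kcut_ge0 cf).
  - by rewrite adde_ge0// sume_ge0// => k _; rewrite lee_fin.
  split => //; rewrite sumEFin -EFinD lee_fin kcutE.
  have h1 : ((W x + W y) / 2 <= w)%R by apply: hw; move: Dy; rewrite /D/= in_itv.
  have := ln_cut_le `|x - y|%R n r0.
  rewrite (eq_bigr (fun k : 'I_n => \1_(A k) y : R)%R); last first.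
    by move=> k _; rewrite indicE; congr (_%:R); rewrite /A mem_setE.
  by rewrite /nn; lra.
have mI k : measurable_fun D (fun y => (\1_(A k) y)%:E).
  by apply/measurable_EFinP; apply: measurable_funTS; exact: measurable_indic.
have I0 k (y : RR) : 0 <= (\1_(A k) y)%:E :> \bar R by rewrite lee_fin.
rewrite ge0_integralD//; last 2 first.
- by move=> y _; exact: sume_ge0.
- exact: emeasurable_sum.
rewrite integral_cst// ge0_integral_sum//.
have Dr : lebesgue_measure D = r%:E by exact: lebesgue_unif.
apply: (@le_trans _ _ ((r^-1)%:E * ((w + B - ln r)%:E * r%:E +
    \sum_(k < n) (2 * r * expR (- k%:R))%:E))).
  rewrite lee_wpmul2l ?lee_fin ?invr_ge0 ?(ltW r0)//.
  apply: leeD.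
    by rewrite le_eqVlt; apply/orP; left; apply/eqP; congr (_ * _); exact: Dr.
  apply: lee_sum => k _; rewrite integral_indic//.
  apply: (@le_trans _ _ (lebesgue_measure (A k))).
    by apply: le_measure; rewrite ?inE//; exact: measurableI.
  have -> : A k = `[(x - r * expR (- k%:R))%R, (x + r * expR (- k%:R))%R]%classic.
    apply/seteqP; split => y; rewrite /A/= in_itv/= ler_norml => /andP[h1 h2];
    apply/andP; split; lra.
  rewrite lebesgue_measure_itv/=; case: ifPn => _.
    by rewrite -EFinD lee_fin; lra.
  by rewrite lee_fin !mulr_ge0 ?expR_ge0 ?(ltW r0).
rewrite sumEFin -EFinM lee_fin -mulr_sumr mulrDr.
rewrite mulrCA mulVf ?gt_eqF// mulr1 lerD2l.
have -> : (r^-1 * (2 * r * \sum_(i < n) expR (- i%:R)) =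
  2 * \sum_(i < n) expR (- i%:R))%R by field; rewrite gt_eqF.
by have := sum_expN_le n; lra.
Qed.

End smear.

Section smearing.
Context {R : realType} (p : nat) (W : R -> R) (a B : R).
Hypothesis cf : confining p W a B.
Local Notation RR := (measurableTypeR R).
Local Notation kern := (kern W B).
Local Notation kreal := (kreal W B).

Let mW := conf_meas cf.

(** Each [W (x i)] occurs in [2 * (N - 1)] ordered pairs with weight 1/4. The pair energy thus
    bounds the sum of the potentials with a gain of a factor [N], which makes every leftover
    one-body term negligible. *)
Lemma sum_kreal_ge (N : nat) (x : nat -> R) :
  (forall i j, (i < N)%N -> (j < N)%N -> i != j -> x i != x j) ->
  (N%:R - 1) / 2 * \sum_(i < N) W (x i) <=
  \sum_(i < N) \sum_(j < N | j != i) kreal (x i) (x j).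
Proof.
move=> xinj.
have -> : (N%:R - 1) / 2 * \sum_(i < N) W (x i) =
    \sum_(i < N) \sum_(j < N | j != i) (W (x i) + W (x j)) / 4.
  have -> : \sum_(i < N) \sum_(j < N | j != i) (W (x i) + W (x j)) / 4 =
      \sum_(i < N) (\sum_(j < N) (W (x i) + W (x j)) / 4 - W (x i) / 2).
    apply: eq_bigr => i _; rewrite [in RHS](bigD1 i)//=.
    by rewrite [X in _ = X]addrAC (_ : (W (x i) + W (x i)) / 4 - W (x i) / 2 = 0) ?add0r//; field.
  rewrite sumrB.
  have -> : \sum_(i < N) \sum_(j < N) (W (x i) + W (x j)) / 4 =
      N%:R / 2 * \sum_(i < N) W (x i).
    under eq_bigr do rewrite -mulr_suml big_split/= sumr_const card_ord -mulr_natl.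
    rewrite -mulr_suml big_split/= sumr_const card_ord sumrMnl -[X in (X + _) / _]mulr_natl.
    by field.
  by rewrite -mulr_suml; field.
apply: ler_sum => i _; apply: ler_sum => j ji; apply: (kreal_ge cf).
by apply: xinj => //; rewrite eq_sym.
Qed.

(** Counting the points to the left orders the configuration without changing its indexing. *)
Definition rank (N : nat) (x : nat -> R) (i : nat) : nat :=
  (\sum_(j < N) (x j < x i)%R)%N.

Lemma rank_le N x i : (rank N x i <= N)%N.
Proof.
rewrite /rank -[leqRHS]card_ord -sum1_card; apply: leq_sum => j _; exact: leq_b1.
Qed.

Lemma rank_lt N x i j : (i < N)%N -> x i < x j -> (rank N x i < rank N x j)%N.
Proof.
move=> iN xij; rewrite /rank (bigD1 (Ordinal iN))//= ltxx add0n.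
rewrite [ltnRHS](bigD1 (Ordinal iN))//= xij add1n ltnS; apply: leq_sum => k _.
by case: ltP => // xki; rewrite (lt_trans xki xij).
Qed.

Local Open Scope ereal_scope.

Lemma finite_energy_exists : exists2 nu : probability RR R,
  \int[nu]_x (W x)%:E < +oo & energy W B nu < +oo.
Proof.
have [C C0 hC] := conf_le cf.
have Wb y : (0 <= y <= 0 + 1)%R -> (W y <= C * 2)%R.
  move=> /andP[y0 y1]; apply: (le_trans (hC y)); rewrite ler_wpM2l//.
  by rewrite ger0_norm// lerD2l exprn_ile1//; lra.
exists (unif 0 (@ltr01 R)).
  apply: (@le_lt_trans _ _ (C * 2)%:E); last exact: ltry.
  apply: integral_unif_le; first exact/measurable_EFinP.
  - by move=> x; rewrite lee_fin; exact: confining_ge0 cf _.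
  - by move=> y hy; rewrite lee_fin; exact: Wb.
apply: (@le_lt_trans _ _ (C * 2 + B - ln 1 + 4)%:E); last exact: ltry.
apply: integral_unif_le; first exact: measurable_energy_inner cf _.
- by move=> x; apply: integral_ge0 => y _; exact: kern_ge0 cf _ _.
- move=> x hx; apply: (unif_kern_le cf) => // y hy.
  by have := Wb x hx; have := Wb y hy; lra.
Qed.

(* The atoms are smeared into uniform measures on intervals of length [N^-2],
   pushed apart in increasing order so that no distance shrinks. *)
Lemma energy_lower (e : R) :
  (forall nu : probability RR R, \int[nu]_x (W x)%:E < +oo -> e%:E <= energy W B nu) ->
  forall eta : R, (0 < eta)%R -> exists2 N0 : nat, (0 < N0)%N &
  forall (N : nat) (x : nat -> R), (N0 <= N)%N ->
  (forall i j, (i < N)%N -> (j < N)%N -> i != j -> x i != x j) ->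
  (e <= (1 + eta) * ((\sum_(i < N) \sum_(j < N | j != i) kreal (x i) (x j))
          / N%:R ^+ 2) + eta)%R.
Proof.
move=> he eta eta0.
pose h : R := (Num.min 1 (eta / 8))%R.
have h0 : (0 < h)%R by rewrite lt_min ltr01/= divr_gt0.
have h1 : (h <= 1)%R by rewrite ge_min lexx.
have h8 : (8 * h <= eta)%R.
  have : (h <= eta / 8)%R by rewrite ge_min lexx orbT.
  by lra.
have [d d0 hd] := confining_shift cf h0.
have [N1 N10 hN1] := log_sublinear (`|B + 5| + 2)%R h0.
pose N2 := (Num.truncn (3 / d)%R).+1; pose N3 := (Num.truncn (2 / h)%R).+2.
exists (maxn N1 (maxn N2 N3)); first by rewrite leq_max N10.
move=> N x; rewrite !geq_max => /and3P[NN1 NN2 NN3] xinj.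
have N_gt0 : (0 < N)%N by rewrite (leq_trans _ NN2).
have N0 : (0 < N%:R :> R)%R by rewrite ltr0n.
have Nge1 : (1 <= N%:R :> R)%R by rewrite ler1n.
have Nd : (3 / N%:R <= d)%R.
  rewrite ler_pdivrMr// mulrC -ler_pdivrMr//.
  by apply: le_trans (ltW (truncnS_gt _)) _; rewrite ler_nat.
have Nh : (2 <= h * (N%:R - 1))%R.
  rewrite mulrC -ler_pdivrMr//.
  have : ((Num.truncn (2 / h)%R).+1%:R + 1 <= N%:R :> R)%R by rewrite natr1 ler_nat.
  by have := truncnS_gt (2 / h)%R; lra.
(* Small enough for the total displacement, at most [2 * r * N + r], to vanish, while
   [- ln r = 2 * ln N] keeps the [N] self-energies of order [N * ln N]. *)
pose r : R := (N%:R ^- 2)%R.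
have r0 : (0 < r)%R by rewrite invr_gt0 exprn_gt0.
have r1 : (r <= 1)%R by rewrite invf_le1 ?exprn_gt0// exprn_ege1.
have rN : (2 * r * N%:R + r <= 3 / N%:R)%R.
  have -> : (2 * r * N%:R = 2 / N%:R)%R by rewrite /r; field; rewrite gt_eqF.
  have : (r <= N%:R^-1)%R.
    by rewrite lef_pV2 ?posrE ?exprn_gt0// expr2 ler_peMl// ltW.
  by lra.
(* A shift of [2 * r] per rank compensates the length [r] of the left interval and leaves a further
   [r], so points of distinct intervals are at least as far apart as the atoms. *)
pose b i : R := (x i + 2 * r * (rank N x i)%:R)%R.
have bx i y : (b i <= y <= b i + r)%R -> (`|x i - y| <= d)%R.
  move=> /andP[by1 by2]; apply: le_trans Nd; apply: le_trans rN.
  have k0 : (0 <= 2 * r * (rank N x i)%:R)%R by rewrite !mulr_ge0// ltW.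
  have k1 : (2 * r * (rank N x i)%:R <= 2 * r * N%:R)%R.
    by rewrite ler_wpM2l ?mulr_ge0 ?(ltW r0)// ler_nat rank_le.
  by rewrite /b in by1 by2; rewrite distrC ger0_norm; clear - mW by1 by2 k0 k1; lra.
have Wb i y : (b i <= y <= b i + r)%R -> (W y <= (1 + h) * W (x i) + h)%R.
  by move=> /bx; exact: hd.
have W0 y : (0 <= W y)%R := confining_ge0 cf y.
have gap i j u v : (i < N)%N -> (j < N)%N -> i != j ->
    (b i <= u <= b i + r)%R -> (b j <= v <= b j + r)%R -> (`|x i - x j| <= `|u - v|)%R.
  have aux i' j' u' v' : (i' < N)%N -> (x i' < x j')%R -> (b i' <= u' <= b i' + r)%R ->
      (b j' <= v' <= b j' + r)%R -> (`|x i' - x j'| <= `|u' - v'|)%R.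
    move=> i'N xlt /andP[u1 u2] /andP[v1 v2].
    have rk : (2 * r * (rank N x i')%:R + 2 * r <= 2 * r * (rank N x j')%:R)%R.
      rewrite -[X in (_ + X)%R]mulr1 -mulrDr ler_wpM2l ?mulr_ge0 ?(ltW r0)//.
      by rewrite natr1 ler_nat rank_lt.
    have duv : (x j' - x i' <= v' - u')%R by rewrite /b in u2 v1; clear - mW u2 v1 rk r0; lra.
    by rewrite distrC (distrC u') !ger0_norm; clear - mW duv xlt; lra.
  move=> iN jN ij hu hv; have := xinj i j iN jN ij.
  rewrite neq_lt => /orP[xlt|xlt]; first exact: aux hu hv.
  by rewrite distrC (distrC u); exact: aux hv hu.
pose U i : probability RR R := unif (b i) r0.
pose nu : probability RR R := mnormalize (msum U N) (U 0%N).
have k0 u v : 0 <= kern u v := kern_ge0 cf u v.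
have mk u : measurable_fun setT (fun v : RR => kern u v) by exact: measurable_kern2.
have mE i : measurable_fun setT (fun u : RR => \int[U i]_v kern u v).
  exact: measurable_energy_inner cf (U i).
have E0 i u : 0 <= \int[U i]_v kern u v by exact: integral_ge0.
have nuE (f : RR -> \bar R) : measurable_fun setT f -> (forall x, 0 <= f x) ->
    \int[nu]_u f u = (N%:R^-1)%:E * \sum_(i < N) \int[U i]_u f u.
  move=> mf f0; apply: integral_mixture => // i; exact: probability_setT.
have Wfin : \int[nu]_u (W u)%:E < +oo.
  rewrite nuE; last 2 first.
  - exact/measurable_EFinP.
  - by move=> y; rewrite lee_fin.
  apply: (@le_lt_trans _ _ ((N%:R^-1)%:E * \sum_(i < N) ((1 + h) * W (x i) + h)%:E)).
    rewrite lee_wpmul2l ?lee_fin ?invr_ge0 ?(ltW N0)//; apply: lee_sum => i _.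
    apply: integral_unif_le; first exact/measurable_EFinP.
    - by move=> y; rewrite lee_fin.
    - by move=> y hy; rewrite lee_fin; exact: Wb.
  by rewrite sumEFin -EFinM ltry.
pose S : R := (\sum_(i < N) \sum_(j < N | j != i) kreal (x i) (x j))%R.
pose T : R := (\sum_(i < N) W (x i))%R.
have pair (i j : 'I_N) : \int[U i]_u \int[U j]_v kern u v <=
    (if j == i then (1 + h) * W (x i) + h + B - ln r + 4
     else (1 + 2 * h) * kreal (x i) (x j) + h)%:E.
  apply: integral_unif_le => //.
  - case: eqVneq => [->|ji] u hu.
      apply: (unif_kern_le cf) => // v hv.
      by have k1 := Wb i u hu; have k2 := Wb i v hv; clear - mW k1 k2; lra.
    apply: integral_unif_le => // v hv.
    have ij : x i != x j by apply: xinj => //; rewrite eq_sym.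
    have guv : (`|x i - x j| <= `|u - v|)%R by apply: gap hu hv => //; rewrite eq_sym.
    have uv : u != v.
      by rewrite -subr_eq0 -normr_gt0 (lt_le_trans _ guv)// normr_gt0 subr_eq0.
    rewrite kernE// lee_fin; apply: (kreal_spread cf) => //; exact: Wb.
have T0 : (0 <= T)%R by apply: sumr_ge0.
have TS : ((N%:R - 1) / 2 * T <= S)%R by exact: sum_kreal_ge.
(* The diagonal pairs bring one extra copy of each potential, a small fraction of the pair energy
   once [N] is large. *)
have ThS : (T <= h * S)%R.
  have k1 : (h * ((N%:R - 1) / 2 * T) <= h * S)%R by rewrite ler_wpM2l// ltW.
  have k2 : (1 * T <= (h * (N%:R - 1) / 2) * T)%R.
    by rewrite ler_wpM2r//; clear - mW Nh; lra.
  by clear - mW k1 k2; lra.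
have := he nu Wfin; rewrite /energy.
have -> : \int[nu]_u \int[nu]_v kern u v =
    (N%:R^-1 ^+ 2)%:E * \sum_(i < N) \sum_(j < N) \int[U i]_u \int[U j]_v kern u v.
  rewrite nuE; last 2 first.
  - exact: measurable_energy_inner cf nu.
  - by move=> y; exact: integral_ge0.
  rewrite expr2 EFinM -muleA; congr (_ * _).
  rewrite ge0_sume_distrr; last by move=> i _; apply: sume_ge0 => j _; exact: integral_ge0.
  apply: eq_bigr => i _.
  rewrite (eq_integral (fun u : RR => (N%:R^-1)%:E * \sum_(j < N) \int[U j]_v kern u v));
    last by move=> u _; rewrite nuE.
  rewrite ge0_integralZl_EFin ?invr_ge0//; last 2 first.
  - by move=> u _; apply: sume_ge0 => j _; exact: E0.
  - by apply: emeasurable_sum => j; exact: mE.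
  by rewrite ge0_integral_sum//; move=> j; exact: mE.
have bnd : \sum_(i < N) \sum_(j < N) \int[U i]_u \int[U j]_v kern u v <=
    ((1 + 2 * h) * S + h * N%:R ^+ 2 + (1 + h) * T + N%:R * (h + B - ln r + 4))%:E.
  apply: (@le_trans _ _ (\sum_(i < N) \sum_(j < N)
    (if j == i then (1 + h) * W (x i) + h + B - ln r + 4
     else (1 + 2 * h) * kreal (x i) (x j) + h)%:E)).
    by apply: lee_sum => i _; apply: lee_sum => j _; exact: pair.
  under eq_bigr do rewrite sumEFin.
  rewrite sumEFin lee_fin.
  have row (i : 'I_N) : (\sum_(j < N) (if j == i then (1 + h) * W (x i) + h + B - ln r + 4
      else (1 + 2 * h) * kreal (x i) (x j) + h) <=
     (1 + 2 * h) * (\sum_(j < N | j != i) kreal (x i) (x j)) + h * N%:R +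
      ((1 + h) * W (x i) + (h + B - ln r + 4)))%R.
    rewrite (bigD1 i)//= eqxx.
    rewrite (eq_bigr (fun j : 'I_N => (1 + 2 * h) * kreal (x i) (x j) + h)%R); last first.
      by move=> j /negbTE ->.
    rewrite big_split/= -mulr_sumr.
    have rs : (\sum_(j < N | j != i) h <= h * N%:R)%R.
      apply: (@le_trans _ _ (\sum_(j < N) h)%R).
        rewrite [leLHS]big_mkcond; apply: ler_sum => j _.
        by case: ifPn => // _; exact: ltW.
      by rewrite sumr_const card_ord -[leLHS]mulr_natr.
    by clear - mW rs; lra.
  apply: (le_trans (ler_sum _ (fun i _ => row i))).
  have -> : (\sum_(i < N) ((1 + 2 * h) * (\sum_(j < N | j != i) kreal (x i) (x j)) +
      h * N%:R + ((1 + h) * W (x i) + (h + B - ln r + 4))) =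
     (1 + 2 * h) * S + N%:R * (h * N%:R) + ((1 + h) * T +
       N%:R * (h + B - ln r + 4)))%R.
    rewrite big_split/= big_split/= [X in (_ + X)%R]big_split/=.
    by rewrite /S /T [in RHS]mulr_sumr [in RHS]mulr_sumr !sumr_const card_ord !mulr_natl.
  by rewrite le_eqVlt; apply/orP; left; apply/eqP; ring.
move=> /le_trans/(_ (lee_wpmul2l _ bnd)).
rewrite lee_fin exprn_ge0 ?invr_ge0 ?(ltW N0)// => /(_ isT).
rewrite -EFinM lee_fin => heN; apply: (le_trans heN).
have S0 : (0 <= S)%R.
  by apply: le_trans TS; rewrite mulr_ge0// divr_ge0// subr_ge0.
have lnr : (- ln r = 2 * ln N%:R)%R.
  rewrite /r lnV ?posrE ?exprn_gt0// opprK lnXn// mulr2n; ring.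
have logN : (N%:R * (h + B - ln r + 4) <= h * N%:R ^+ 2)%R.
  rewrite expr2 mulrCA ler_wpM2l ?(ltW N0)//.
  apply: le_trans (hN1 N NN1).
  rewrite lnr; have l0 : (0 <= ln N%:R :> R)%R by rewrite ln_ge0.
  have l1 : (`|B + 5| * ln N%:R >= 0)%R by rewrite mulr_ge0.
  by have l2 := ler_norm (B + 5)%R; clear - mW l0 l1 l2 h1; lra.
have TT : ((1 + h) * T <= 2 * h * S)%R.
  have : ((1 + h) * T <= 2 * (h * S))%R by apply: ler_pM => //; clear - mW h0 h1; lra.
  by rewrite mulrA.
rewrite -exprVn in S0 *.
set q := (N%:R^-1 ^+ 2)%R.
have q0 : (0 <= q)%R by rewrite exprn_ge0// invr_ge0 ltW.
have qN : (q * N%:R ^+ 2 = 1)%R by rewrite /q -exprMn mulVf ?expr1n// gt_eqF.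
apply: (@le_trans _ _ (q * ((1 + 4 * h) * S + 2 * h * N%:R ^+ 2))%R).
  by rewrite ler_wpM2l//; clear - mW TT logN; lra.
rewrite mulrDr (mulrCA q (2 * h)%R) qN mulr1.
apply: lerD; last by clear - mW h8 h0; lra.
rewrite mulrCA (mulrC q) ler_wpM2r ?mulr_ge0//; clear - mW h8 h0; lra.
Qed.

End smearing.

(** * The Gibbs density *)

Section tuple_integrals.
Context {R : realType}.
Local Notation RR := (measurableTypeR R).
Local Open Scope ereal_scope.

Definition box (N : nat) (y : nat -> R) (w : R) : set (N.-tuple RR) :=
  [set t | forall i : 'I_N, (y i <= tnth t i <= y i + w)%R].

Arguments box : clear implicits.

Lemma measurable_box N y w : measurable (box N y w).
Proof.
have -> : box N y w = \bigcap_(i in [set: 'I_N])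
    ((fun t : N.-tuple RR => tnth t i) @^-1` `[y i, (y i + w)%R]%classic).
  apply/seteqP; split => t /=.
    by move=> h i _ /=; rewrite in_itv/=; exact: h.
  by move=> h i; have := h i I; rewrite /= in_itv.
apply: fin_bigcap_measurable => // i _.
by rewrite -[X in measurable X]setTI; exact: measurable_tnth.
Qed.

Lemma lebesgue_box N y (w : R) : (0 <= w)%R ->
  lebesgue_tuple N (box N y w) = (w ^+ N)%:E.
Proof.
move=> w0; elim: N => [|N IH] in y *.
  by rewrite /= diracE mem_set// => -[].
have -> : lebesgue_tuple N.+1 (box N.+1 y w) =
    (lebesgue_measure \x lebesgue_tuple N)%E
      (`[y 0%N, (y 0%N + w)%R]%classic `*` box N (y \o S) w).
  rewrite /= /measure_cons /pushforward; congr (_ _).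
  apply/seteqP; split => -[x t] /= h.
    split; first by have := h ord0; rewrite in_itv.
    move=> i; have := h (lift ord0 i).
    by rewrite !(tnth_nth 0%R)/=.
  move=> i; case: h => /= hx ht; case: (unliftP ord0 i) => [j ->|->].
    by have := ht j; rewrite !(tnth_nth 0%R)/=.
  by move: hx; rewrite in_itv.
have hI : lebesgue_measure (`[y 0%N, (y 0%N + w)%R]%classic : set RR) = w%:E.
  rewrite lebesgue_measure_itv/= lte_fin.
  case: ltP => [_|w0']; first by rewrite -EFinB; congr (_%:E); ring.
  by congr (_%:E); apply/eqP; rewrite eq_le w0/=; lra.
rewrite product_measure1E//; last exact: measurable_box.
transitivity (w%:E * (w ^+ N)%:E); last by rewrite -EFinM exprS.
by congr (_ * _); [exact: hI|exact: IH].
Qed.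

Lemma integral_lebesgue_tuple_prod N (g : RR -> R) (m : R) :
  measurable_fun setT g -> (forall x, (0 <= g x)%R) ->
  \int[lebesgue_measure]_x (g x)%:E = m%:E ->
  \int[lebesgue_tuple N]_t (\prod_(i < N) g (tnth t i))%:E = (m ^+ N)%:E.
Proof.
move=> mg g0 gm; elim: N => [|N IH].
  rewrite (eq_integral (cst 1%:E)) => [|t _]; last by rewrite big_ord0.
  by rewrite integral_cst//= diracT mul1e.
have mf n : measurable_fun setT (fun t : n.-tuple RR => (\prod_(i < n) g (tnth t i))%:E).
  apply/measurable_EFinP; apply: measurable_prod => i _.
  by apply: measurableT_comp => //; exact: measurable_tnth.
have f0 n (t : n.-tuple RR) : 0 <= (\prod_(i < n) g (tnth t i))%:E.
  by rewrite lee_fin; apply: prodr_ge0 => i _.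
have mc := @measurable_tuple_cons _ RR N.
rewrite /= [LHS](ge0_integral_pushforward mc)//=; last 2 first.
- exact: mf.
- by move=> t _; exact: f0.
rewrite preimage_setT fubini_tonelli1/=; last 2 first.
- exact: (measurableT_comp (mf N.+1) mc).
- by move=> z; exact: f0.
rewrite /fubini_F/=.
rewrite (eq_integral (fun x : RR => (m ^+ N)%:E * (g x)%:E)).
  rewrite ge0_integralZl_EFin//; last 3 first.
  - by move=> x _; rewrite lee_fin.
  - exact/measurable_EFinP.
  - rewrite exprn_ge0// -lee_fin -gm; apply: integral_ge0 => x _.
    by rewrite lee_fin.
  by rewrite gm -EFinM -exprSr.
move=> x _; rewrite muleC -IH -ge0_integralZl_EFin//; last exact: mf.
apply: eq_integral => t _; rewrite -EFinM; congr (_%:E).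
rewrite big_ord_recl/= tnth0; congr (_ * _)%R; apply: eq_bigr => i _.
by congr g; rewrite !(tnth_nth 0%R).
Qed.

End tuple_integrals.
Arguments box {R} N y w.

Section density.
Context {R : realType} (p : nat) (W : R -> R) (a B : R).
Hypothesis cf : confining p W a B.
Local Notation RR := (measurableTypeR R).
Local Notation kreal := (kreal W B).

Let mW := conf_meas cf.

(** Comparison with a Gaussian density: [p >= 2] gives [x ^ 2 <= 1 + |x| ^ p]. *)
Lemma integral_exp_confining (k : R) : 0 < k -> exists2 m : R, 0 <= m &
  (\int[lebesgue_measure]_x (expR (- k * W x))%:E = m%:E)%E.
Proof.
move=> k0; have a0 := conf_a cf; have ka : 0 < k * a by rewrite mulr_gt0.
(* The standard deviation for which the Gaussian exponent is [- k * a * x ^ 2]. *)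
pose s := Num.sqrt (2 * (k * a))^-1.
have s0 : s != 0 by rewrite gt_eqF// sqrtr_gt0 invr_gt0; lra.
pose C := expR (k * a) / normal_peak s.
have C0 : 0 <= C by rewrite divr_ge0 ?expR_ge0// normal_peak_ge0.
have le x : expR (- k * W x) <= C * normal_pdf 0 s x.
  rewrite normal_pdfE// /C -mulrA mulKf; last first.
    by rewrite gt_eqF// normal_peak_gt0.
  rewrite /normal_fun -expRD ler_expR subr0.
  have -> : s ^+ 2 *+ 2 = (k * a)^-1.
    rewrite sqr_sqrtr ?invr_ge0; last lra.
    by rewrite invfM -mulr_natl mulrA mulfV ?mul1r.
  rewrite invrK.
  have h1 : x ^+ 2 <= 1 + `|x| ^+ p.
    by rewrite -[leLHS]ger0_norm ?sqr_ge0// normrX exprn_le1D//; exact: conf_p cf.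
  have h2 := conf_ge cf x.
  have h3 : k * (a * `|x| ^+ p) <= k * W x by rewrite ler_wpM2l// ltW.
  have h4 : k * a * x ^+ 2 <= k * a * (1 + `|x| ^+ p) by rewrite ler_wpM2l// ltW.
  lra.
have fin : (\int[lebesgue_measure]_x (expR (- k * W x))%:E <= C%:E)%E.
  apply: (@le_trans _ _ (\int[lebesgue_measure]_x (C%:E * (normal_pdf 0 s x)%:E))%E).
    apply: integral_mono => x _.
    - by rewrite lee_fin expR_ge0.
    - by rewrite mule_ge0// lee_fin normal_pdf_ge0.
    - by split => //; rewrite -EFinM lee_fin.
  rewrite ge0_integralZl_EFin//.
  - by rewrite integral_normal_pdf mule1.
  - by move=> x _; rewrite lee_fin normal_pdf_ge0.
  - by apply/measurable_EFinP; exact: measurable_normal_pdf.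
have ge : (0 <= \int[lebesgue_measure]_x (expR (- k * W x))%:E)%E.
  by apply: integral_ge0 => x _; rewrite lee_fin expR_ge0.
exists (fine (\int[lebesgue_measure]_x (expR (- k * W x))%:E)%E).
  exact: fine_ge0.
by rewrite fineK// ge0_fin_numE// (le_lt_trans fin)// ltry.
Qed.

Lemma sum_neq_sym (N : nat) (F : 'I_N -> 'I_N -> R) : (forall i j, F i j = F j i) ->
  \sum_(i < N) \sum_(j < N | j != i) F i j =
  2 * \sum_(i < N) \sum_(j < N | (i < j)%N) F i j.
Proof.
move=> Fsym; transitivity (\sum_(i < N) (\sum_(j < N | (i < j)%N) F i j +
    \sum_(j < N | (j < i)%N) F i j)).
  apply: eq_bigr => i _; rewrite (bigID (fun j : 'I_N => (i < j)%N))/=.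
  congr (_ + _); apply: eq_bigl => j; rewrite -(inj_eq val_inj)/=.
    by case: ltngtP.
  by case: ltngtP.
rewrite big_split/= mulr_natl mulr2n; congr (_ + _).
rewrite (exchange_big_dep xpredT)//=; apply: eq_bigr => i _.
by apply: eq_bigr => j _; rewrite Fsym.
Qed.

Definition pair_energy (N : nat) (x : nat -> R) : R :=
  \sum_(i < N) \sum_(j < N | j != i) kreal (x i) (x j).

(* The contributions of [B] and [b] introduced by [kreal] and [W = V + b]; they are the
   same for the partition function and for the integral over any event. *)
Definition log_factor (b : R) (N : nat) : R :=
  (B + b) * (N%:R * (N%:R - 1)) + b * N%:R.

Variables (b beta : R) (V : R -> R).
Hypothesis VW : forall x, W x = V x + b.
Hypothesis beta0 : 0 < beta.

(** The exponent [beta] of the Vandermonde counts unordered pairs and [beta / 2] the ordered ones.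
    Distinct coordinates keep every [ln] away from its junk value at 0. *)
Lemma gibbs_densityE N (lam : N.-tuple RR) :
  (forall i j : 'I_N, i != j -> tnth lam i != tnth lam j) ->
  gibbs_density V beta lam =
  expR (beta / 2 * (log_factor b N - pair_energy N (nth 0 lam))) *
  \prod_(i < N) expR (- (beta / 2) * W (tnth lam i)).
Proof.
move=> inj; pose x (i : 'I_N) : R := tnth lam i.
pose L := \sum_(i < N) \sum_(j < N | (i < j)%N) ln `|x j - x i|.
have vE : `|vandermonde lam| = expR L.
  rewrite /vandermonde normr_prod expR_sum; apply: eq_bigr => i _.
  rewrite normr_prod expR_sum; apply: eq_bigr => j ij.
  rewrite lnK// posrE normr_gt0 subr_eq0; apply: inj.
  by rewrite -(inj_eq val_inj)/= gtn_eqF.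
have SE : pair_energy N (nth 0 lam) =
    (N%:R - 1) * \sum_(i < N) W (x i) + B * (N%:R * (N%:R - 1)) - 2 * L.
  have -> : pair_energy N (nth 0 lam) =
      \sum_(i < N) \sum_(j < N | j != i) kreal (x i) (x j).
    by apply: eq_bigr => i _; apply: eq_bigr => j _; rewrite /x !(tnth_nth 0).
  have -> : 2 * L = \sum_(i < N) \sum_(j < N | j != i) ln `|x i - x j|.
    rewrite sum_neq_sym; last by move=> i j; rewrite distrC.
    by congr (2 * _); apply: eq_bigr => i _; apply: eq_bigr => j _; rewrite distrC.
  pose F (i j : 'I_N) : R := (W (x i) + W (x j)) / 2 + B.
  have FE : \sum_(i < N) \sum_(j < N | j != i) F i j =
      (N%:R - 1) * \sum_(i < N) W (x i) + B * (N%:R * (N%:R - 1)).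
    have -> : \sum_(i < N) \sum_(j < N | j != i) F i j =
        \sum_(i < N) (\sum_(j < N) F i j - (W (x i) + B)).
      apply: eq_bigr => i _; rewrite [in RHS](bigD1 i)//=.
      by rewrite [RHS]addrAC [X in X + _](_ : _ = 0) ?add0r// /F; field.
    rewrite sumrB.
    have -> : \sum_(i < N) \sum_(j < N) F i j =
        N%:R * \sum_(i < N) W (x i) + N%:R * (N%:R * B).
      under eq_bigr do rewrite big_split/= -mulr_suml big_split/= !sumr_const card_ord.
      rewrite big_split/= -mulr_suml big_split/= !sumr_const card_ord sumrMnl.
      rewrite -[(\sum_(i < N) W (x i)) *+ N]mulr_natl -[B *+ N]mulr_natl.
      by rewrite -[N%:R * B *+ N]mulr_natl; field.
    by rewrite big_split/= sumr_const card_ord -[B *+ N]mulr_natl; ring.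
  rewrite -FE -sumrB; apply: eq_bigr => i _; rewrite -sumrB.
  by apply: eq_bigr.
rewrite /gibbs_density vE -expRM -expR_sum -!expRD; congr expR.
rewrite SE /log_factor -mulr_sumr.
have -> : \sum_(i < N) V (tnth lam i) = \sum_(i < N) W (x i) - b * N%:R.
  under [in RHS]eq_bigr do rewrite VW.
  by rewrite big_split/= sumr_const card_ord -[X in _ + X - _]mulr_natr addrK.
by rewrite -/(x _); field.
Qed.

(** A repeated coordinate annihilates the Vandermonde, and [beta > 0] the density with it; a bound
    on the pair energy is therefore asked only of configurations without repetition. *)
Lemma gibbs_density_le N (lam : N.-tuple RR) (s : R) :
  ((forall i j, (i < N)%N -> (j < N)%N -> i != j -> nth 0 lam i != nth 0 lam j) ->
    s <= pair_energy N (nth 0 lam)) ->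
  gibbs_density V beta lam <=
  expR (beta / 2 * (log_factor b N - s)) *
  \prod_(i < N) expR (- (beta / 2) * W (tnth lam i)).
Proof.
move=> hs; have [inj|] := boolP [forall i : 'I_N, forall j : 'I_N, (i != j) ==> (tnth lam i != tnth lam j)].
  have inj' (i j : 'I_N) : i != j -> tnth lam i != tnth lam j.
    by move: inj => /forallP/(_ i)/forallP/(_ j)/implyP.
  rewrite gibbs_densityE// ler_wpM2r//.
    by apply: prodr_ge0 => i _; exact: expR_ge0.
  rewrite ler_expR ler_wpM2l ?divr_ge0 ?(ltW beta0)// lerD2l lerN2; apply: hs.
  move=> i j iN jN ij; have := inj' (Ordinal iN) (Ordinal jN).
  by rewrite !(tnth_nth 0)/=; apply; rewrite -(inj_eq val_inj).
move=> /forallPn[i /forallPn[j]]; rewrite negb_imply negbK => /andP[ij /eqP e].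
have -> : gibbs_density V beta lam = 0.
  rewrite /gibbs_density (_ : vandermonde lam = 0).
    by rewrite normr0 powR0 ?mul0r// gt_eqF.
  wlog ltij : i j ij e / (i < j)%N.
    move=> h; have : (i : nat) != j by rewrite (inj_eq val_inj).
    rewrite neq_ltn => /orP[|ji]; first exact: h.
    by apply: (h j i) => //; rewrite eq_sym.
  rewrite /vandermonde (bigD1 i)//= (bigD1 j)//= e subrr.
  by rewrite !mul0r.
by rewrite mulr_ge0 ?expR_ge0//; apply: prodr_ge0 => k _; exact: expR_ge0.
Qed.

End density.

(** * Pair energy of configurations with prescribed gaps *)

Section gaps.
Context {R : realType}.
Local Notation RR := (measurableTypeR R).
Local Open Scope ereal_scope.

Lemma integral_gap_measure N (lam : N.-tuple RR) (f : RR -> \bar R) : (1 < N)%N ->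
  measurable_fun setT f -> (forall x, 0 <= f x) ->
  \int[gap_measure lam]_x f x = ((N.-1)%:R^-1)%:E *
    \sum_(k < N.-1) f (order_stat lam N - order_stat lam k.+1)%R.
Proof.
move=> N1 mf f0; rewrite /gap_measure integral_mixture//.
- congr (_ * _); apply: eq_bigr => k _.
  by rewrite integral_dirac// diracT mul1e.
- by case: N N1 {lam} => [|[]].
- by move=> k; exact: diracT.
Qed.

(** Sorting permutes the terms, and dropping the top particle, which the gap measure omits, removes
    nonnegative ones. *)
Lemma sum_order_stat_le N (lam : N.-tuple RR) (F : R -> R -> R) :
  (forall x y, (0 <= F x y)%R) ->
  (\sum_(a < N.-1) \sum_(b < N.-1) F (order_stat lam a.+1) (order_stat lam b.+1) <=
   \sum_(i < N) \sum_(j < N) F (nth 0 lam i) (nth 0 lam j))%R.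
Proof.
move=> F0; pose s := sort <=%R (lam : seq R).
have sN : size s = N by rewrite size_sort size_tuple.
have seqE (G : R -> R) (t : seq R) : size t = N ->
    (\sum_(x <- t) G x = \sum_(i < N) G (nth 0 t i))%R.
  by move=> tN; rewrite (big_nth 0%R) tN big_mkord.
have permE (G : R -> R) : (\sum_(i < N) G (nth 0 lam i) = \sum_(i < N) G (nth 0 s i))%R.
  rewrite -!seqE ?size_tuple//; apply: perm_big.
  by rewrite perm_sym perm_sort.
have -> : (\sum_(i < N) \sum_(j < N) F (nth 0 lam i) (nth 0 lam j) =
    \sum_(i < N) \sum_(j < N) F (nth 0 s i) (nth 0 s j))%R.
  rewrite (permE (fun x => \sum_(j < N) F x (nth 0 lam j))%R).
  by apply: eq_bigr => i _; exact: permE.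
have drop1 (G : nat -> R) : (forall i, (0 <= G i)%R) ->
    (\sum_(i < N.-1) G i <= \sum_(i < N) G i)%R.
  move=> G0; case: N {lam s sN seqE permE} => [|n] /=; first by rewrite !big_ord0.
  by rewrite [leRHS]big_ord_recr/= lerDl.
apply: (@le_trans _ _ (\sum_(a < N.-1) \sum_(j < N) F (nth 0 s a) (nth 0 s j))%R).
  by apply: ler_sum => a' _; exact: (drop1 (fun b => F (nth 0 s a') (nth 0 s b))%R).
by apply: (drop1 (fun a => \sum_(j < N) F (nth 0 s a) (nth 0 s j))%R) => i; exact: sumr_ge0.
Qed.

Lemma coupling_integral1 (mu nu : probability RR R) pi (f : RR -> \bar R) :
  couplings mu nu pi -> measurable_fun setT f -> (forall x, 0 <= f x) ->
  \int[pi]_z f z.1 = \int[mu]_x f x.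
Proof.
move=> cpl mf f0.
rewrite -[LHS](ge0_integral_pushforward (measurable_fst (T1 := RR) (T2 := RR)) pi measurableT mf)//.
by apply: eq_measure_integral => A mA _; have [+ _] := cpl A mA; exact.
Qed.

Lemma coupling_integral2 (mu nu : probability RR R) pi (f : RR -> \bar R) :
  couplings mu nu pi -> measurable_fun setT f -> (forall x, 0 <= f x) ->
  \int[pi]_z f z.2 = \int[nu]_x f x.
Proof.
move=> cpl mf f0.
rewrite -[LHS](ge0_integral_pushforward (measurable_snd (T1 := RR) (T2 := RR)) pi measurableT mf)//.
by apply: eq_measure_integral => A mA _; have [_ +] := cpl A mA; exact.
Qed.

Lemma wasserstein_lt_coupling (p : nat) (mu nu : probability RR R) (delta : R) :
  (0 < p)%N -> (0 < delta)%R -> wasserstein p mu nu < delta%:E ->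
  exists2 pi, couplings mu nu pi &
    \int[pi]_z (`|(z.1 : R) - (z.2 : R)| ^+ p)%:E < (delta ^+ p)%:E.
Proof.
move=> p0 d0 hW; set Q := [set \int[pi]_z (`|(z.1 : R) - (z.2 : R)| ^+ p)%:E
             | pi in couplings mu nu].
have : ereal_inf Q < (delta ^+ p)%:E.
  rewrite ltNge; apply/negP => hQ; move: hW; rewrite ltNge => /negP; apply.
  have -> : delta%:E = ((delta ^+ p)%:E) `^ p%:R^-1.
    rewrite poweR_EFin -powR_mulrn ?(ltW d0)// -powRrM mulfV ?powRr1 ?(ltW d0)//.
    by rewrite pnatr_eq0 -lt0n.
  apply: gt0_ler_poweR; rewrite ?in_itv/= ?leey ?andbT ?lee_fin ?invr_ge0 ?exprn_ge0 ?(ltW d0)//.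
  by apply: le_ereal_inf_tmp => _ [pi _ <-]; apply: integral_ge0 => z _; rewrite lee_fin exprn_ge0.
by move=> /ereal_inf_lt[_ [pi cpl <-] hpi]; exists pi.
Qed.

Lemma wasserstein_le_coupling (p : nat) (mu nu : probability RR R) pi (e delta : R) :
  (0 < p)%N -> (0 < delta)%R -> couplings mu nu pi ->
  \int[pi]_z (`|(z.1 : R) - (z.2 : R)| ^+ p)%:E <= e%:E -> (e < delta ^+ p)%R ->
  wasserstein p mu nu < delta%:E.
Proof.
move=> p0 d0 cpl hpi ed; rewrite /wasserstein.
set Q := [set \int[pi]_z (`|(z.1 : R) - (z.2 : R)| ^+ p)%:E | pi in couplings mu nu].
have Qe : ereal_inf Q <= e%:E.
  by apply: ge_ereal_inf; exists (\int[pi]_z (`|(z.1 : R) - (z.2 : R)| ^+ p)%:E) => //; exists pi.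
have Q0 : 0 <= ereal_inf Q.
  apply: le_ereal_inf_tmp => _ [? _ <-]; apply: integral_ge0 => z _.
  by rewrite lee_fin exprn_ge0.
have e0 : (0 <= e)%R by rewrite -lee_fin (le_trans Q0).
have ip : (0 < p%:R^-1 :> R)%R by rewrite invr_gt0 ltr0n.
apply: (@le_lt_trans _ _ (e%:E `^ p%:R^-1)).
  by apply: gt0_ler_poweR; rewrite ?in_itv/= ?leey ?andbT ?(ltW ip).
rewrite poweR_EFin lte_fin.
have -> : delta = ((delta ^+ p) `^ p%:R^-1)%R.
  rewrite -powR_mulrn ?(ltW d0)// -powRrM mulfV ?powRr1 ?(ltW d0)//.
  by rewrite pnatr_eq0 -lt0n.
by apply: gt0_ltr_powR => //; rewrite nnegrE ?exprn_ge0// ltW.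
Qed.

End gaps.

Section cut_error.
Context {R : realType}.

(** The arithmetic closing [event_pair_energy]: [M = N - 1], [S] is the pair energy, [T] the sum of
    the potentials, [X] the truncated double sum over the lower particles, [z = B + m] the diagonal
    cost and [x] the transport error. Passing from [M ^ 2] to [N ^ 2] costs a factor
    [(1 + 1 / M) ^ 2], and [T] is [O(S / M)]. *)
Lemma cut_error_bound (eta h x z M S T X : R) :
  0 < h -> h <= 1 / 2 -> 20 * h <= eta -> x <= h -> 1 <= M -> `|z| + 8 <= h * M ->
  0 <= S -> M / 2 * T <= S -> X <= S + T + (M + 1) * z ->
  h + x + M^-1 ^+ 2 * X <= ((1 + eta) * (S / (M + 1) ^+ 2) + eta) * (1 - h).
Proof.
move=> h0 h2 h20 xh M1 KM S0 TS ST.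
pose q : R := S / (M + 1) ^+ 2; rewrite -/q.
have q0 : 0 <= q by rewrite divr_ge0// exprn_ge0//; lra.
pose u : R := M^-1; rewrite -/u.
have M0 : 0 < M by lra.
have u0 : 0 <= u by rewrite invr_ge0 ltW.
have Mu : M * u = 1 by rewrite /u mulfV// gt_eqF.
have zu : `|z| * u <= h by rewrite ler_pdivrMr//; apply: le_trans KM; rewrite lerDl.
have uh : u <= h / 8.
  have : 8 * u <= h by rewrite ler_pdivrMr//; apply: le_trans KM; rewrite lerDr.
  by clear; lra.
have Suq : u ^+ 2 * S = q * (1 + u) ^+ 2.
  have -> : 1 + u = (M + 1) * u by clear - Mu; lra.
  by rewrite /q exprMn; field; clear - M0; rewrite gt_eqF//; lra.
have Tu : u ^+ 2 * T <= 2 * u * (u ^+ 2 * S).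
  have : T <= 2 * u * S.
    have -> : T = 2 * u * (M / 2 * T) by rewrite /u; field; rewrite gt_eqF.
    by rewrite ler_wpM2l// mulr_ge0.
  by move=> /(ler_wpM2l (sqr_ge0 u)); clear; lra.
have q1 : q * (1 + u) ^+ 2 <= q * (1 + h).
  by rewrite ler_wpM2l// expr2; clear - uh u0 h2; nra.
have q1' : 2 * u * (q * (1 + u) ^+ 2) <= 2 * (h / 8) * (q * (1 + h)).
  apply: ler_pM => //; first by rewrite mulr_ge0.
    by rewrite mulr_ge0// exprn_ge0// addr_ge0.
  by rewrite ler_wpM2l.
have q2 : 2 * (h / 8) * (q * (1 + h)) <= q * h.
  have -> : 2 * (h / 8) * (q * (1 + h)) = q * (h * ((1 + h) / 4)) by field.
  by rewrite ler_wpM2l// ler_piMr ?(ltW h0)//; clear - h2; lra.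
have z1 : u ^+ 2 * ((M + 1) * z) <= 2 * h.
  have -> : u ^+ 2 * ((M + 1) * z) = (M * u + u) * (z * u) by ring.
  rewrite Mu; have z2 : z * u <= h by apply: le_trans zu; rewrite ler_wpM2r// ler_norm.
  apply: (@le_trans _ _ ((1 + u) * h)); first by rewrite ler_wpM2l// addr_ge0.
  by rewrite ler_wpM2r ?(ltW h0)//; clear - uh h2; lra.
have tot : h + x + u ^+ 2 * X <= q * (1 + 2 * h) + 4 * h.
  have := ler_wpM2l (sqr_ge0 u) ST; rewrite !mulrDr => h3.
  by rewrite Suq in Tu h3; clear - Tu h3 q1 q1' q2 z1 xh; lra.
apply: (le_trans tot).
have e1 : q * (1 + 2 * h) <= q * ((1 + eta) * (1 - h)).
  by rewrite ler_wpM2l//; clear - h0 h2 h20; nra.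
have e2 : 4 * h <= eta * (1 - h) by clear - h0 h2 h20; nra.
by clear - e1 e2; lra.
Qed.

End cut_error.

Section event_upper_bound.
Context {R : realType} (p : nat) (W : R -> R) (a B : R).
Hypothesis cf : confining p W a B.
Local Notation RR := (measurableTypeR R).
Local Notation kcut := (kcut W B).
Local Notation kreal := (kreal W B).
Local Open Scope ereal_scope.

Let mW := conf_meas cf.

(** The truncated energy of [tau c mu], written against [mu] so that couplings with the gap measure
    apply and [c] enters through the kernel only. *)
Definition cut_energy (mu : probability RR R) (m c : R) : \bar R :=
  \int[mu]_x \int[mu]_y (kcut m (c - x) (c - y))%:E.

Lemma measurable_kcut_sub m c :
  measurable_fun setT (fun z : RR * RR => (kcut m (c - z.1) (c - z.2))%:E).
Proof.
apply/measurable_EFinP.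
have m1 : measurable_fun setT (fun z : RR * RR => (((c - z.1)%R : RR), ((c - z.2)%R : RR))).
  by apply: measurable_fun_pair => /=; apply: measurable_funB.
exact: (measurableT_comp (measurable_kcut B mW m) m1).
Qed.

Lemma sum_kcut_le (N : nat) (x : nat -> R) m :
  (forall i j, (i < N)%N -> (j < N)%N -> i != j -> x i != x j) ->
  (\sum_(i < N) \sum_(j < N) kcut m (x i) (x j) <=
   pair_energy W B N x + \sum_(i < N) W (x i) + N%:R * (B + m))%R.
Proof.
move=> inj.
have -> : (\sum_(i < N) \sum_(j < N) kcut m (x i) (x j) =
    \sum_(i < N) \sum_(j < N | j != i) kcut m (x i) (x j) +
    \sum_(i < N) W (x i) + N%:R * (B + m))%R.
  rewrite (eq_bigr (fun i : 'I_N => \sum_(j < N | j != i) kcut m (x i) (x j) +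
     (W (x i) + (B + m))))%R; last first.
    by move=> i _; rewrite (bigD1 i)//= kcut_diag; ring.
  by rewrite big_split/= big_split/= sumr_const card_ord -[((B + m) *+ N)%R]mulr_natl addrA.
rewrite !lerD2r; apply: ler_sum => i _; apply: ler_sum => j ji.
by apply: kcut_le_kreal; apply: inj => //; rewrite eq_sym.
Qed.

(** With [c] the top particle, [u |-> c - u] turns the gaps back into the lower particles. Two
    independent pairs drawn from one coupling carry the truncated kernel from [mu] to the gap
    measure; neither [delta] nor [N0] depends on [c]. *)
Lemma event_pair_energy (mu : probability RR R) (m eta : R) : (0 <= m)%R -> (0 < eta)%R ->
  exists2 delta : R, (0 < delta)%R & exists2 N0 : nat, (1 < N0)%N &
  forall N (lam : N.-tuple RR), (N0 <= N)%N ->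
    (forall i j, (i < N)%N -> (j < N)%N -> i != j -> nth 0%R lam i != nth 0%R lam j) ->
    ball_wasserstein p mu delta (gap_measure lam) ->
    cut_energy mu m (order_stat lam N) <=
      ((1 + eta) * (pair_energy W B N (nth 0%R lam) / N%:R ^+ 2) + eta)%:E.
Proof.
move=> m0 eta0; have p0 : (0 < p)%N by have := conf_p cf; case: (p).
pose h : R := (Num.min (1 / 2) (eta / 20))%R.
have h0 : (0 < h)%R by rewrite lt_min; apply/andP; split; lra.
have h2 : (h <= 1 / 2)%R by rewrite ge_min lexx.
have h20 : (20 * h <= eta)%R.
  have : (h <= eta / 20)%R by rewrite ge_min lexx orbT.
  by lra.
have [D D0 hD] := kcut_reg cf h0 m0.
(* [delta <= 1] gives [delta ^ p <= delta], so the total transport error [2 * D * delta ^ p] is at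
   most [h]. *)
pose delta : R := (Num.min 1 (h / (2 * (D + 1))))%R.
have delta0 : (0 < delta)%R by rewrite lt_min ltr01/= divr_gt0//; lra.
have dD : (2 * D * delta ^+ p <= h)%R.
  have d1 : (delta ^+ p <= delta)%R.
    rewrite -[leRHS]expr1; apply: ler_wiXn2l => //; first exact: ltW.
    by rewrite ge_min lexx.
  have d2 : (delta <= h / (2 * (D + 1)))%R by rewrite ge_min lexx orbT.
  have d3 : (delta * (2 * (D + 1)) <= h)%R by rewrite -ler_pdivlMr//; lra.
  have : (2 * D * delta ^+ p <= 2 * D * delta)%R by rewrite ler_wpM2l// mulr_ge0.
  by lra.
pose K : R := (`|B + m| + 8)%R.
pose N0 := (Num.truncn (2 * K / h)%R).+3.
exists delta => //; exists N0 => // N lam NN0 inj [_ hball].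
have [pi cpl hpi] := wasserstein_lt_coupling p0 delta0 hball.
set c := order_stat lam N.
have N1 : (1 < N)%N by rewrite (leq_trans _ NN0).
pose M := N.-1; have MN : N = M.+1 by rewrite prednK// ltnW.
have M1 : (1 <= M%:R :> R)%R by rewrite ler1n; case: (N) N1 @M MN => [|[]].
have NM : (N%:R = M%:R + 1 :> R)%R by rewrite MN natr1.
have KM : (K <= h * M%:R)%R.
  rewrite mulrC -ler_pdivrMr//.
  have : ((Num.truncn (2 * K / h)%R).+2%:R <= M%:R :> R)%R.
    by rewrite ler_nat -ltnS -MN.
  rewrite -natr1; have := truncnS_gt (2 * K / h)%R.
  have : (0 <= K / h)%R by rewrite divr_ge0 ?(ltW h0)// addr_ge0.
  lra.
pose s k : R := order_stat lam k.+1.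
pose f (u v : R) := kcut m (c - u) (c - v).
have f0 u v : (0 <= f u v)%R by exact: (kcut_ge0 cf).
have mf : measurable_fun setT (fun z : RR * RR => (f z.1 z.2)%:E).
  exact: measurable_kcut_sub.
have mf2 u : measurable_fun setT (fun v : RR => (f u v)%:E).
  exact: (measurableT_comp mf (measurable_pair1 u)).
have mf1 v : measurable_fun setT (fun u : RR => (f u v)%:E).
  exact: (measurableT_comp mf (measurable_pair2 v)).
pose dist (z : RR * RR) : R := (`|(z.1 : R) - z.2| ^+ p)%R.
have dist0 z : (0 <= dist z)%R by rewrite exprn_ge0.
have mdist : measurable_fun setT (fun z => (dist z)%:E) by exact: measurable_dist.
pose I := \int[pi]_z (dist z)%:E.
have Idelta : I <= (delta ^+ p)%:E by exact: ltW.
have I0 : 0 <= I by apply: integral_ge0 => z _; rewrite lee_fin.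
(* The first components are distributed according to [mu], the second ones to the gap measure; the
   factor [1 - h] comes from moving the relative error to the left. *)
have pt (z w : RR * RR) : ((1 - h) * f z.1 w.1 <=
     h + D * dist z + (f z.2 w.2 + D * dist w))%R.
  have := hD (c - z.1)%R (c - w.1)%R (c - z.2)%R (c - w.2)%R; rewrite -/(f _ _) -/(f _ _).
  have e1 u v : (`|c - u - (c - v)| = `|v - u|)%R by congr (`| _ |)%R; ring.
  by rewrite !e1 /dist; lra.
have h1 : (0 <= 1 - h)%R by lra.
(* The kernel averaged in its second variable over the gap measure: [step1] integrates out one of
   the pairs, [step2] the other. *)
pose g (u : R) : R := (M%:R^-1 * \sum_(b < M) f u (c - s b))%R.
have iM : (0 <= M%:R^-1 :> R)%R by rewrite invr_ge0.
have g0 u : (0 <= g u)%R by rewrite mulr_ge0// sumr_ge0.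
have gapE (F : RR -> \bar R) : measurable_fun setT F -> (forall x, 0 <= F x) ->
    \int[pi]_w F w.2 = (M%:R^-1)%:E * \sum_(b < M) F (c - s b)%R.
  move=> mF F0; rewrite (coupling_integral2 cpl)//.
  by rewrite (integral_gap_measure _ N1).
have mg : measurable_fun setT (fun u : RR => (g u)%:E).
  rewrite (_ : (fun _ => _) = fun u => (M%:R^-1)%:E * \sum_(b < M) (f u (c - s b))%:E).
    by apply: measurable_funeM; apply: emeasurable_sum => b; exact: mf1.
  by apply/funext => u; rewrite sumEFin.
have step1 (z : RR * RR) : (1 - h)%:E * \int[mu]_v (f z.1 v)%:E <=
    (h + D * delta ^+ p)%:E + ((D * dist z)%:E + (g z.2)%:E).
  rewrite -(coupling_integral1 cpl (mf2 z.1)); last by move=> v; rewrite lee_fin.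
  rewrite -ge0_integralZl_EFin//; last 2 first.
  - by move=> w _; rewrite lee_fin.
  - exact: (measurableT_comp (mf2 z.1) measurable_fst).
  apply: (@le_trans _ _ (\int[pi]_w ((h + D * dist z)%:E +
      ((f z.2 w.2)%:E + D%:E * (dist w)%:E)))).
    apply: integral_mono => w _.
    - by rewrite mule_ge0// lee_fin.
    - by rewrite !adde_ge0// ?mule_ge0// lee_fin// addr_ge0 ?(ltW h0)// mulr_ge0.
    - by split => //; rewrite -!EFinM -!EFinD lee_fin; exact: pt.
  have mfw : measurable_fun setT (fun w : RR * RR => (f z.2 w.2)%:E).
    exact: (measurableT_comp (mf2 z.2) measurable_snd).
  have mDw : measurable_fun setT (fun w => D%:E * (dist w)%:E) by exact: measurable_funeM.
  rewrite ge0_integralD//; last 3 first.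
  - by move=> w _; rewrite lee_fin addr_ge0 ?(ltW h0)// mulr_ge0.
  - by move=> w _; rewrite adde_ge0 ?mule_ge0// lee_fin.
  - exact: emeasurable_funD.
  rewrite [X in X + _]integral_prob_cst ge0_integralD//; last 2 first.
  - by move=> w _; rewrite lee_fin.
  - by move=> w _; rewrite mule_ge0// lee_fin.
  rewrite ge0_integralZl_EFin//; last by move=> w _; rewrite lee_fin.
  rewrite (gapE (fun v => (f z.2 v)%:E))//; last by move=> v; rewrite lee_fin.
  rewrite sumEFin -EFinM -/(g z.2).
  apply: (@le_trans _ _ ((h + D * dist z)%:E + ((g z.2)%:E + D%:E * (delta ^+ p)%:E))).
    by rewrite leeD2l// leeD2l// lee_wpmul2l.
  by rewrite -EFinM -!EFinD lee_fin; lra.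
have step2 : (1 - h)%:E * cut_energy mu m c <=
    (h + 2 * D * delta ^+ p + M%:R^-1 ^+ 2 * \sum_(a < M) \sum_(b < M) kcut m (s a) (s b))%:E.
  have mI : measurable_fun setT (fun u : RR => \int[mu]_v (f u v)%:E).
    apply: (measurable_fun_fubini_tonelli_F (fun z : RR * RR => (f z.1 z.2)%:E)) => //.
    by move=> z; rewrite lee_fin.
  have I0' u : 0 <= \int[mu]_v (f u v)%:E by apply: integral_ge0 => v _; rewrite lee_fin.
  rewrite /cut_energy -(coupling_integral1 cpl mI)//.
  rewrite -ge0_integralZl_EFin//; last first.
    exact: (measurableT_comp mI measurable_fst).
  apply: (@le_trans _ _ (\int[pi]_z ((h + D * delta ^+ p)%:E +
      (D%:E * (dist z)%:E + (g z.2)%:E)))).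
    apply: integral_mono => z _.
    - by rewrite mule_ge0// lee_fin.
    - rewrite !adde_ge0// ?mule_ge0// lee_fin// addr_ge0 ?(ltW h0)// mulr_ge0//.
      by rewrite exprn_ge0// ltW.
    - by split => //; exact: step1.
  have mgz : measurable_fun setT (fun z : RR * RR => (g z.2)%:E).
    exact: (measurableT_comp mg measurable_snd).
  have mDw : measurable_fun setT (fun w => D%:E * (dist w)%:E) by exact: measurable_funeM.
  rewrite ge0_integralD//; last 3 first.
  - move=> w _; rewrite lee_fin addr_ge0 ?(ltW h0)// mulr_ge0//.
    by rewrite exprn_ge0// ltW.
  - by move=> w _; rewrite adde_ge0 ?mule_ge0// lee_fin.
  - exact: emeasurable_funD.
  rewrite [X in X + _]integral_prob_cst ge0_integralD//; last 2 first.
  - by move=> w _; rewrite mule_ge0// lee_fin.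
  - by move=> w _; rewrite lee_fin.
  have distE0 (z : RR * RR) : setT z -> 0 <= (dist z)%:E by rewrite lee_fin.
  rewrite ge0_integralZl_EFin//.
  rewrite (gapE (fun v => (g v)%:E))//.
  rewrite sumEFin -EFinM.
  have -> : (M%:R^-1 * \sum_(b < M) g (c - s b) =
      M%:R^-1 ^+ 2 * \sum_(a0 < M) \sum_(b < M) kcut m (s a0) (s b))%R.
    rewrite expr2 -mulrA; congr (_ * _)%R; rewrite mulr_sumr; apply: eq_bigr => i _.
    congr (_ * _)%R; apply: eq_bigr => j _; rewrite /f; congr (kcut m _ _); ring.
  apply: (@le_trans _ _ ((h + D * delta ^+ p)%:E + (D%:E * (delta ^+ p)%:E +
    (M%:R^-1 ^+ 2 * \sum_(a0 < M) \sum_(b < M) kcut m (s a0) (s b))%:E))).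
    by rewrite leeD2l// leeD2r// lee_wpmul2l.
  by rewrite -EFinM -!EFinD lee_fin; lra.
set S := pair_energy W B N (nth 0%R lam).
pose T : R := (\sum_(i < N) W (nth 0%R lam i))%R.
have TS : (M%:R / 2 * T <= S)%R.
  have := sum_kreal_ge cf inj; rewrite -/T -/(pair_energy W B N (nth 0%R lam)) -/S NM.
  by rewrite addrK.
have ST : (\sum_(a < M) \sum_(b < M) kcut m (s a) (s b) <= S + T + N%:R * (B + m))%R.
  apply: le_trans (sum_kcut_le m inj).
  by apply: (sum_order_stat_le lam (F := kcut m)) => x y; exact: (kcut_ge0 cf).
have S0 : (0 <= S)%R.
  apply: le_trans TS; rewrite mulr_ge0 ?divr_ge0//.
  by apply: sumr_ge0 => i _; exact: confining_ge0 cf _.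
have h1' : (0 < 1 - h)%R by clear - mW h2; lra.
move: step2; rewrite muleC -lee_pdivlMr// => step2.
apply: (le_trans step2); rewrite -EFinM lee_fin ler_pdivrMr//.
by rewrite NM in ST *; exact: cut_error_bound TS ST.
Qed.

End event_upper_bound.

(** * Lower bounds on integrals *)

Section lower_bound.
Context {R : realType} (p : nat) (W : R -> R) (a B : R).
Hypothesis cf : confining p W a B.
Local Notation RR := (measurableTypeR R).
Local Notation kreal := (kreal W B).
Local Notation kern := (kern W B).
Local Notation PE := (pair_energy W B).

Let mW := conf_meas cf.

(** Points of successive cells are ordered but may be arbitrarily close. Shifting the [i]-th by
    [2 * i] times [w = d / (3 * M)] opens room for an interval of length [w] around each without
    shrinking a distance, and no point moves by more than [3 * w * M = d]. *)
Lemma spread_discretization (nu : probability RR R) (D : set RR) (eta : R) :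
  measurable D -> nu D = 1%E -> (energy W B nu < +oo)%E ->
  (\int[nu]_x (W x)%:E < +oo)%E -> 0 < eta ->
  exists2 d0 : R, 0 < d0 & forall d, 0 < d <= d0 ->
  exists2 M0 : nat, (0 < M0)%N & forall M, (M0 <= M)%N ->
  exists q, exists x : nat -> R,
  [/\ quantiles nu M q, (forall i, (i < M)%N -> D (x i)),
      (\sum_(i < M) \int[nu]_(y in cell q i) (`|x i - (y : R)| ^+ p)%:E <= eta%:E)%E &
      forall l : nat -> R, (forall i, (i < M)%N ->
        x i + 2 * (d / (3 * M%:R)) * i%:R <= l i <=
        x i + 2 * (d / (3 * M%:R)) * i%:R + d / (3 * M%:R)) ->
      [/\ forall i j, (i < j < M)%N -> l i < l j,
          forall i, (i < M)%N -> `|l i - x i| <= d &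
          PE M l <= M%:R ^+ 2 * (fine (energy W B nu) + eta)]].
Proof.
move=> mD nuD Efin Wfin eta0; set e := fine (energy W B nu).
have e0 : 0 <= e by rewrite fine_ge0//; exact: energy_ge0 cf nu.
(* Expanding [(1 + 2 * h) * (e + h) + h] leaves an excess over [e] of at most [h * (2 * e + 4)]. *)
pose h : R := Num.min 1 (eta / (2 * e + 4)).
have c4 : 0 < 2 * e + 4 by lra.
have h0 : 0 < h by rewrite lt_min ltr01/= divr_gt0.
have h1 : h <= 1 by rewrite ge_min lexx.
have he : h * (2 * e + 4) <= eta.
  by rewrite -ler_pdivlMr// ge_min lexx orbT.
have [d0 d00 hd] := confining_shift cf h0.
have [M0 M00 hM] := discretization cf mD nuD Efin Wfin h0.
exists d0 => // d /andP[dgt0 dd0]; exists M0 => // M M0M.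
have [q [x [Qq hx sumk cost]]] := hM M M0M.
have qnd := quantile_nd Qq.
have xlt i j : (i < j)%N -> (j < M)%N -> x i < x j.
  move=> ij jM; have [xi _] := hx i (ltn_trans ij jM); have [xj _] := hx j jM.
  exact: cell_lt qnd ij xi xj.
have M_gt0 : (0 < M)%N := leq_trans M00 M0M.
have Mr : 0 < M%:R :> R by rewrite ltr0n.
set w := d / (3 * M%:R).
have w0 : 0 < w by rewrite divr_gt0// mulr_gt0.
have wM : 3 * w * M%:R = d by rewrite /w; field; rewrite gt_eqF.
exists q, x; split => //.
- by move=> i iM; have [] := hx i iM.
- apply: (le_trans cost); rewrite lee_fin.
  apply: le_trans he; rewrite ler_peMr ?(ltW h0)//; clear - mW e0; lra.
move=> l hl.
have incr i j : (i < j)%N -> (j < M)%N -> x j - x i + w <= l j - l i.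
  move=> ij jM; have /andP[_ h2] := hl i (ltn_trans ij jM); have /andP[h3 _] := hl j jM.
  have : 2 * w * i%:R + 2 * w <= 2 * w * j%:R.
    have -> : 2 * w * i%:R + 2 * w = 2 * w * i.+1%:R by rewrite -natr1; ring.
    by apply: ler_wpM2l; [rewrite mulr_ge0// ltW|rewrite ler_nat].
  by move=> k; clear - mW k h2 h3; lra.
have close i : (i < M)%N -> `|l i - x i| <= d.
  move=> iM; have /andP[h2 h3] := hl i iM.
  have k0 : 0 <= 2 * w * i%:R by rewrite !mulr_ge0// ltW.
  have k1 : 2 * w * i%:R <= 2 * w * M%:R.
    by apply: ler_wpM2l; [rewrite mulr_ge0// ltW|rewrite ler_nat ltnW].
  have k2 : w <= w * M%:R by rewrite ler_peMr ?(ltW w0)// ler1n.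
  by rewrite ger0_norm; clear - mW h2 h3 k0 k1 k2 wM w0; lra.
split => //.
  move=> i j /andP[ij jM]; have lij := incr i j ij jM; have xij := xlt i j ij jM.
  by clear - mW lij xij w0; lra.
have sumk' : PE M x <= M%:R ^+ 2 * (e + h).
  have : (\sum_(i < M) \sum_(j < M | j != i) kern (x i) (x j) =
      (PE M x)%:E)%E.
    rewrite /pair_energy -sumEFin; apply: eq_bigr => i _.
    rewrite -sumEFin; apply: eq_bigr => j ji; rewrite kernE//.
    have : (i : nat) != j by rewrite eq_sym.
    rewrite neq_ltn => /orP[ij|ji']; first by rewrite lt_eqF// xlt.
    by rewrite gt_eqF// xlt.
  by move=> hh; move: sumk; rewrite hh lee_fin natrX.
have ptw (i j : 'I_M) : j != i -> kreal (l i) (l j) <= (1 + 2 * h) * kreal (x i) (x j) + h.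
  move=> ji.
  have Wl (k : 'I_M) : W (l k) <= (1 + h) * W (x k) + h.
    by apply: hd; rewrite distrC; apply: le_trans (close k _) dd0.
  have : (i : nat) != j by rewrite eq_sym.
  rewrite neq_ltn => /orP[ij|ij].
    have xij := xlt i j ij (ltn_ord j); have lij := incr i j ij (ltn_ord j).
    apply: (kreal_spread cf) => //; first by rewrite lt_eqF.
    by rewrite distrC (distrC (l i)) !ger0_norm; clear - mW xij lij w0; lra.
  have xij := xlt j i ij (ltn_ord i); have lij := incr j i ij (ltn_ord i).
  apply: (kreal_spread cf) => //; first by rewrite gt_eqF.
  by rewrite !ger0_norm; clear - mW xij lij w0; lra.
apply: (@le_trans _ _ ((1 + 2 * h) * PE M x + h * M%:R ^+ 2)).
  apply: (@le_trans _ _ (\sum_(i < M) \sum_(j < M | j != i)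
      ((1 + 2 * h) * kreal (x i) (x j) + h))).
    by apply: ler_sum => i _; apply: ler_sum => j ji; exact: ptw.
  have -> : (1 + 2 * h) * PE M x + h * M%:R ^+ 2 =
      \sum_(i < M) ((1 + 2 * h) * (\sum_(j < M | j != i) kreal (x i) (x j)) + h * M%:R).
    rewrite big_split/= -mulr_sumr sumr_const card_ord -[(h * M%:R) *+ M]mulr_natl.
    by congr (_ + _); ring.
  apply: ler_sum => i _; rewrite big_split/= -mulr_sumr lerD2l.
  apply: (@le_trans _ _ (\sum_(j < M) h)).
    by rewrite [leLHS]big_mkcond; apply: ler_sum => j _; case: ifPn => // _; exact: ltW.
  by rewrite sumr_const card_ord -[leLHS]mulr_natr.
have hh : (1 + 2 * h) * (M%:R ^+ 2 * (e + h)) + h * M%:R ^+ 2 <=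
    M%:R ^+ 2 * (e + eta).
  have -> : (1 + 2 * h) * (M%:R ^+ 2 * (e + h)) + h * M%:R ^+ 2 =
     M%:R ^+ 2 * (e + (2 * h * e + 2 * h + 2 * h * h)) by ring.
  rewrite ler_wpM2l ?exprn_ge0// lerD2l; apply: le_trans he.
  have : h * h <= h by rewrite ler_piMr// ltW.
  by clear - mW; lra.
by apply: le_trans hh; rewrite lerD2r ler_wpM2l//; clear - mW h0; lra.
Qed.

Variables (b beta : R) (V : R -> R).
Hypothesis VW : forall x, W x = V x + b.
Hypothesis beta0 : 0 < beta.

(** The pair energy bounds the product weight as well: by [sum_kreal_ge] the sum of the potentials
    is at most [2 * E / (N - 1)]. *)
Lemma integral_box_ge N (y : nat -> R) (w E : R) (A : set (N.-tuple RR)) :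
  (1 < N)%N -> 0 <= w -> box N y w `<=` A ->
  (forall lam, box N y w lam ->
    (forall i j, (i < j < N)%N -> nth 0 lam i < nth 0 lam j) /\
    PE N (nth 0 lam) <= E) ->
  ((expR (beta / 2 * (log_factor B b N - E - 2 * E / (N%:R - 1))) * w ^+ N)%:E <=
   \int[lebesgue_tuple N]_(lam in A) (gibbs_density V beta lam)%:E)%E.
Proof.
move=> N1 w0 boxA hbox; set C := expR _.
have -> : (C * w ^+ N)%:E = (\int[lebesgue_tuple N]_(lam in box N y w) (cst C%:E) lam)%E.
  rewrite integral_cst//; last exact: measurable_box.
  by rewrite EFinM; congr (_ * _)%E; exact/esym/lebesgue_box.
apply: integral_mono.
- by move=> lam _; rewrite lee_fin expR_ge0.
- by move=> lam _; rewrite lee_fin mulr_ge0 ?powR_ge0 ?expR_ge0.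
move=> lam blam; split; first exact: boxA.
have [inc hPE] := hbox lam blam.
have inj (i j : nat) : (i < N)%N -> (j < N)%N -> i != j -> nth 0 lam i != nth 0 lam j.
  move=> iN jN; rewrite neq_ltn => /orP[ij|ij]; first by rewrite lt_eqF// inc// ij.
  by rewrite gt_eqF// inc// ij.
rewrite lee_fin (gibbs_densityE B beta VW); last first.
  move=> i j ij; rewrite !(tnth_nth 0); apply: inj => //.
rewrite -expR_sum -expRD ler_expR -mulr_sumr.
have TE : \sum_(i < N) W (tnth lam i) <= 2 * E / (N%:R - 1).
  have N1' : 0 < N%:R - 1 :> R by rewrite subr_gt0 ltr1n.
  rewrite ler_pdivlMr//.
  have := le_trans (sum_kreal_ge cf inj) hPE.
  rewrite (eq_bigr (fun i : 'I_N => W (tnth lam i))); last first.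
    by move=> i _; rewrite (tnth_nth 0).
  lra.
have b20 : 0 <= beta / 2 by rewrite divr_ge0// ltW.
rewrite mulNr -mulrBr ler_wpM2l//; lra.
Qed.

(** With [E] of order [N ^ 2], the one-body term is [O(N)], and the volume costs
    [N * (ln N - ln k)]; the spare [eta / 2] in front of [N ^ 2] pays for both. *)
Lemma box_asymptotics (e eta k : R) : 0 <= e -> 0 < eta -> 0 < k ->
  exists2 N0 : nat, (1 < N0)%N & forall (N : nat) (E w L : R), (N0 <= N)%N ->
  0 <= E -> E <= N%:R ^+ 2 * (e + eta / 2) -> k / N%:R <= w ->
  expR (beta / 2 * (L - N%:R ^+ 2 * (e + eta))) <=
  expR (beta / 2 * (L - E - 2 * E / (N%:R - 1))) * w ^+ N.
Proof.
move=> e0 eta0 k0; pose C := 1 + `|2 * beta * (e + eta / 2) - ln k|.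
have be0 : 0 < beta * eta / 4 by rewrite divr_gt0// mulr_gt0.
have [N0 N00 hN] := log_sublinear C be0.
exists N0.+2 => // N E w L NN0 E0 hE kw.
have N2 : 2 <= N%:R :> R by rewrite (ler_nat _ 2) (leq_trans _ NN0).
have N0' : 0 < N%:R :> R by lra.
have w0 : 0 < w by apply: lt_le_trans kw; rewrite divr_gt0.
have -> : w ^+ N = expR (N%:R * ln w) by rewrite expRM_natl lnK.
rewrite -expRD ler_expR.
have lw : ln k - ln N%:R <= ln w.
  by rewrite -ln_div ?posrE// ler_ln ?posrE ?divr_gt0.
have EN : 2 * E / (N%:R - 1) <= 4 * (N%:R * (e + eta / 2)).
  rewrite ler_pdivrMr; last lra.
  have : 2 * E <= 2 * (N%:R ^+ 2 * (e + eta / 2)) by rewrite ler_wpM2l.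
  have : N%:R * (e + eta / 2) * N%:R <= N%:R * (e + eta / 2) * (2 * (N%:R - 1)).
    by rewrite ler_wpM2l ?mulr_ge0 ?addr_ge0//; lra.
  by rewrite expr2; lra.
have := hN N (leq_trans (leqnSn _) (ltnW NN0)) => hlog.
have l0 : 0 <= ln N%:R :> R by rewrite ln_ge0//; lra.
have hl : 2 * beta * (e + eta / 2) - ln k + ln N%:R <= beta * eta / 4 * N%:R.
  apply: le_trans hlog.
  have := ler_norm (2 * beta * (e + eta / 2) - ln k).
  have : 0 <= `|2 * beta * (e + eta / 2) - ln k| * ln N%:R by rewrite mulr_ge0.
  rewrite /C; lra.
have hl' : N%:R * (2 * beta * (e + eta / 2) - ln k + ln N%:R) <=
   N%:R * (beta * eta / 4 * N%:R) by rewrite ler_wpM2l// ltW.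
have h1 : N%:R * (ln k - ln N%:R) <= N%:R * ln w by rewrite ler_wpM2l// ltW.
have h2 : beta / 2 * (E + 2 * E / (N%:R - 1)) <=
   beta / 2 * (N%:R ^+ 2 * (e + eta / 2) + 4 * (N%:R * (e + eta / 2))).
  by rewrite ler_wpM2l ?divr_ge0 ?(ltW beta0)//; lra.
rewrite expr2 in h2 *; lra.
Qed.

Lemma partition_function_lower (nu : probability RR R) (eta : R) :
  (energy W B nu < +oo)%E -> (\int[nu]_x (W x)%:E < +oo)%E -> 0 < eta ->
  exists N0 : nat, forall N, (N0 <= N)%N ->
  ((expR (beta / 2 * (log_factor B b N -
      N%:R ^+ 2 * (fine (energy W B nu) + eta))))%:E <=
   partition_function V beta N)%E.
Proof.
move=> Efin Wfin eta0; set e := fine (energy W B nu).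
have e0 : 0 <= e by rewrite fine_ge0//; exact: energy_ge0 cf nu.
have eta20 : 0 < eta / 2 by lra.
have [d0 d00 hd] := spread_discretization measurableT (probability_setT _) Efin Wfin eta20.
have [|M0 M00 hM] := hd d0; first by rewrite d00 lexx.
have k0 : 0 < d0 / 3 by lra.
have [N1 N11 hN1] := box_asymptotics e0 eta0 k0.
exists (maxn N1 M0) => N; rewrite geq_max => /andP[NN1 NM0].
have [q [x [Qq _ _ hl]]] := hM N NM0.
have N_gt0 : (0 < N)%N := leq_trans M00 NM0.
have Nr : 0 < N%:R :> R by rewrite ltr0n.
set w := d0 / (3 * N%:R) in hl.
have w0 : 0 < w by rewrite divr_gt0// mulr_gt0.
pose E := N%:R ^+ 2 * (e + eta / 2).
have E0 : 0 <= E by rewrite mulr_ge0 ?exprn_ge0// addr_ge0// ltW.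
apply: (@le_trans _ _ (expR (beta / 2 * (log_factor B b N - E - 2 * E / (N%:R - 1))) *
    w ^+ N)%:E).
  rewrite lee_fin; apply: hN1 => //.
  by rewrite /w le_eqVlt; apply/orP; left; apply/eqP; field; rewrite gt_eqF.
rewrite /partition_function.
apply: (@integral_box_ge N (fun i => x i + 2 * w * i%:R)) => //.
- by rewrite (leq_trans _ NN1).
- exact: ltW.
move=> lam blam; have [|inc _ hPE] := hl (nth 0 lam).
  by move=> i iN; have := blam (Ordinal iN); rewrite (tnth_nth 0).
by split.
Qed.

End lower_bound.

(** * Coupling of a measure with the gap measure of an ordered configuration *)

Section step_coupling.
Context {R : realType} (p : nat).
Local Notation RR := (measurableTypeR R).
Local Open Scope ereal_scope.

Lemma order_stat_increasing N (lam : N.-tuple RR) :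
  (forall i j, (i < j < N)%N -> (nth 0 lam i < nth 0 lam j)%R) ->
  forall k, order_stat lam k.+1 = nth 0%R lam k.
Proof.
move=> inc k; rewrite /order_stat sorted_sort//.
  exact: le_trans.
apply/(sortedP 0%R) => i; rewrite size_tuple => iN.
by apply/ltW/inc; rewrite ltnSn.
Qed.

Lemma integral_tau (c : R) (mu : probability RR R) (f : RR -> \bar R) :
  measurable_fun setT f -> (forall x, 0 <= f x) ->
  \int[tau c mu]_x f x = \int[mu]_x f (c - (x : R))%R.
Proof. by move=> mf f0; rewrite /tau ge0_integral_distribution. Qed.

Lemma gap_measure_M1plus N (lam : N.-tuple RR) : (1 < N)%N ->
  (forall i j, (i < j < N)%N -> (nth 0 lam i < nth 0 lam j)%R) ->
  M1plus p (gap_measure lam).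
Proof.
move=> N1 inc; have N0 : ((N.-1)%:R : R) != 0%R.
  by rewrite pnatr_eq0; case: (N) N1 => [|[]].
split.
  rewrite gap_measureE//.
  rewrite (eq_bigr (fun=> 1%:E)); last first.
    move=> k _; rewrite diracE mem_set//= in_itv/= andbT subr_ge0.
    have -> : order_stat lam N = nth 0%R lam N.-1.
      by have := order_stat_increasing inc N.-1; rewrite prednK// ltnW.
    rewrite order_stat_increasing//; apply/ltW/inc.
    by rewrite ltn_ord/= prednK// ltnW.
  by rewrite sumEFin sumr_const card_ord -EFinM mulVf.
rewrite integral_gap_measure//.
- by rewrite sumEFin -EFinM ltry.
- by apply/measurable_EFinP; apply: measurable_funX; exact: normr_measurable.
Qed.

(* The gap measure of an increasing configuration [l 0 < .. < l M] is the image
   of [mu] under [x |-> l M - l i], where [i] is the quantile cell of [c - x]. *)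
Lemma gap_coupling (M : nat) (lam : M.+1.-tuple RR) (mu : probability RR R)
    (c : R) q : (0 < M)%N -> quantiles (tau c mu) M q ->
  (forall i j, (i < j < M.+1)%N -> (nth 0 lam i < nth 0 lam j)%R) ->
  exists2 pi, couplings mu (gap_measure lam) pi &
  \int[pi]_z (`|(z.1 : R) - (z.2 : R)| ^+ p)%:E =
  \sum_(i < M) \int[tau c mu]_(y in cell q i)
    (`|c - (y : R) - (nth 0 lam M - nth 0 lam i)| ^+ p)%:E.
Proof.
move=> M0 Qq inc; set nu := tau c mu; pose l := nth 0%R lam.
(* The step function sending each quantile cell to its particle; equal cell masses give every lower
   particle the weight [1 / M]. *)
pose T (y : RR) : RR := (\sum_(i < M) l i * \1_(cell q i) y)%R.
have TE (i : 'I_M) y : cell q i y -> T y = l i.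
  move=> yi; rewrite /T (bigD1 i)//= indicE mem_set// mulr1 big1 ?addr0// => j ji.
  rewrite indicE memNset ?mulr0// => yj.
  by have /val_inj/eqP := cell_inj Qq yj yi; apply/negP.
have mT : measurable_fun setT T.
  apply: measurable_sum => i; apply: measurable_funM => //.
  by apply: measurable_indic; exact: measurable_cell.
pose S (y : RR) : RR := (l M - T y)%R.
have mS : measurable_fun setT S by exact: measurable_funB.
(* The coupling is the law of this graph map under [mu]. *)
pose phi (x : RR) : RR * RR := (x, S (c - (x : R))%R).
have mphi : measurable_fun setT phi.
  apply: measurable_fun_pair => //=.
  exact: (measurableT_comp mS (measurable_sub_from c)).
pose phi_mfun := @isMeasurableFun.Build _ _ _ _ phi mphi.
pose X : {RV mu >-> (RR * RR)%type} := HB.pack_for {mfun RR >-> (RR * RR)%type} phi phi_mfun.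
exists (distribution mu X).
  move=> A mA; split; first by [].
  have mSA : measurable (S @^-1` A) by rewrite -[X in measurable X]setTI; exact: mS.
  transitivity (nu (S @^-1` A)); first by [].
  have -> : nu (S @^-1` A) = \int[nu]_y (\1_(S @^-1` A) y)%:E.
    by rewrite integral_indic// setIT.
  rewrite -(sum_integral_cell Qq); last 2 first.
  - by apply/measurable_EFinP; exact: measurable_indic.
  - by move=> y; rewrite lee_fin.
  rewrite gap_measureE// ge0_sume_distrr//; apply: eq_bigr => i _.
  rewrite !order_stat_increasing//.
  rewrite (eq_integral (cst (\1_A (l M - l i)%R)%:E)).
    rewrite integral_cst; last exact: measurable_cell.
    rewrite [X in _ * X](quantile_mass Qq)// muleC; congr (_ * _).
  move=> y /set_mem yi; have e : S y = (l M - l i)%R by rewrite /S (TE i).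
  rewrite /= !indicE; congr ((nat_of_bool _)%:R%:E).
  by apply/idP/idP => /set_mem h; apply/mem_set; move: h => /=; rewrite e.
rewrite ge0_integral_distribution//; last exact: measurable_dist.
pose g (y : RR) : \bar R := (`|c - (y : R) - S y| ^+ p)%:E.
have mg : measurable_fun setT g.
  apply/measurable_EFinP; apply: measurable_funX; apply: measurableT_comp => //.
  by apply: measurable_funB => //; exact: measurable_funB.
have g0 y : 0 <= g y by rewrite lee_fin exprn_ge0.
transitivity (\int[nu]_y g y).
  rewrite integral_tau//; apply: eq_integral => x _ /=.
  by rewrite /g; congr (`| _ - _| ^+ _)%:E; ring.
rewrite -(sum_integral_cell Qq)//; apply: eq_bigr => i _.
by apply: eq_integral => y /set_mem yi; rewrite /g /S (TE i).
Qed.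

End step_coupling.

(** * Lower bound for the integral over the event *)

Section event_lower_bound.
Context {R : realType} (p : nat) (W : R -> R) (a B : R).
Hypothesis cf : confining p W a B.
Local Notation RR := (measurableTypeR R).
Local Notation kreal := (kreal W B).
Local Notation PE := (pair_energy W B).

Let mW := conf_meas cf.

Variables (b beta : R) (V : R -> R).
Hypothesis VW : forall x, W x = V x + b.
Hypothesis beta0 : 0 < beta.

Lemma pair_energyS (M : nat) (l : nat -> R) :
  PE M.+1 l = PE M l + \sum_(j < M) 2 * kreal (l j) (l M).
Proof.
rewrite /pair_energy !(sum_neq_lt _ (fun i j => kreal (l i) (l j))) big_ord_recr/=.
congr (_ + _); apply: eq_bigr => j _.
by rewrite kreal_sym mulr_natl mulr2n.
Qed.

(** The [N - 1] lower particles discretize [tau c mu] and stay below [c + d]; the top one lies in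
    [[c + 2 * d, c + 3 * d]]. It is thus the maximum, at distance at least [d] from the others, and
    its interaction energy is only [O(N)]. *)
Lemma event_integral_lower (mu : probability RR R) (c delta delta' eta : R) :
  mu `[0, +oo[%classic = 1%E ->
  (energy W B (tau c mu) < +oo)%E -> (\int[tau c mu]_x (W x)%:E < +oo)%E ->
  0 < delta -> 0 < delta' -> 0 < eta ->
  exists N0 : nat, forall N, (N0 <= N)%N ->
  ((expR (beta / 2 * (log_factor B b N -
      N%:R ^+ 2 * (fine (energy W B (tau c mu)) + eta))))%:E <=
   \int[lebesgue_tuple N]_(lam in [set lam : N.-tuple RR |
       (order_stat lam N \in `[(c - delta'), (c + delta')])%R /\
       ball_wasserstein p mu delta (gap_measure lam)])
     (gibbs_density V beta lam)%:E)%E.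
Proof.
move=> mu0 Efin Wfin delta0 delta'0 eta0; set nu := tau c mu; set e := fine _.
have p0 : (0 < p)%N by have := conf_p cf; case: (p).
have e0 : 0 <= e by rewrite fine_ge0//; exact: energy_ge0 cf nu.
(* As [mu] is carried by the half-line, [tau c mu] is carried by [D]; sampling inside [D] keeps the
   lower particles away from the top one. *)
pose D : set RR := `]-oo, c]%classic.
have mD : measurable D by exact: measurable_itv.
have nuD : nu D = 1%E.
  rewrite -mu0 /nu /tau /distribution /pushforward/=; congr (mu _).
  apply/seteqP; split => x /=; rewrite /sub_from !in_itv/= ?andbT => h.
    by have : c - (x : R) <= c := h; rewrite gerBl.
  by have : 0 <= (x : R) := h; rewrite -(gerBl c).
(* Discretization and displacement may each cost [e1]; after the factor [2 ^ p] of [exprn_add_le]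
   the total is [delta ^ p / 2], strictly inside the ball. *)
pose e1 := delta ^+ p / (4 * 2 ^+ p).
have p2 : 0 < 2 ^+ p :> R by rewrite exprn_gt0.
have dp0 : 0 < delta ^+ p by rewrite exprn_gt0.
have e10 : 0 < e1 by rewrite divr_gt0// mulr_gt0.
pose eta' := Num.min (eta / 4) e1.
have eta'0 : 0 < eta' by rewrite lt_min e10 andbT; lra.
have eta'1 : eta' <= eta / 4 by rewrite ge_min lexx.
have eta'2 : eta' <= e1 by rewrite ge_min lexx orbT.
have [d0 d00 hd] := spread_discretization cf mD nuD Efin Wfin eta'0.
(* A gap moves by at most [4 * d], one [d] for the lower particle and three for the top one;
   [4 * d <= 1] allows [(4 * d) ^ p <= 4 * d <= e1]. The bound [delta' / 3] keeps the top particle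
   in its window. *)
pose d := Num.min (Num.min d0 (delta' / 3)) (Num.min (1 / 4) (e1 / 4)).
have dgt0 : 0 < d by rewrite !lt_min d00 /=; apply/and3P; split; lra.
have dd0 : d <= d0 by rewrite !ge_min lexx.
have dd' : 3 * d <= delta'.
  have : d <= delta' / 3 by rewrite !ge_min lexx orbT.
  lra.
have d4 : 4 * d <= 1.
  have : d <= 1 / 4 by rewrite !ge_min lexx !orbT.
  lra.
have de1 : 4 * d <= e1.
  have : d <= e1 / 4 by rewrite !ge_min lexx !orbT.
  lra.
have [|M0 M00 hM] := hd d; first by rewrite dgt0 dd0.
have k0 : 0 < d / 3 by lra.
have [N1 N11 hN1] := box_asymptotics beta0 e0 eta0 k0.
have [C C0 hC] := conf_le cf.
(* [Wtop] bounds the potential of the top particle, so twice its interaction with particle [j] is at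
   most [W (l j) + K]; [N2] lets the sum over [j] fit between [eta / 4] and [eta / 2]. *)
pose Wtop := C * (1 + (`|c| + 3 * d) ^+ p).
pose K := `|Wtop + 2 * B - 2 * ln d|.
pose N2 := (Num.truncn ((8 * (4 * (e + eta / 4) + K)) / eta)).+1.
exists (maxn N1 (maxn M0.+1 N2.+2)) => N; rewrite !geq_max => /and3P[NN1 NM0 NN2].
have [M NM] : exists M, N = M.+1 by exists N.-1; rewrite prednK// (leq_trans _ NM0).
subst N.
have MM0 : (M0 <= M)%N by rewrite -ltnS.
have M_gt0 : (0 < M)%N := leq_trans M00 MM0.
have Mr : 0 < M%:R :> R by rewrite ltr0n.
have M2 : 2 <= M%:R :> R by rewrite (ler_nat _ 2) -ltnS (leq_trans _ NN2).
have [q [x [Qq hxD cost hl]]] := hM M MM0.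
set w := d / (3 * M%:R) in hl.
have w0 : 0 < w by rewrite divr_gt0// mulr_gt0.
have wd : w <= d by rewrite ler_pdivrMr ?mulr_gt0// ler_peMr ?(ltW dgt0)//; lra.
pose y i := if (i < M)%N then x i + 2 * w * i%:R else c + 2 * d.
have spec (lam : M.+1.-tuple RR) : box M.+1 y w lam ->
  [/\ forall i j, (i < j < M.+1)%N -> nth 0 lam i < nth 0 lam j,
      forall i, (i < M)%N -> `|nth 0 lam i - x i| <= d,
      c + 2 * d <= nth 0 lam M <= c + 3 * d &
      PE M (nth 0 lam) <= M%:R ^+ 2 * (e + eta / 4)].
  move=> blam.
  have [|inc close hPE] := hl (nth 0 lam).
    move=> i iM; have := blam (Ordinal (ltnW iM : (i < M.+1)%N)).
    by rewrite (tnth_nth 0)/= /y iM.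
  have top : c + 2 * d <= nth 0 lam M <= c + 3 * d.
    have := blam ord_max; rewrite (tnth_nth 0)/= /y ltnn => /andP[-> h]/=.
    by apply: le_trans h _; clear - mW VW beta0 wd; lra.
  split => //.
    move=> i j /andP[ij]; rewrite ltnS leq_eqVlt => /orP[/eqP jM|jM]; last first.
      by apply: inc; rewrite ij.
    have iM : (i < M)%N by rewrite -jM.
    have := hxD i iM; rewrite /D/= in_itv/= => xic.
    have := close i iM; rewrite ler_norml => /andP[_ h].
    by rewrite jM; case/andP: top => h1 _; clear - mW VW beta0 xic h h1 dgt0; lra.
  apply: (le_trans hPE); rewrite ler_wpM2l ?exprn_ge0// lerD2l.
  exact: eta'1.
pose E := M.+1%:R ^+ 2 * (e + eta / 2).
have PEtop (lam : M.+1.-tuple RR) : box M.+1 y w lam -> PE M.+1 (nth 0 lam) <= E.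
  move=> blam; have [inc close /andP[t1 t2] hPE] := spec lam blam.
  set l := nth 0 lam in inc close t1 t2 hPE *.
  have inj (i j : nat) : (i < M)%N -> (j < M)%N -> i != j -> l i != l j.
    move=> iM jM; rewrite neq_ltn => /orP[ij|ij].
      by rewrite lt_eqF// inc// ij ltnW.
    by rewrite gt_eqF// inc// ij ltnW.
  have TM : (M%:R - 1) / 2 * \sum_(i < M) W (l i) <= PE M l := sum_kreal_ge cf inj.
  have T0 : 0 <= \sum_(i < M) W (l i).
    by apply: sumr_ge0 => i _; exact: confining_ge0 cf _.
  have Wl : W (l M) <= Wtop.
    apply: (le_trans (hC _)); rewrite /Wtop ler_wpM2l// lerD2l.
    rewrite lerXn2r ?nnegrE ?addr_ge0 ?mulr_ge0 ?(ltW dgt0)//.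
    have c1 := ler_norm c; have c2 := ler_norm (- c); rewrite normrN in c2.
    by rewrite ler_norml; apply/andP; split; clear - mW VW beta0 c1 c2 t1 t2 dgt0; lra.
  have kt (j : 'I_M) : 2 * kreal (l j) (l M) <= W (l j) + K.
    have jM := ltn_ord j.
    have := hxD j jM; rewrite /D/= in_itv/= => xic.
    have := close j jM; rewrite ler_norml => /andP[_ h].
    have dist : d <= `|l j - l M|.
      by rewrite distrC ger0_norm; clear - mW VW beta0 h xic t1 dgt0; lra.
    have lnd : ln d <= ln `|l j - l M|.
      by rewrite ler_ln ?posrE// (lt_le_trans dgt0).
    have := ler_norm (Wtop + 2 * B - 2 * ln d); rewrite -/K krealE => hn.
    by clear - mW VW beta0 hn lnd Wl; lra.
  rewrite pair_energyS.
  have : \sum_(j < M) 2 * kreal (l j) (l M) <= \sum_(j < M) W (l j) + M%:R * K.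
    apply: le_trans (ler_sum _ (fun j _ => kt j)) _.
    by rewrite big_split/= sumr_const card_ord -[K *+ M]mulr_natl.
  have hN2 : 8 * (4 * (e + eta / 4) + K) <= eta * M%:R.
    rewrite [leRHS]mulrC -ler_pdivrMr//.
    apply: le_trans (ltW (truncnS_gt _)) _; rewrite ler_nat.
    by rewrite -ltnS; apply: leq_trans NN2; rewrite ltnS leqnSn.
  have PE0 : 0 <= e + eta / 4 by clear - mW VW beta0 e0 eta0; lra.
  have TM' : \sum_(i < M) W (l i) <= M%:R * (4 * (e + eta / 4)).
    have h1 : M%:R / 4 * \sum_(i < M) W (l i) <= M%:R ^+ 2 * (e + eta / 4).
      apply: le_trans hPE; apply: le_trans TM; rewrite ler_wpM2r//.
      by clear - mW VW beta0 M2; lra.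
    have : 4 / M%:R * (M%:R / 4 * \sum_(i < M) W (l i)) <=
        4 / M%:R * (M%:R ^+ 2 * (e + eta / 4)).
      by rewrite ler_wpM2l// divr_ge0.
    rewrite (_ : 4 / M%:R * (M%:R / 4 * _) = \sum_(i < M) W (l i)); last first.
      by field; rewrite gt_eqF.
    by rewrite (_ : 4 / M%:R * (M%:R ^+ 2 * _) = M%:R * (4 * (e + eta / 4)))//; field;
      rewrite gt_eqF.
  move=> hsum.
  have h2 : M%:R * (8 * (4 * (e + eta / 4) + K)) <= M%:R * (eta * M%:R).
    by rewrite ler_wpM2l.
  have h3 : M%:R ^+ 2 * (e + eta / 2) <= E.
    rewrite /E ler_wpM2r ?addr_ge0//; first by clear - mW VW beta0 eta0; lra.
    by rewrite lerXn2r ?nnegrE// ler_nat.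
  have h4 : 0 <= M%:R * (eta * M%:R) by rewrite !mulr_ge0// ltW.
  apply: le_trans h3; rewrite expr2 in hPE *; clear - mW VW beta0 hPE hsum TM' h2 h4; lra.
have E0 : 0 <= E by rewrite mulr_ge0 ?exprn_ge0// addr_ge0//; clear - mW VW beta0 eta0; lra.
apply: (@le_trans _ _ (expR (beta / 2 * (log_factor B b M.+1 - E - 2 * E / (M.+1%:R - 1))) *
    w ^+ M.+1)%:E).
  rewrite lee_fin; apply: hN1 => //.
  have -> : w = d / 3 / M%:R by rewrite /w; field; rewrite gt_eqF.
  by rewrite ler_pM2l// lef_pV2 ?posrE ?ltr0n// ler_nat.
apply: (integral_box_ge cf VW beta0) => //; [exact: ltW| |]; last first.
  by move=> lam blam; have [inc _ _ _] := spec lam blam; split => //; exact: PEtop.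
move=> lam blam; have [inc close /andP[t1 t2] _] := spec lam blam.
have MN : (1 < M.+1)%N by rewrite ltnS.
split.
  by rewrite order_stat_increasing// in_itv/=; apply/andP; split;
    clear - mW VW beta0 t1 t2 dd' dgt0; lra.
split; first exact: gap_measure_M1plus.
have [pi cpl costE] := gap_coupling p M_gt0 Qq inc.
apply: (wasserstein_le_coupling (e := delta ^+ p / 2) p0 delta0 cpl); last first.
  by clear - mW VW beta0 dp0; lra.
rewrite costE.
have nu0 := quantile_mass Qq.
have nxp (i : 'I_M) : (\int[nu]_(z in cell q i)
     (`|c - (z : R) - (nth 0 lam M - nth 0 lam i)| ^+ p)%:E <=
   (2 ^+ p)%:E * \int[nu]_(z in cell q i) (`|x i - (z : R)| ^+ p)%:E +
   (2 ^+ p * (4 * d) / M%:R)%:E)%E.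
  have mC := measurable_cell q i.
  have mz : measurable_fun (cell q i) (fun z : RR => (`|x i - (z : R)| ^+ p)%:E).
    by apply: measurable_funTS; exact: measurable_dist2.
  have z0 (z : RR) : (0 <= (`|x i - (z : R)| ^+ p)%:E)%E by rewrite lee_fin exprn_ge0.
  apply: (@le_trans _ _ (\int[nu]_(z in cell q i)
    ((2 ^+ p)%:E * (`|x i - (z : R)| ^+ p)%:E + (2 ^+ p * (4 * d))%:E))%E).
    apply: integral_mono => z zi.
    - by rewrite lee_fin exprn_ge0.
    - by rewrite adde_ge0// ?mule_ge0// lee_fin ?(ltW p2)// !mulr_ge0// ltW.
    split => //; rewrite -EFinM -EFinD lee_fin.
    have cl := close i (ltn_ord i).
    have tri : `|c - (z : R) - (nth 0 lam M - nth 0 lam i)| <= `|x i - (z : R)| + 4 * d.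
      have -> : c - (z : R) - (nth 0 lam M - nth 0 lam i) =
        (x i - (z : R)) + ((nth 0 lam i - x i) + (c - nth 0 lam M)) by ring.
      apply: le_trans (ler_normD _ _) _; rewrite lerD2l.
      apply: le_trans (ler_normD _ _) _.
      have : `|c - nth 0 lam M| <= 3 * d.
        by rewrite distrC ger0_norm; clear - mW VW beta0 t1 t2 dgt0; lra.
      by move=> h; clear - mW VW beta0 h cl; lra.
    have d40 : 0 <= 4 * d by clear - mW VW beta0 dgt0; lra.
    apply: (@le_trans _ _ ((`|x i - (z : R)| + 4 * d) ^+ p)).
      by rewrite lerXn2r ?nnegrE ?addr_ge0.
    apply: le_trans (exprn_add_le p _ d40) _ => //.
    rewrite -mulrDr ler_wpM2l ?(ltW p2)// lerD2l.
    by rewrite -[leRHS]expr1; apply: ler_wiXn2l.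
  have z1 (z : RR) : cell q i z -> (0 <= (2 ^+ p)%:E * (`|x i - (z : R)| ^+ p)%:E)%E.
    by move=> _; rewrite mule_ge0// lee_fin ltW.
  have mz1 : measurable_fun (cell q i) (fun z : RR => (2 ^+ p)%:E * (`|x i - (z : R)| ^+ p)%:E)%E.
    exact: measurable_funeM.
  have c1 (z : RR) : cell q i z -> (0 <= (2 ^+ p * (4 * d))%:E)%E.
    by move=> _; rewrite lee_fin !mulr_ge0// ltW.
  rewrite ge0_integralD//.
  rewrite ge0_integralZl_EFin ?(ltW p2)// leeD2l// integral_cst//.
  by rewrite [X in (_ * X)%E](nu0 i)// -EFinM.
apply: (le_trans (lee_sum _ (fun i _ => nxp i))).
rewrite big_split/= -ge0_sume_distrr; last first.
  by move=> i _; apply: integral_ge0 => z _; rewrite lee_fin exprn_ge0.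
rewrite sumEFin sumr_const card_ord -[(_ *+ M)%R]mulr_natl mulrCA mulfV ?gt_eqF// mulr1.
apply: (@le_trans _ _ ((2 ^+ p)%:E * eta'%:E + (2 ^+ p * (4 * d))%:E)%E).
  by rewrite leeD2r// lee_wpmul2l// lee_fin ltW.
rewrite -EFinM -EFinD lee_fin -mulrDr.
apply: (@le_trans _ _ (2 ^+ p * (e1 + e1))).
  by rewrite ler_wpM2l ?(ltW p2)// lerD.
by rewrite /e1 le_eqVlt; apply/orP; left; apply/eqP; field; rewrite gt_eqF.
Qed.

End event_lower_bound.

(** * Removing the truncation *)

Section ereal_transfer.
Context {R : realType}.
Local Open Scope ereal_scope.

(** Here [x] and [e] are the full energies at [c] and at a reference point, [v] and [u] the
    truncated ones, [w] and [w0] the integrals of the potential: translation changes both kinds of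
    energy by [w - w0]. *)
Lemma ereal_transfer_fin (x u v : \bar R) (e t s w w0 : R) :
  t%:E <= x -> x + w0%:E = e%:E + w%:E -> (e - s)%:E < u ->
  v + w0%:E = u + w%:E -> (t - s)%:E <= v.
Proof.
case: x => [x| |] //; rewrite lee_fin => tx [] xe.
case: u => [u| |] //; case: v => [v| |] //; rewrite ?lte_fin ?lee_fin.
- by move=> eu [] vu; lra.
- by rewrite leey.
Qed.

(** At infinite energy there is no value to compare with: the truncated energy at the reference
    point is taken above [t + w0], and [w >= 0] does the rest. *)
Lemma ereal_transfer_infty (u v : \bar R) (t s w w0 : R) :
  (0 <= w)%R -> (0 < s)%R -> (t + w0)%:E < u ->
  v + w0%:E = u + w%:E -> (t - s)%:E <= v.
Proof.
move=> wge0 s0; case: u => [u| |] //; case: v => [v| |] //; rewrite ?lte_fin ?lee_fin.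
- by move=> eu [] vu; lra.
- by rewrite leey.
Qed.

End ereal_transfer.

Section cut_energy_limit.
Context {R : realType} (p : nat) (W : R -> R) (a B : R).
Hypothesis cf : confining p W a B.
Local Notation RR := (measurableTypeR R).
Local Notation kcut := (kcut W B).
Local Notation kern := (kern W B).
Local Open Scope ereal_scope.

Let mW := conf_meas cf.

Lemma M1plus_tau_finite (mu : probability RR R) (c : R) : M1plus p mu ->
  \int[tau c mu]_x (W x)%:E < +oo.
Proof.
move=> [_ mfin]; have [C C0 hC] := conf_le cf.
have W0 x : 0 <= (W x)%:E by rewrite lee_fin; exact: confining_ge0 cf _.
rewrite integral_tau//; last exact/measurable_EFinP.
have r0 : (0 <= C * (1 + 2 ^+ p * `|c| ^+ p))%R.
  by rewrite mulr_ge0// addr_ge0// mulr_ge0// exprn_ge0.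
have k0 : (0 <= C * 2 ^+ p)%R by rewrite mulr_ge0// exprn_ge0.
apply: (@le_lt_trans _ _ (\int[mu]_x ((C * (1 + 2 ^+ p * `|c| ^+ p))%:E +
    (C * 2 ^+ p)%:E * (`|x : R| ^+ p)%:E))).
  apply: integral_mono => x _.
  - exact: W0.
  - by rewrite adde_ge0 ?mule_ge0// lee_fin ?exprn_ge0.
  split => //; rewrite -EFinM -EFinD lee_fin; apply: (le_trans (hC _)).
  rewrite -[(C * 2 ^+ p * _)%R]mulrA -mulrDr ler_wpM2l// -addrA lerD2l -mulrDr.
  apply: (@le_trans _ _ ((`|c| + `|x : R|) ^+ p)%R).
    by rewrite lerXn2r ?nnegrE ?addr_ge0// ler_normB.
  exact: exprn_add_le.
rewrite integral_prob_affine//.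
- by rewrite lte_add_pinfty ?ltry// lte_mul_pinfty// lee_fin.
- by apply/measurable_EFinP; apply: measurable_funX; exact: normr_measurable.
Qed.

Lemma energy_tau (mu : probability RR R) (c : R) : energy W B (tau c mu) =
  \int[mu]_x \int[mu]_y kern (c - (x : R))%R (c - (y : R))%R.
Proof.
have k0 x y : 0 <= kern x y := kern_ge0 cf x y.
rewrite /energy integral_tau; last 2 first.
- exact: measurable_energy_inner cf _.
- by move=> x; exact: integral_ge0.
by apply: eq_integral => x _; rewrite integral_tau//; exact: measurable_kern2.
Qed.

Let msub c : measurable_fun setT
  (fun z : RR * RR => (((c - z.1)%R : RR), ((c - z.2)%R : RR))).
Proof. by apply: measurable_fun_pair => /=; apply: measurable_funB. Qed.

(** The logarithm depends on [x - y] only, so translation affects just the potential. The additive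
    form avoids subtracting integrals that may be infinite. *)
Lemma energy_translate (mu : probability RR R) (k : R -> R -> \bar R) (c c' w w' : R) :
  measurable_fun setT (fun z : RR * RR => k z.1 z.2) -> (forall x y, 0 <= k x y) ->
  \int[tau c mu]_x (W x)%:E = w%:E -> \int[tau c' mu]_x (W x)%:E = w'%:E ->
  (forall x y, k (c - x)%R (c - y)%R + ((W (c' - x) + W (c' - y)) / 2)%:E =
               k (c' - x)%R (c' - y)%R + ((W (c - x) + W (c - y)) / 2)%:E) ->
  \int[mu]_x \int[mu]_y k (c - (x : R))%R (c - (y : R))%R + w'%:E =
  \int[mu]_x \int[mu]_y k (c' - (x : R))%R (c' - (y : R))%R + w%:E.
Proof.
move=> mk k0 hw hw' kk.
have W0 x : (0 <= W x)%R := confining_ge0 cf x.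
pose K d (z : RR * RR) := k (d - (z.1 : R))%R (d - (z.2 : R))%R.
pose G d (z : RR * RR) : \bar R := ((W (d - z.1) + W (d - z.2)) / 2)%:E.
have mK d : measurable_fun setT (K d) by exact: (measurableT_comp mk (msub d)).
have K0 d z : 0 <= K d z by exact: k0.
have mWs d : measurable_fun setT (fun x : RR => (W (d - (x : R)))%:E).
  have mE : measurable_fun setT (fun x : RR => (W x)%:E) by exact/measurable_EFinP.
  exact: (measurableT_comp mE (measurable_sub_from d)).
have G0 d z : 0 <= G d z by rewrite lee_fin divr_ge0// addr_ge0.
have GI d v : \int[tau d mu]_x (W x)%:E = v%:E ->
    measurable_fun setT (G d) /\ \int[mu \x mu]_z G d z = v%:E.
  move=> hv.
  have m1 : measurable_fun setT (fun z : RR * RR => (W (d - (z.1 : R)))%:E).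
    exact: (measurableT_comp (mWs d) measurable_fst).
  have m2 : measurable_fun setT (fun z : RR * RR => (W (d - (z.2 : R)))%:E).
    exact: (measurableT_comp (mWs d) measurable_snd).
  have GE z : G d z = (2^-1)%:E * ((W (d - (z.1 : R)))%:E + (W (d - (z.2 : R)))%:E).
    by rewrite -EFinD -EFinM /G mulrC.
  have mD : measurable_fun setT (fun z : RR * RR =>
      (W (d - (z.1 : R)))%:E + (W (d - (z.2 : R)))%:E) by exact: emeasurable_funD.
  split.
    by move/funext: GE => ->; apply: measurable_funeM; exact: mD.
  transitivity (\int[(mu \x mu)%E]_z ((2^-1)%:E *
    ((W (d - (z.1 : R)))%:E + (W (d - (z.2 : R)))%:E))).
    by apply: eq_integral => z _; exact: GE.
  have D0 (z : RR * RR) : setT z ->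
      0 <= (W (d - (z.1 : R)))%:E + (W (d - (z.2 : R)))%:E.
    by move=> _; rewrite adde_ge0// lee_fin.
  rewrite ge0_integralZl_EFin//.
  rewrite ge0_integralD//; last 2 first.
  - by move=> z _; rewrite lee_fin.
  - by move=> z _; rewrite lee_fin.
  have W0d (x : RR) : 0 <= (W (d - (x : R)))%:E by rewrite lee_fin.
  rewrite (prod_integral1 _ (mWs d) W0d) (prod_integral2 _ (mWs d) W0d).
  have <- : \int[tau d mu]_x (W x)%:E = \int[mu]_x (W (d - (x : R)))%:E.
    by rewrite integral_tau//; exact/measurable_EFinP.
  by rewrite hv -EFinD; congr (_%:E); field.
have [mG GIc] := GI c w hw; have [mG' GIc'] := GI c' w' hw'.
rewrite -(fubini_tonelli1 (K c))// -(fubini_tonelli1 (K c'))// -GIc -GIc'.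
rewrite -!ge0_integralD//.
by apply: eq_integral => z _; exact: kk.
Qed.

Lemma cvg_cut_energy (mu : probability RR R) (c : R) :
  cut_energy W B mu n%:R c @[n --> \oo] --> energy W B (tau c mu).
Proof.
have k0 n x y : 0 <= (kcut n%:R (c - x) (c - y))%:E.
  by rewrite lee_fin; exact: (kcut_ge0 cf).
have mk n := measurable_kcut_sub cf n%:R c.
rewrite energy_tau -(fubini_tonelli1 (fun z : RR * RR =>
  kern (c - (z.1 : R))%R (c - (z.2 : R))%R)); last 2 first.
- exact: (measurableT_comp (measurable_kern B mW) (msub c)).
- by move=> z; exact: kern_ge0 cf _ _.
rewrite (_ : (fun n => cut_energy W B mu n%:R c) = (fun n => \int[mu \x mu]_z
    (kcut n%:R (c - (z.1 : R)) (c - (z.2 : R)))%:E)); last first.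
  by apply/funext => n; rewrite (fubini_tonelli1 (fun z : RR * RR =>
    (kcut n%:R (c - (z.1 : R)) (c - (z.2 : R)))%:E))//.
rewrite [X in _ --> X](eq_integral (fun z : RR * RR => limn (fun n =>
    (kcut n%:R (c - (z.1 : R)) (c - (z.2 : R)))%:E))).
  apply: cvg_monotone_convergence => //.
  by move=> z _ n m nm; rewrite lee_fin; apply: kcut_nd; rewrite ler_nat.
by move=> z _; apply/esym/cvg_lim => //; exact: cvg_kcut.
Qed.

(* By [energy_translate] the cut and the full energies vary in the same way with
   [c], so the truncation level found at one point of [F] is good on all of [F]. *)
Lemma cut_energy_uniform (mu : probability RR R) (F : set R) (t eps : R) :
  M1plus p mu -> F !=set0 -> (forall c, F c -> t%:E <= energy W B (tau c mu)) ->
  (0 < eps)%R -> exists2 m : R, (0 <= m)%R &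
  forall c, F c -> (t - eps)%:E <= cut_energy W B mu m c.
Proof.
move=> mu1 [c0 Fc0] ht eps0.
have W0 x : 0 <= (W x)%:E by rewrite lee_fin; exact: confining_ge0 cf _.
have wE c : exists2 w : R, (0 <= w)%R & \int[tau c mu]_x (W x)%:E = w%:E.
  have f0 : 0 <= \int[tau c mu]_x (W x)%:E by exact: integral_ge0.
  exists (fine (\int[tau c mu]_x (W x)%:E)); first exact: fine_ge0.
  by rewrite fineK// ge0_fin_numE//; exact: M1plus_tau_finite.
have [w0 w00 hw0] := wE c0.
have cutE c m w : (0 <= m)%R -> \int[tau c mu]_x (W x)%:E = w%:E ->
    cut_energy W B mu m c + w0%:E = cut_energy W B mu m c0 + w%:E.
  move=> m0 hw.
  apply: (energy_translate (k := fun x y => (kcut m x y)%:E)) => //.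
  - by apply/measurable_EFinP; exact: measurable_kcut.
  - by move=> x y; rewrite lee_fin; exact: (kcut_ge0 cf).
  move=> x y; rewrite -!EFinD !kcutE; congr (_%:E).
  rewrite (_ : c - x - (c - y) = c0 - x - (c0 - y))%R; last by ring.
  by ring.
have enE c w : \int[tau c mu]_x (W x)%:E = w%:E ->
    energy W B (tau c mu) + w0%:E = energy W B (tau c0 mu) + w%:E.
  move=> hw; rewrite !energy_tau; apply: energy_translate => //.
  - exact: measurable_kern.
  - by move=> x y; exact: kern_ge0 cf _ _.
  move=> x y; have [->|xy] := eqVneq x y; first by rewrite !kernxx.
  rewrite !kernE ?(inj_eq (subrI _))// -!EFinD !krealE; congr (_%:E).
  rewrite (_ : c - x - (c - y) = c0 - x - (c0 - y))%R; last by ring.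
  by ring.
have cut0 := @cvg_cut_energy mu c0.
have [efin|] := ltP (energy W B (tau c0 mu)) +oo.
  pose e := fine (energy W B (tau c0 mu)).
  have eE : energy W B (tau c0 mu) = e%:E.
    by rewrite fineK// ge0_fin_numE//; exact: energy_ge0 cf _.
  have : \forall n \near \oo, (e - eps)%:E < cut_energy W B mu n%:R c0.
    have h : nbhs (energy W B (tau c0 mu)) [set y | (e - eps)%:E < y].
      apply: open_nbhs_nbhs; split; first exact: open_ereal_gt_ereal.
      by rewrite /= eE lte_fin ltrBlDr ltrDl.
    exact: (cut0 _ h).
  move=> /filter_ex[n hn]; exists n%:R => [|c Fc]; first exact: ler0n.
  have [w _ hw] := wE c; have ew := enE c w hw; rewrite eE in ew.
  exact: (ereal_transfer_fin (ht c Fc) ew hn (cutE c n%:R w (ler0n _ _) hw)).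
rewrite leye_eq => /eqP einf.
have : \forall n \near \oo, (t + w0)%:E < cut_energy W B mu n%:R c0.
  have h : nbhs (energy W B (tau c0 mu)) [set y | (t + w0)%:E < y].
    apply: open_nbhs_nbhs; split; first exact: open_ereal_gt_ereal.
    by rewrite /= einf ltry.
  exact: (cut0 _ h).
move=> /filter_ex[n hn]; exists n%:R => [|c Fc]; first exact: ler0n.
have [w w_ge0 hw] := wE c.
exact: (ereal_transfer_infty w_ge0 eps0 hn (cutE c n%:R w (ler0n _ _) hw)).
Qed.

End cut_energy_limit.

(** * Upper bounds on integrals *)

Section upper_bound.
Context {R : realType} (p : nat) (W : R -> R) (a B : R).
Hypothesis cf : confining p W a B.
Variables (b beta : R) (V : R -> R).
Hypothesis VW : forall x, W x = V x + b.
Hypothesis beta0 : 0 < beta.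
Local Notation RR := (measurableTypeR R).
Local Notation LF := (log_factor B b).
Local Notation PE := (pair_energy W B).

Lemma gibbs_density_ge0 N (lam : N.-tuple RR) : 0 <= gibbs_density V beta lam.
Proof. by rewrite mulr_ge0 ?powR_ge0 ?expR_ge0. Qed.

Lemma gibbs_integral_le N (A : set (N.-tuple RR)) (s m : R) :
  (\int[lebesgue_measure]_x (expR (- (beta / 2) * W x))%:E = m%:E)%E ->
  (forall lam, A lam -> (forall i j, (i < N)%N -> (j < N)%N -> i != j ->
     nth 0 lam i != nth 0 lam j) -> s <= PE N (nth 0 lam)) ->
  (\int[lebesgue_tuple N]_(lam in A) (gibbs_density V beta lam)%:E <=
   (expR (beta / 2 * (LF N - s)) * m ^+ N)%:E)%E.
Proof.
move=> hm hs; pose g (x : RR) := expR (- (beta / 2) * W x).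
have mg : measurable_fun setT g.
  apply: (measurableT_comp (@measurable_expR R)).
  by apply: measurable_funM => //; exact: (conf_meas cf).
have g0 x : 0 <= g x by exact: expR_ge0.
have P0 (lam : N.-tuple RR) : 0 <= \prod_(i < N) g (tnth lam i).
  by apply: prodr_ge0 => i _.
have mP : measurable_fun setT (fun lam : N.-tuple RR => \prod_(i < N) g (tnth lam i)).
  apply: measurable_prod => i _.
  exact: (measurableT_comp mg (measurable_tnth i)).
rewrite EFinM -(integral_lebesgue_tuple_prod N mg g0 hm).
rewrite -ge0_integralZl_EFin ?expR_ge0//; last 2 first.
- by move=> lam _; rewrite lee_fin.
- exact/measurable_EFinP.
apply: integral_mono => lam.
- by move=> _; rewrite lee_fin gibbs_density_ge0.
- by move=> _; rewrite mule_ge0// lee_fin// expR_ge0.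
move=> Alam; split => //; rewrite -EFinM lee_fin.
exact: (gibbs_density_le VW beta0 (hs _ Alam)).
Qed.

Lemma linear_le_square (K eta : R) : 0 < eta ->
  exists N0 : nat, forall N, (N0 <= N)%N -> N%:R * K <= N%:R ^+ 2 * eta.
Proof.
move=> eta0; exists (Num.truncn (`|K| / eta)).+1 => N NN.
have h : `|K| / eta <= N%:R.
  apply: ltW; apply: lt_le_trans (truncnS_gt _) _; by rewrite ler_nat.
rewrite expr2 -mulrA ler_wpM2l//; apply: (le_trans (ler_norm _)).
by rewrite -ler_pdivrMr.
Qed.

(** The product weight contributes [m ^ N], which [eta] absorbs at scale [N ^ 2]; the threshold is
    uniform in [t] and [A], so it serves the partition function and the events alike. *)
Lemma gibbs_integral_upper (eta : R) : 0 < eta ->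
  exists N0 : nat, forall N, (N0 <= N)%N -> forall (t : R) (A : set (N.-tuple RR)),
  (forall lam, A lam -> (forall i j, (i < N)%N -> (j < N)%N -> i != j ->
     nth 0 lam i != nth 0 lam j) -> N%:R ^+ 2 * t <= PE N (nth 0 lam)) ->
  (\int[lebesgue_tuple N]_(lam in A) (gibbs_density V beta lam)%:E <=
   (expR (beta / 2 * (LF N - N%:R ^+ 2 * (t - eta))))%:E)%E.
Proof.
move=> eta0; have hb : 0 < beta / 2 by rewrite divr_gt0.
have [m m0 hm] := integral_exp_confining cf hb.
have be0 : 0 < beta / 2 * eta by rewrite mulr_gt0.
(* [1 + m] rather than [m], which is only known to be nonnegative. *)
have [N0 hN0] := linear_le_square (ln (1 + m)) be0.
exists N0 => N NN t A hA; apply: (le_trans (gibbs_integral_le hm hA)).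
have m1 : m ^+ N <= expR (N%:R * ln (1 + m)).
  rewrite mulrC expRM_natr lnK ?posrE ?ltr_pwDl//.
  by rewrite lerXn2r ?nnegrE ?addr_ge0// lerDr.
rewrite lee_fin; apply: (@le_trans _ _ (expR (beta / 2 * (LF N - N%:R ^+ 2 * t)) *
    expR (N%:R * ln (1 + m)))).
  by rewrite ler_wpM2l// expR_ge0.
rewrite -expRD ler_expR; have := hN0 N NN; lra.
Qed.

(** Converts the multiplicative errors of [energy_lower] and [event_pair_energy] into additive ones:
    with [h = eta / (1 + t)], the loss [h * t + h] is exactly [eta]. *)
Lemma relax_bound (t q eta : R) : 0 <= t -> 0 < eta ->
  t <= (1 + eta / (1 + t)) * q + eta / (1 + t) -> t - eta <= q.
Proof.
move=> t0 eta0; set h := eta / (1 + t) => ht; rewrite leNgt; apply/negP => qt.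
have t1 : 0 < 1 + t by lra.
have hE : h * (1 + t) = eta by rewrite /h divfK// gt_eqF.
have h0 : 0 < h by rewrite divr_gt0.
have : (1 + h) * q < (1 + h) * (t - eta) by rewrite ltr_pM2l//; lra.
have : 0 < h * eta by rewrite mulr_gt0.
by lra.
Qed.

Lemma partition_function_upper (e eta : R) : 0 <= e ->
  (forall nu : probability RR R, (\int[nu]_x (W x)%:E < +oo)%E ->
     (e%:E <= energy W B nu)%E) -> 0 < eta ->
  exists N0 : nat, forall N, (N0 <= N)%N ->
  (partition_function V beta N <=
   (expR (beta / 2 * (LF N - N%:R ^+ 2 * (e - eta))))%:E)%E.
Proof.
move=> e0 he eta0; have eta20 : 0 < eta / 2 by lra.
have h0 : 0 < eta / 2 / (1 + e) by rewrite divr_gt0//; lra.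
have [N1 N1_gt0 hN1] := energy_lower cf he h0.
have [N2 hN2] := gibbs_integral_upper eta20.
exists (maxn N1 N2) => N; rewrite geq_max => /andP[NN1 NN2].
have Nr : 0 < N%:R :> R by rewrite ltr0n (leq_trans N1_gt0).
rewrite (_ : e - eta = e - eta / 2 - eta / 2); last by lra.
apply: hN2 => // lam _ inj; rewrite mulrC -ler_pdivlMr ?exprn_gt0//.
by apply: relax_bound => //; exact: hN1.
Qed.

Lemma event_integral_upper (mu : probability RR R) (F : set R) (t m eta : R) :
  0 <= t -> 0 <= m -> 0 < eta ->
  (forall c, F c -> (t%:E <= cut_energy W B mu m c)%E) ->
  exists2 delta : R, 0 < delta & exists N0 : nat, forall N, (N0 <= N)%N ->
  (\int[lebesgue_tuple N]_(lam in [set lam : N.-tuple RR | F (order_stat lam N) /\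
       ball_wasserstein p mu delta (gap_measure lam)]) (gibbs_density V beta lam)%:E <=
   (expR (beta / 2 * (LF N - N%:R ^+ 2 * (t - eta))))%:E)%E.
Proof.
move=> t0 m0 eta0 ht; have eta20 : 0 < eta / 2 by lra.
have h0 : 0 < eta / 2 / (1 + t) by rewrite divr_gt0//; lra.
have [delta delta0 [N1 N1_gt1 hN1]] := event_pair_energy cf mu m0 h0.
have [N2 hN2] := gibbs_integral_upper eta20.
exists delta => //; exists (maxn N1 N2) => N; rewrite geq_max => /andP[NN1 NN2].
have Nr : 0 < N%:R :> R by rewrite ltr0n (leq_trans _ NN1)// ltnW.
rewrite (_ : t - eta = t - eta / 2 - eta / 2); last by lra.
apply: hN2 => // lam [Flam blam] inj; rewrite mulrC -ler_pdivlMr ?exprn_gt0//.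
apply: relax_bound => //.
by have := le_trans (ht _ Flam) (hN1 N lam NN1 inj blam); rewrite lee_fin.
Qed.

End upper_bound.

(** * The rate function *)

Section rate_energy.
Context {R : realType} (p : nat) (W : R -> R) (a B : R).
Hypothesis cf : confining p W a B.
Variables (b : R) (V : R -> R).
Hypothesis VW : forall x, W x = V x + b.
Hypothesis b0 : 0 <= b.
Local Notation RR := (measurableTypeR R).
Local Open Scope ereal_scope.

Let mW : measurable_fun setT (fun x : RR => (W x)%:E).
Proof. apply/measurable_EFinP; exact: conf_meas cf. Qed.

Let W0 x : 0 <= (W x)%:E.
Proof. by rewrite lee_fin; exact: confining_ge0 cf _. Qed.

Let VE : V = (fun x => W x - b)%R.
Proof. by apply/funext => x; rewrite VW addrK. Qed.

Let mV : measurable_fun setT (V : RR -> R).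
Proof. by rewrite VE; apply: measurable_funB => //; exact: (conf_meas cf). Qed.

Lemma V_integrableP (nu : probability RR R) :
  V_integrable V nu <-> \int[nu]_x (W x)%:E < +oo.
Proof.
split => h.
  apply: (@le_lt_trans _ _ (\int[nu]_x (b%:E + 1%:E * `|V x|%:E))).
    apply: integral_mono => x _; first exact: W0.
      by rewrite adde_ge0 ?mule_ge0// lee_fin.
    split => //; rewrite -EFinM -EFinD lee_fin mul1r VW [leLHS]addrC lerD2l.
    exact: ler_norm.
  rewrite integral_prob_affine//; first by rewrite mul1e lte_add_pinfty// ltry.
  by apply/measurable_EFinP; exact: (measurableT_comp (@normr_measurable R setT)).
apply: (@le_lt_trans _ _ (\int[nu]_x (b%:E + 1%:E * (W x)%:E))).
  apply: integral_mono => x _; first by rewrite lee_fin.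
    by rewrite adde_ge0 ?mule_ge0// lee_fin.
  split => //; rewrite -EFinM -EFinD lee_fin mul1r VE [leRHS]addrC.
  apply: (le_trans (ler_normB _ _)).
  by rewrite !ger0_norm//; exact: confining_ge0 cf _.
by rewrite integral_prob_affine// mul1e lte_add_pinfty// ltry.
Qed.

Lemma log_energy_potential (nu : probability RR R) :
  \int[nu]_x (W x)%:E < +oo ->
  - log_energy nu + \int[nu]_x (V x)%:E = energy W B nu - (B + b)%:E.
Proof.
move=> h; have f0 : 0 <= \int[nu]_x (W x)%:E by exact: integral_ge0.
pose w := fine (\int[nu]_x (W x)%:E).
have wE : \int[nu]_x (W x)%:E = w%:E by rewrite fineK// ge0_fin_numE.
have -> : \int[nu]_x (V x)%:E = (w - b)%:E.
  rewrite VE; under eq_integral do rewrite EFinB.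
  rewrite integralB_EFin//.
  - by rewrite wE EFinB; congr (_ - _); exact: integral_prob_cst.
  - apply/integrableP; split => //.
    rewrite (eq_integral (fun x : RR => (W x)%:E))// => x _.
    by rewrite gee0_abs//; exact: W0.
  - exact: finite_measure_integrable_cst.
rewrite (log_energyE cf wE).
have : 0 <= energy W B nu by exact: energy_ge0 cf nu.
case: (energy W B nu) => [r| |]//= _.
by congr (_%:E); ring.
Qed.

(** The near-minimisers stand in for the equilibrium measure. The constant [B + b] introduced by the
    kernel shifts the infimum here and cancels in the rate function. *)
Lemma equilibrium_energy : exists e : R, [/\ (0 <= e)%R,
  (forall nu : probability RR R, \int[nu]_x (W x)%:E < +oo -> e%:E <= energy W B nu),
  (forall eta : R, (0 < eta)%R -> exists2 nu : probability RR R,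
     \int[nu]_x (W x)%:E < +oo & energy W B nu < (e + eta)%:E) &
  cV V = (e - (B + b))%:E].
Proof.
pose S := [set energy W B nu | nu in [set nu : probability RR R | \int[nu]_x (W x)%:E < +oo]].
have S0 : 0 <= ereal_inf S.
  by apply: le_ereal_inf_tmp => _ [nu _ <-]; exact: energy_ge0 cf nu.
have [nu0 Wnu0 Enu0] := finite_energy_exists cf.
have Sfin : ereal_inf S < +oo.
  by apply: le_lt_trans Enu0; apply: ereal_inf_lbound; exists nu0.
have SE : ereal_inf S = (fine (ereal_inf S))%:E by rewrite fineK// ge0_fin_numE.
exists (fine (ereal_inf S)); split.
- exact: fine_ge0.
- by move=> nu Wnu; rewrite -SE; apply: ereal_inf_lbound; exists nu.
- move=> eta eta0; have : ereal_inf S < (fine (ereal_inf S) + eta)%:E.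
    by rewrite SE lte_fin ltrDl.
  by move=> /ereal_inf_lt[_ [nu Wnu <-] h]; exists nu.
rewrite EFinB -SE /cV; apply/eqP; rewrite eq_le; apply/andP; split.
  rewrite leeBrDr//; apply: le_ereal_inf_tmp => _ [nu Wnu <-].
  rewrite -leeBrDr// -(log_energy_potential Wnu); apply: ereal_inf_lbound.
  by exists nu => //; exact/V_integrableP.
apply: le_ereal_inf_tmp => _ [nu /V_integrableP Wnu <-].
rewrite log_energy_potential// leeB//.
by apply: ereal_inf_lbound; exists nu.
Qed.

Lemma joint_rateE (e c : R) (mu : probability RR R) :
  cV V = (e - (B + b))%:E -> M1plus p mu ->
  joint_rate V c mu = energy W B (tau c mu) - e%:E.
Proof.
move=> hc mu1; have h := M1plus_tau_finite cf c mu1.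
rewrite /joint_rate /rate asboolT; last exact/V_integrableP.
rewrite log_energy_potential// hc.
have : 0 <= energy W B (tau c mu) by exact: energy_ge0 cf _.
case: (energy W B (tau c mu)) => [r| |]//= _.
by congr (_%:E); ring.
Qed.

End rate_energy.

(** * Limits in the extended reals *)

Section ereal_limits.
Context {R : realType}.
Local Open Scope ereal_scope.

(** Monotone convergence along a filter; stated abstractly, it covers both the limit in [delta] and
    the joint limit in [(delta, delta')]. *)
Lemma cvg_ereal_inf_near T (F : set_system T) (FF : ProperFilter F)
    (f : T -> \bar R) (P : set T) :
  F P -> (forall x, P x -> \forall y \near F, f y <= f x) ->
  f @ F --> ereal_inf (f @` P).
Proof.
move=> FP fP; set l := ereal_inf _.
have lf : \forall y \near F, l <= f y.
  by apply: filterS FP => y Py; apply: ereal_inf_lbound; exists y.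
have fl r : l < r -> \forall y \near F, f y < r.
  move=> /ereal_inf_lt[_ [x Px <-] fxr].
  by apply: filterS (fP x Px) => y yx; exact: le_lt_trans fxr.
move: lf fl; case: l => [l| |] lf fl.
- have fl1 : \forall y \near F, f y < (l + 1)%:E by apply: fl; rewrite lte_fin ltrDl.
  apply/fine_cvgP; split.
    apply: filterS2 lf fl1 => y ly yl; rewrite fin_numElt.
    by rewrite (lt_le_trans _ ly) ?ltNyr// (lt_trans yl) ?ltry.
  apply/cvgrPdist_le => eps eps0.
  have fle : \forall y \near F, f y < (l + eps)%:E by apply: fl; rewrite lte_fin ltrDl.
  apply: filterS2 lf fle => y; rewrite /comp.
  case: (f y) => [r| |]//=; rewrite lee_fin lte_fin => lr rl.
  by rewrite ler_distlC; apply/andP; split; lra.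
- by apply/cvgeyPge => A; apply: filterS lf => y /(le_trans (leey _)).
- by apply/cvgeNyPle => A; apply: filterS (fl A%:E (ltNyr _)) => y /ltW.
Qed.

Lemma lee_of_upper_reals (x y : \bar R) :
  (forall t : R, x < t%:E -> y <= t%:E) -> y <= x.
Proof.
case: x => [x| |] h; last 2 first.
- exact: leey.
- move: y h => [y| |] h //; last exact: (h 0%R (ltNyr _)).
  by have := h _ (ltNyr (y - 1)%R); rewrite lee_fin lerDl oppr_ge0 ler10.
apply/lee_addgt0Pr => e e0; rewrite -EFinD; apply: h.
by rewrite lte_fin ltrDl.
Qed.

(** The limit being an infimum, one radius for each threshold [t] above [x] suffices, and the radius
    may depend on [t]. *)
Lemma cvg_at_right_inf (G : R -> \bar R) (x : \bar R) :
  (forall d d', (0 < d)%R -> (d <= d')%R -> G d <= G d') ->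
  (forall t : R, x < t%:E -> exists2 d, (0 < d)%R & G d <= t%:E) ->
  cvg (G @ (0%R : R)^'+) /\ lim (G @ (0%R : R)^'+) <= x.
Proof.
move=> ndG hx.
have cG : G @ (0%R : R)^'+ --> ereal_inf (G @` [set d | (0 < d)%R]).
  apply: cvg_ereal_inf_near; first exact: nbhs_right_gt.
  move=> d d0; have d1 : \forall y \near (0%R : R)^'+, (0 < y)%R by exact: nbhs_right_gt.
  by apply: filterS2 d1 (nbhs_right_le d0) => y y0; exact: ndG.
split; first by apply/cvg_ex; eexists; exact: cG.
rewrite (cvg_lim _ cG)//; apply: lee_of_upper_reals => t /hx[d d0 Gd].
by apply: le_trans Gd; apply: ereal_inf_lbound; exists d.
Qed.

Lemma cvg_at_right2_inf (G : R -> R -> \bar R) (x : \bar R) :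
  (forall d1 d1' d2 d2', (0 < d1)%R -> (d1 <= d1')%R -> (0 < d2)%R -> (d2 <= d2')%R ->
     G d1 d2 <= G d1' d2') ->
  (forall d1 d2, (0 < d1)%R -> (0 < d2)%R -> x <= G d1 d2) ->
  let L := (fun d : R * R => G d.1 d.2) @ filter_prod (0%R : R)^'+ (0%R : R)^'+ in
  cvg L /\ x <= lim L.
Proof.
move=> ndG hx L.
pose P := [set d : R * R | (0 < d.1)%R /\ (0 < d.2)%R].
have r0 : \forall y \near (0%R : R)^'+, (0 < y)%R by exact: nbhs_right_gt.
have cG : L --> ereal_inf ((fun d : R * R => G d.1 d.2) @` P).
  apply: cvg_ereal_inf_near.
    by exists ([set y : R | (0 < y)%R], [set y : R | (0 < y)%R]).
  move=> [d1 d2] [/= d10 d20].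
  exists ([set y : R | (0 < y)%R /\ (y <= d1)%R], [set y : R | (0 < y)%R /\ (y <= d2)%R]).
    split => /=.
      by apply: filterS2 r0 (nbhs_right_le d10) => y.
    by apply: filterS2 r0 (nbhs_right_le d20) => y.
  by move=> [y1 y2] /= [[? ?] [? ?]]; exact: ndG.
split; first by apply/cvg_ex; eexists; exact: cG.
rewrite (cvg_lim _ cG)//; apply: le_ereal_inf_tmp => _ [[d1 d2] [/= d10 d20] <-].
exact: hx.
Qed.

Lemma limn_esup_le_near (u : nat -> \bar R) (x : \bar R) :
  (\forall n \near \oo, u n <= x) -> limn_esup u <= x.
Proof.
move=> h; rewrite /limn_esup limf_esupE; apply: ge_ereal_inf.
exists (ereal_sup (u @` [set n | u n <= x])); first by exists [set n | u n <= x].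
by apply: ge_ereal_sup => _ [n /= un <-].
Qed.

Lemma limn_einf_ge_near (u : nat -> \bar R) (x : \bar R) :
  (\forall n \near \oo, x <= u n) -> x <= limn_einf u.
Proof.
move=> h; rewrite /limn_einf leeNr; apply: limn_esup_le_near.
by apply: filterS h => n; rewrite leeN2.
Qed.

Lemma le_limn_esup (u v : nat -> \bar R) : (forall n, u n <= v n) ->
  limn_esup u <= limn_esup v.
Proof.
move=> uv; rewrite /limn_esup !limf_esupE; apply: le_ereal_inf_tmp => _ [A oA <-].
apply: ge_ereal_inf; exists (ereal_sup (u @` A)); first by exists A.
apply: ge_ereal_sup => _ [n An <-]; apply: (le_trans (uv n)).
by apply: ereal_sup_ubound; exists n.
Qed.

Lemma le_limn_einf (u v : nat -> \bar R) : (forall n, u n <= v n) ->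
  limn_einf u <= limn_einf v.
Proof.
by move=> uv; rewrite /limn_einf leeN2; apply: le_limn_esup => n; rewrite leeN2.
Qed.

End ereal_limits.

(** * Large deviation bounds *)

Section gibbs_bounds.
Context {R : realType} (V : R -> R) (beta : R).
Hypothesis beta0 : 0 < beta.
Local Notation RR := (measurableTypeR R).
Local Open Scope ereal_scope.

Let density_integral_ge0 N (A : set (N.-tuple RR)) :
  0 <= \int[lebesgue_tuple N]_(lam in A) (gibbs_density V beta lam)%:E.
Proof. by apply: integral_ge0 => lam _; rewrite lee_fin gibbs_density_ge0. Qed.

Let Z_ge0 N : 0 <= partition_function V beta N := density_integral_ge0 setT.

Let gibbs_ge0 N (A : set (N.-tuple RR)) : 0 <= gibbs V beta A.
Proof. by rewrite mule_ge0// inve_ge0. Qed.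

Lemma log_gibbs_mono N (A A' : set (N.-tuple RR)) : A `<=` A' ->
  (2 / (beta * N%:R ^+ 2))%:E * lne (gibbs V beta A) <=
  (2 / (beta * N%:R ^+ 2))%:E * lne (gibbs V beta A').
Proof.
move=> AA'; apply: lee_wpmul2l.
  by rewrite lee_fin divr_ge0// mulr_ge0 ?exprn_ge0// ltW.
rewrite lee_lne ?in_itv/= ?leey ?andbT//.
apply: lee_wpmul2l; first by rewrite inve_ge0.
apply: integral_mono => lam Alam; rewrite ?lee_fin ?gibbs_density_ge0//.
by split; [exact: AA'|].
Qed.

(** The common factor [L] cancels in the quotient, and the scale [2 / (beta * N ^ 2)] leaves the
    difference of the energies. *)
Let scaled_lne N (L s t : R) : (0 < N)%N ->
  (2 / (beta * N%:R ^+ 2))%:E * lne ((expR (beta / 2 * (L - N%:R ^+ 2 * s)))%:E^-1 *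
     (expR (beta / 2 * (L - N%:R ^+ 2 * t)))%:E) = (s - t)%:E.
Proof.
move=> N0; have Nr : (N%:R != 0 :> R)%R by rewrite pnatr_eq0 -lt0n.
rewrite inver gt_eqF ?expR_gt0// -expRN -EFinM -expRD.
rewrite lne_EFin ?expR_gt0// expRK -EFinM; congr (_%:E).
by field; rewrite Nr gt_eqF.
Qed.

Lemma log_gibbs_le N (A : set (N.-tuple RR)) (L s t : R) : (0 < N)%N ->
  (expR (beta / 2 * (L - N%:R ^+ 2 * s)))%:E <= partition_function V beta N ->
  \int[lebesgue_tuple N]_(lam in A) (gibbs_density V beta lam)%:E <=
    (expR (beta / 2 * (L - N%:R ^+ 2 * t)))%:E ->
  (2 / (beta * N%:R ^+ 2))%:E * lne (gibbs V beta A) <= (s - t)%:E.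
Proof.
move=> N0 hZ hI; rewrite -(scaled_lne L s t N0); apply: lee_wpmul2l.
  by rewrite lee_fin divr_ge0// mulr_ge0 ?exprn_ge0// ltW.
have e0 (u : R) : 0 <= (expR u)%:E by rewrite lee_fin expR_ge0.
rewrite lee_lne ?in_itv/= ?leey ?andbT ?mule_ge0 ?inve_ge0//.
by apply: lee_pmul; rewrite ?inve_ge0// lee_pV2// inE.
Qed.

Lemma log_gibbs_ge N (A : set (N.-tuple RR)) (L s t : R) : (0 < N)%N ->
  partition_function V beta N <= (expR (beta / 2 * (L - N%:R ^+ 2 * s)))%:E ->
  (expR (beta / 2 * (L - N%:R ^+ 2 * t)))%:E <=
    \int[lebesgue_tuple N]_(lam in A) (gibbs_density V beta lam)%:E ->
  (s - t)%:E <= (2 / (beta * N%:R ^+ 2))%:E * lne (gibbs V beta A).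
Proof.
move=> N0 hZ hI; rewrite -(scaled_lne L s t N0); apply: lee_wpmul2l.
  by rewrite lee_fin divr_ge0// mulr_ge0 ?exprn_ge0// ltW.
have e0 (u : R) : 0 <= (expR u)%:E by rewrite lee_fin expR_ge0.
rewrite lee_lne ?in_itv/= ?leey ?andbT ?mule_ge0 ?inve_ge0//.
by apply: lee_pmul; rewrite ?inve_ge0// lee_pV2// inE.
Qed.

End gibbs_bounds.

Section large_deviations.
Context {R : realType} (p : nat) (W : R -> R) (a B : R).
Hypothesis cf : confining p W a B.
Variables (b beta : R) (V : R -> R).
Hypothesis VW : forall x, W x = V x + b.
Hypothesis b0 : 0 <= b.
Hypothesis beta0 : 0 < beta.
Local Notation RR := (measurableTypeR R).
Local Notation rate_seq A := (fun N : nat =>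
  (2 / (beta * N%:R ^+ 2))%:E * lne (gibbs V beta (A N : set (N.-tuple RR))))%E.
Local Open Scope ereal_scope.

Lemma ball_wasserstein_subset (mu : probability RR R) (d d' : R) : (d <= d')%R ->
  ball_wasserstein p mu d `<=` ball_wasserstein p mu d'.
Proof. by move=> dd' nu [? h]; split => //; apply: lt_le_trans h _; rewrite lee_fin. Qed.

Lemma event_lower (c : R) (mu : probability RR R) (d d' : R) : M1plus p mu ->
  (0 < d)%R -> (0 < d')%R ->
  - joint_rate V c mu <= limn_einf (rate_seq (fun N => [set lam |
     (order_stat lam N \in `[(c - d')%R, (c + d')%R])%R /\
     ball_wasserstein p mu d (gap_measure lam)])).
Proof.
move=> mu1 d0 d'0; have [e [e0 he _ hcV]] := equilibrium_energy cf VW b0.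
rewrite (joint_rateE cf VW b0 c hcV mu1).
have [Efin|] := ltP (energy W B (tau c mu)) +oo; last first.
  by rewrite leye_eq => /eqP ->; rewrite addye// leNye.
have Wfin := M1plus_tau_finite cf c mu1.
have EE : energy W B (tau c mu) = (fine (energy W B (tau c mu)))%:E.
  by rewrite fineK// ge0_fin_numE//; exact: energy_ge0 cf _.
rewrite EE -EFinB -EFinN; set E := fine _.
apply/lee_subgt0Pr => eta eta0; rewrite -EFinB.
have eta20 : (0 < eta / 2)%R by rewrite divr_gt0.
have [N1 hN1] := partition_function_upper cf VW beta0 e0 he eta20.
have [N2 hN2] := event_integral_lower cf VW beta0 mu1.1 Efin Wfin d0 d'0 eta20.
apply: limn_einf_ge_near; exists (maxn 1 (maxn N1 N2)) => // N /=.
rewrite !geq_max => /and3P[N0 NN1 NN2].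
rewrite (_ : (- (E - e) - eta)%R = ((e - eta / 2) - (E + eta / 2))%R); last by lra.
exact: (log_gibbs_ge beta0 N0 (hN1 N NN1) (hN2 N NN2)).
Qed.

(** The strict inequality leaves a margin [eta], spent in quarters on the truncation, the event, the
    near-minimiser and the partition function. *)
Lemma event_upper (F : set R) (mu : probability RR R) (t : R) : M1plus p mu ->
  - ereal_inf [set joint_rate V c mu | c in F] < t%:E ->
  exists2 d : R, (0 < d)%R &
  limn_esup (rate_seq (fun N => [set lam | F (order_stat lam N) /\
     ball_wasserstein p mu d (gap_measure lam)])) <= t%:E.
Proof.
move=> mu1 ht; have [e [e0 he heta hcV]] := equilibrium_energy cf VW b0.
have [eta eta0 hEt] : exists2 eta : R, (0 < eta)%R &
    forall c, F c -> (e - t + eta)%:E <= energy W B (tau c mu).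
  have [eta eta0 hr] : exists2 eta : R, (0 < eta)%R &
      (- t + eta)%:E <= ereal_inf [set joint_rate V c mu | c in F].
    move: ht; case: (ereal_inf _) => [r| |]//=.
    - rewrite lte_fin => rt; exists (r + t)%R; first by lra.
      by rewrite lee_fin; lra.
    - by move=> _; exists 1%R => //; rewrite leey.
  exists eta => // c Fc.
  have : (- t + eta)%:E <= joint_rate V c mu.
    by apply: (le_trans hr); apply: ereal_inf_lbound; exists c.
  rewrite (joint_rateE cf VW b0 c hcV mu1).
  case: (energy W B (tau c mu)) => [r| |]//=; first by rewrite !lee_fin; lra.
  by move=> _; rewrite leey.
have eta40 : (0 < eta / 4)%R by rewrite divr_gt0.
(* Cutting at 0 meets the sign condition of [event_integral_upper] and costs nothing, since
   truncated energies are nonnegative. *)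
pose t1 : R := Num.max 0%R (e - t + eta - eta / 4)%R.
have [m m0 hm] : exists2 m : R, (0 <= m)%R & forall c, F c -> t1%:E <= cut_energy W B mu m c.
  have cut0 (k u : R) : (0 <= k)%R -> 0 <= cut_energy W B mu k u.
    move=> k0; apply: integral_ge0 => x _; apply: integral_ge0 => y _.
    by rewrite lee_fin; exact: (kcut_ge0 cf).
  have [F0|F0] := pselect (F !=set0); last first.
    by exists 0%R => // c Fc; case: F0; exists c.
  have [m m0 hm] := cut_energy_uniform cf mu1 F0 hEt eta40.
  by exists m => // c Fc; rewrite /t1 EFin_max ge_max cut0// hm.
have t10 : (0 <= t1)%R by rewrite /t1 le_max lexx.
have [d d0 [N1 hN1]] := event_integral_upper cf VW beta0 t10 m0 eta40 hm.
have [nu Wnu Enu] := heta _ eta40.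
have [N2 hN2] := partition_function_lower cf VW beta0 (lt_trans Enu (ltry _)) Wnu eta40.
exists d => //; apply: limn_esup_le_near; exists (maxn 1 (maxn N1 N2)) => // N /=.
rewrite !geq_max => /and3P[N0 NN1 NN2].
apply: (le_trans (log_gibbs_le beta0 N0 (hN2 N NN2) (hN1 N NN1))).
have : (e - t + eta - eta / 4 <= t1)%R by rewrite /t1 le_max lexx orbT.
have : (fine (energy W B nu) <= e + eta / 4)%R.
  rewrite -lee_fin fineK; first exact: ltW.
  by rewrite ge0_fin_numE; [exact: lt_trans Enu (ltry _)|exact: energy_ge0 cf _].
by rewrite lee_fin; lra.
Qed.

End large_deviations.

Theorem proposition2p7 (R : realType) (p : nat) (V : {poly R}) (beta : R)
    (p_ge2 : (2 <= p)%N) (p_even : ~~ odd p) (V_deg : size V = p.+1)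
    (V_convex : convex_function (E := R^o) [set: R^o] (horner V))
    (beta_gt0 : 0 < beta) :
  (forall (c : R) (mu : probability (measurableTypeR R) R), M1plus p mu ->
     let G (delta delta' : R) : \bar R :=
       limn_einf (fun N : nat =>
         (2 / (beta * N%:R ^+ 2))%:E *
         lne (gibbs (horner V) beta
                [set lam : N.-tuple (measurableTypeR R) |
                   (order_stat lam N \in `[c - delta', c + delta'])%R /\
                   ball_wasserstein p mu delta (gap_measure lam)]))%E in
     let L := (fun d : R * R => G d.1 d.2) @ filter_prod 0^'+ 0^'+ in
     cvg L /\ (- joint_rate (horner V) c mu <= lim L)%E)
  /\
  (forall (F : set R) (mu : probability (measurableTypeR R) R),
     closed F -> M1plus p mu ->
     let G (delta : R) : \bar R :=
       limn_esup (fun N : nat =>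
         (2 / (beta * N%:R ^+ 2))%:E *
         lne (gibbs (horner V) beta
                [set lam : N.-tuple (measurableTypeR R) |
                   F (order_stat lam N) /\
                   ball_wasserstein p mu delta (gap_measure lam)]))%E in
     cvg (G @ 0^'+) /\
     (lim (G @ 0^'+) <=
        - ereal_inf [set joint_rate (horner V) c mu | c in F])%E).
Proof.
have Vc t x y : 0 <= t <= 1 ->
    V.[(1 - t) * x + t * y] <= (1 - t) * V.[x] + t * V.[y].
  move=> /andP[t0 t1]; have s0 : 0 <= 1 - t by rewrite subr_ge0.
  have s1 : 1 - t <= 1 by rewrite gerBl.
  rewrite -{2 4}(subKr 1 t).
  (* The parameter of [convex_function] weights the first point, hence the use of [1 - t] and the
     rewriting of [t] as [1 - (1 - t)]. *)
  exact: (V_convex (Itv01 s0 s1) x y (in_setT _) (in_setT _)).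
have [a [b [B [b0 cf]]]] := convex_even_poly_confining p_ge2 p_even V_deg Vc.
split=> [c mu mu1 G L|F mu _ mu1 G].
  apply: cvg_at_right2_inf => [d1 d1' d2 d2' d10 d11 d20 d22|d d' d0 d'0].
    apply: le_limn_einf => N; apply: (log_gibbs_mono _ beta_gt0) => lam [hc hb].
    split; last exact: ball_wasserstein_subset hb.
    by move: hc; rewrite !in_itv/= => /andP[? ?]; apply/andP; split; lra.
  exact: (event_lower cf _ b0 beta_gt0 c mu1 d0 d'0).
apply: cvg_at_right_inf => [d d' d0 dd'|t ht].
  apply: le_limn_esup => N; apply: (log_gibbs_mono _ beta_gt0) => lam [hc hb].
  by split => //; exact: ball_wasserstein_subset hb.
exact: (event_upper cf _ b0 beta_gt0 mu1 ht).
Qed.
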